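(* Let $\rho^{AB}$ be a density operator on a finite-dimensional Hilbert space $\mathcal{H}_A\otimes\mathcal{H}_B$, let $\phi^{RAB}=|\phi\rangle\langle\phi|^{RAB}$ be its canonical purification, let $\mathsf{X}$ be a finite reconstruction alphabet, and let $\mathcal{W}:\mathsf{X}\to\mathcal{D}(\mathcal{H}_R\otimes\mathcal{H}_B)$, $x\mapsto\mathcal{W}^{RB}_x$, be a classical-quantum posterior channel. Define $$\mathcal{A}(\rho^{AB},\mathcal{W}):=\Big\{P_X\in\mathcal{P}(\mathsf{X}):\ \sum_{x\in\mathsf{X}}P_X(x)\,\mathcal{W}^{RB}_x=\mathrm{Tr}_A\{\phi^{RAB}\}\Big\}.$$ If $\mathcal{A}(\rho^{AB},\mathcal{W})$ is non-empty, then every rate $R$ satisfying $$R\ \ge\ I(X;RB)_\sigma-I(X;B)_\sigma=I(X;R|B)_\sigma$$ for some $P_X\in\mathcal{A}(\rho^{AB},\mathcal{W})$ is achievable (in the sense defined in the context), where the quantum mutual informations are computed with respect to the classical-quantum state $$\sigma^{XRB}:=\sum_{x\in\mathsf{X}}P_X(x)\,|x\rangle\langle x|^X\otimes\mathcal{W}^{RB}_x,$$ with $\{|x\rangle\}_{x\in\mathsf{X}}$ an orthonormal basis of a Hilbert space $\mathcal{H}_X$ of dimension $|\mathsf{X}|$.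
   Context: $\mathcal{D}(\mathcal{H})$ denotes the set of density operators on $\mathcal{H}$, $\mathcal{P}(\mathsf{X})$ the set of probability distributions on $\mathsf{X}$, and $[\Theta]=\{1,\dots,\Theta\}$. The system $R$ is a reference system (isomorphic to $AB$) purifying $\rho^{AB}$. For $x^n=(x_1,\dots,x_n)\in\mathsf{X}^n$, $\mathcal{W}^{RB}_{x^n}:=\bigotimes_{i=1}^n\mathcal{W}^{RB}_{x_i}$ on $R^nB^n$. An $(n,\Theta)$ lossy quantum-classical compression protocol with quantum side information consists of: (i) an encoding POVM $\{\Omega_m\}_{m=1}^{\Theta}$ on $\mathcal{H}_A^{\otimes n}$; (ii) for each $m\in[\Theta]$, a decoding POVM $\{\Lambda^{(m)}_k\}_{k=1}^{\bar\Theta}$ on $\mathcal{H}_B^{\otimes n}$ (for some positive integer $\bar\Theta$); (iii) a decoding map $f:[\Theta]\times[\bar\Theta]\to\mathsf{X}^n$, written $f(m,k)=x^n(m,k)$. For each $(m,k)$ define the unnormalized operator on $R^nB^n$ $$\tau^{R^nB^n}_{m,k}:=\big(I^{R^n}\otimes\sqrt{\Lambda^{(m)}_k}\big)\,\mathrm{Tr}_{A^n}\{(I^{R^nB^n}\otimes\Omega_m)(\phi^{RAB})^{\otimes n}\}\,\big(I^{R^n}\otimes\sqrt{\Lambda^{(m)}_k}\big),$$ and $Q(m,k):=\mathrm{Tr}\{\tau_{m,k}\}=\mathrm{Tr}\{(\Omega_m\otimes\Lambda^{(m)}_k)(\rho^{AB})^{\otimes n}\}$. The error of the protocol is $$\Xi:=\Big\|\sum_{m,k}|x^n(m,k)\rangle\langle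 x^n(m,k)|\otimes\tau^{R^nB^n}_{m,k}-\sum_{m,k}Q(m,k)\,|x^n(m,k)\rangle\langle x^n(m,k)|\otimes\mathcal{W}^{RB}_{x^n(m,k)}\Big\|_1,$$ with $\{|x^n\rangle\}$ the product orthonormal basis of $\mathcal{H}_X^{\otimes n}$. A rate $R$ is achievable if for every $\epsilon>0$ and all sufficiently large $n$ there is an $(n,\Theta)$ such protocol with $\frac1n\log\Theta\le R+\epsilon$ and $\Xi\le\epsilon$. *)

(* Defs.v *)
(* mathcomp-algebra (matrices, spectral theorem),
   mathcomp-real-closed (complex numbers R[i]), mathcomp-analysis (ln). *)
From mathcomp Require Import all_boot all_algebra all_classical all_reals.
From mathcomp Require Import complex exp.
From mathcomp Require Export spectral.

Set Implicit Arguments.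
Unset Strict Implicit.
Unset Printing Implicit Defensive.

Import GRing.Theory Num.Theory Num.Def.
Local Open Scope ring_scope.

Section Quantum.
Variable R : realType.
Local Notation C := R[i].

(* Operators on the Hilbert space C^T with orthonormal basis indexed by a
   finite type T, represented as #|T| x #|T| complex matrices. *)
Definition op (T : finType) := 'M[C]_#|T|.

Definition ent {T : finType} (M : op T) (x y : T) : C :=
  M (enum_rank x) (enum_rank y).

Definition mkop {T : finType} (F : T -> T -> C) : op T :=
  \matrix_(i, j) F (enum_val i) (enum_val j).

(* adjoint (conjugate transpose) *)
Definition adj {T : finType} (M : op T) : op T := (map_mx conjC M)^T.

(* positive semidefinite: <v|M|v> >= 0 for every vector v *)
Definition psd {T : finType} (M : op T) : Prop :=
  forall v : 'cV[C]_#|T|, 0 <= ((map_mx conjC v)^T *m M *m v) ord0 ord0.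

(* density operator *)
Definition density {T : finType} (M : op T) : Prop := psd M /\ \tr M = 1.

(* POVM indexed by a finite type I *)
Definition povm {I T : finType} (E : I -> op T) : Prop :=
  (forall i, psd (E i)) /\ \sum_i E i = 1%:M.

(* square root of a positive semidefinite operator, via the spectral
   decomposition M = U^-1 diag(d) U (U unitary) *)
Definition msqrt {T : finType} (M : op T) : op T :=
  invmx (spectralmx M) *m diag_mx (\row_i sqrtC (spectral_diag M ord0 i))
    *m spectralmx M.

(* trace norm ||M||_1 = Tr sqrt(M^dagger M) *)
Definition trnorm {T : finType} (M : op T) : R :=
  complex.Re (\tr (msqrt (adj M *m M))).

(* von Neumann entropy (natural logarithm), through the eigenvalues *)
Definition eta (t : R) : R := if t <= 0 then 0 else - (t * ln t).
Definition vN {T : finType} (M : op T) : R :=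
  \sum_i eta (complex.Re (spectral_diag M ord0 i)).

(* tensor product, identity, partial traces *)
Definition tens {S T : finType} (M : op S) (N : op T) : op (S * T)%type :=
  @mkop (S * T)%type (fun p q => ent M p.1 q.1 * ent N p.2 q.2).
Definition idop (T : finType) : op T := 1%:M.
Definition ptrace1 {S T : finType} (M : op (S * T)%type) : op T :=
  @mkop T (fun t t' => \sum_s ent M (s, t) (s, t')).
Definition ptrace2 {S T : finType} (M : op (S * T)%type) : op S :=
  @mkop S (fun s s' => \sum_t ent M (s, t) (s', t)).
Definition ptrace_mid {S T U : finType} (M : op (S * (T * U))%type) : op (S * U)%type :=
  @mkop (S * U)%type (fun p q => \sum_t ent M (p.1, (t, p.2)) (q.1, (t, q.2))).
(* |x><x| *)
Definition proj {X : finType} (x : X) : op X :=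
  @mkop X (fun y z => ((y == x) && (z == x))%:R).

(* Canonical purification of rho^{AB}, with reference system R = AB:
   |phi> = (I_R (x) sqrt rho) sum_k |k>_R |k>_{AB}; the operator
   |phi><phi| is laid out on A (x) (R (x) B). *)
Definition purif {A B : finType} (rho : op (A * B)%type) : op (A * ((A * B) * B))%type :=
  let psi := fun (a : A) (r : A * B) (b : B) => ent (msqrt rho) (a, b) r in
  @mkop (A * ((A * B) * B))%type (fun p q => psi p.1 p.2.1 p.2.2 * (psi q.1 q.2.1 q.2.2)^*).

Definition tup (n : nat) (T : finType) := {ffun 'I_n -> T}.

(* (phi^{RAB})^{(x) n}, laid out on A^n (x) (R^n (x) B^n) *)
Definition purif_pow {A B : finType} (rho : op (A * B)%type) (n : nat) :
  op (tup n A * (tup n (A * B)%type * tup n B))%type :=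
  @mkop (tup n A * (tup n (A * B)%type * tup n B))%type (fun p q => \prod_(i < n)
    ent (purif rho) (p.1 i, (p.2.1 i, p.2.2 i)) (q.1 i, (q.2.1 i, q.2.2 i))).

(* W_{x^n} = (x)_i W_{x_i}, laid out on R^n (x) B^n *)
Definition Wpow {X Rs B : finType} (W : X -> op (Rs * B)%type) (n : nat)
  (x : tup n X) : op (tup n Rs * tup n B)%type :=
  @mkop (tup n Rs * tup n B)%type (fun p q => \prod_(i < n) ent (W (x i)) (p.1 i, p.2 i) (q.1 i, q.2 i)).

(* error Xi of an (n, Theta) protocol *)
Definition prot_error {A B X : finType} (rho : op (A * B)%type)
  (W : X -> op ((A * B) * B)%type) (n Th Thb : nat)
  (Om : 'I_Th -> op (tup n A)) (Lam : 'I_Th -> 'I_Thb -> op (tup n B))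
  (f : 'I_Th -> 'I_Thb -> tup n X) : R :=
  let sL := fun m k => tens (idop (tup n (A * B)%type)) (msqrt (Lam m k)) in
  let tau := fun m k =>
    sL m k *m ptrace1 (tens (Om m) (idop (tup n (A * B)%type * tup n B)%type) *m purif_pow rho n) *m sL m k in
  let Q := fun m k => \tr (tau m k) in
  trnorm (\sum_m \sum_k tens (proj (f m k)) (tau m k)
          - \sum_m \sum_k Q m k *: tens (proj (f m k)) (Wpow W (f m k))).

Definition achievable {A B X : finType} (rho : op (A * B)%type)
  (W : X -> op ((A * B) * B)%type) (r : R) : Prop :=
  forall eps : R, 0 < eps -> exists N : nat, forall n : nat, (N <= n)%N ->
    exists (Th Thb : nat) (Om : 'I_Th -> op (tup n A))
           (Lam : 'I_Th -> 'I_Thb -> op (tup n B))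
           (f : 'I_Th -> 'I_Thb -> tup n X),
      [/\ (0 < Thb)%N, povm Om, (forall m, povm (Lam m)),
          ln (Th%:R) / n%:R <= r + eps
        & prot_error rho W Om Lam f <= eps].

(* probability distributions on X and the set A(rho, W) *)
Definition is_distr {X : finType} (P : X -> R) : Prop :=
  (forall x, 0 <= P x) /\ \sum_x P x = 1.

Definition in_calA {A B X : finType} (rho : op (A * B)%type)
  (W : X -> op ((A * B) * B)%type) (P : X -> R) : Prop :=
  is_distr P /\ \sum_x (P x)%:C%C *: W x = ptrace1 (purif rho).

(* sigma^{XRB} and the mutual informations *)
Definition cq_state {X T : finType} (P : X -> R) (W : X -> op T) : op (X * T)%type :=
  \sum_x (P x)%:C%C *: tens (proj x) (W x).

Definition mutinf {S T : finType} (M : op (S * T)%type) : R :=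
  vN (ptrace2 M) + vN (ptrace1 M) - vN M.

Definition I_X_RB {X Rs B : finType} (P : X -> R) (W : X -> op (Rs * B)%type) : R :=
  mutinf (cq_state P W).
Definition I_X_B {X Rs B : finType} (P : X -> R) (W : X -> op (Rs * B)%type) : R :=
  mutinf (ptrace_mid (cq_state P W)).

End Quantum.

(* Main.v *)
(** Random coding with typical projectors, in which every estimate is kept
    linear so that expectations over codebooks are immediate.  A Hermitian
    operator has trace norm at most [c] as soon as it is written [P - Q] with
    [P, Q >= 0] and [tr P + tr Q <= c].

    Covering: for [M * K >> exp (n I(X;RB))] independent codewords the average
    of the [W_x] is at most [phi^RB + Delta] with [tr Delta] small, by a second
    moment bound in the typical subspace.  Since [A] purifies [RB], a
    pretty-good measurement on [A] then steers [RB] to a family close to the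
    [W_x / (M K)].

    Packing: the codewords are put in [M] bins of [K << exp (n I(X;B))]
    codewords, and the Hayashi-Nagaoka inequality shows that the codeword of a
    given bin can be read off [B] with small error, hence with small
    disturbance.  Only the bin is sent, at rate [I(X;RB) - I(X;B)].

    That this rate is nonnegative (otherwise even a single bin would exceed
    it) is obtained operationally: a code decodable from [B] cannot have more
    than about [exp (n I(X;RB))] codewords. *)
Require Import Defs.
From mathcomp Require Import all_boot all_order all_algebra all_classical all_reals.
From mathcomp Require Import complex sequences exp.
From mathcomp Require Import ring lra.
Import GRing.Theory Num.Theory Num.Def Order.TTheory.
Set Implicit Arguments.
Unset Strict Implicit.
Unset Printing Implicit Defensive.
Local Open Scope ring_scope.

(** * Positive semidefinite matrices *)

(** Gentle measurement and the rank bound on the trace norm usually produce square roots, which do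
    not commute with the average over codebooks. Here each [sqrt (a b)] is replaced by
    [(t a + b / t) / 2] with a free parameter; [t], [u] and [s] are all of this kind, and they are
    fixed, independently of the block length, only at the very end. A small multiple of the identity
    is added under every inverse square root, so that no supports or pseudo-inverses occur; this
    costs the error terms [d]. The decoder sees the sum of all states steered into its bin, so the
    deviations are split into positive and negative parts that are measured separately: a
    measurement distributes the trace of each part over its outcomes, and the number of outcomes
    never multiplies the error. Covering and packing must hold for one and the same codebook, which
    is why their errors are added before averaging. *)

Section Entries.
Variables (K : pzRingType) (m n : nat).
Implicit Types M N : 'M[K]_(m, n).

Lemma addmxE M N i j : (M + N) i j = M i j + N i j.
Proof. by rewrite mxE. Qed.

Lemma oppmxE M i j : (- M) i j = - M i j.
Proof. by rewrite mxE. Qed.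

Lemma scalemxE a M i j : (a *: M) i j = a * M i j.
Proof. by rewrite mxE. Qed.

Lemma zeromxE i j : (0 : 'M[K]_(m, n)) i j = 0.
Proof. by rewrite mxE. Qed.

Definition mxlinE := (addmxE, oppmxE, scalemxE, zeromxE).
End Entries.

Ltac mxlin := apply/matrixP => ? ?; rewrite ?mxlinE; ring.

Section Psd.
Variable C : numClosedFieldType.

Definition hadj {m n} (M : 'M[C]_(m, n)) : 'M[C]_(n, m) := (map_mx conjC M)^T.
Local Notation "M ^H" := (hadj M) (at level 8, format "M ^H").

Lemma hadjE m n (M : 'M[C]_(m, n)) i j : M^H i j = (M j i)^*.
Proof. by rewrite !mxE. Qed.

Lemma hadjM m n p (M : 'M[C]_(m, n)) (N : 'M[C]_(n, p)) : (M *m N)^H = N^H *m M^H.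
Proof. by rewrite /hadj map_mxM trmx_mul. Qed.

Lemma hadjK m n (M : 'M[C]_(m, n)) : M^H^H = M.
Proof. by apply/matrixP=> i j; rewrite !hadjE conjCK. Qed.

Lemma hadjD m n (M N : 'M[C]_(m, n)) : (M + N)^H = M^H + N^H.
Proof. by apply/matrixP=> i j; rewrite !mxE rmorphD. Qed.

Lemma hadjB m n (M N : 'M[C]_(m, n)) : (M - N)^H = M^H - N^H.
Proof. by apply/matrixP=> i j; rewrite !mxE rmorphB. Qed.

Lemma hadjN m n (M : 'M[C]_(m, n)) : (- M)^H = - M^H.
Proof. by apply/matrixP=> i j; rewrite !mxE rmorphN. Qed.

Lemma hadjZ m n (a : C) (M : 'M[C]_(m, n)) : (a *: M)^H = a^* *: M^H.
Proof. by apply/matrixP=> i j; rewrite !mxE rmorphM. Qed.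

Lemma hadj1 n : (1%:M : 'M[C]_n)^H = 1%:M.
Proof. by rewrite /hadj map_mx1 trmx1. Qed.

(* A variant rather than a definition, so that [//] does not unfold it. *)
Variant psdmx {n} (M : 'M[C]_n) : Prop :=
  PsdMx of forall v : 'cV[C]_n, 0 <= (v^H *m M *m v) ord0 ord0.

Lemma psdmxP n (M : 'M[C]_n) :
  psdmx M <-> forall v : 'cV[C]_n, 0 <= (v^H *m M *m v) ord0 ord0.
Proof. by split=> [[]|]. Qed.

Lemma psdmx0 n : psdmx (0 : 'M[C]_n).
Proof. by split=> v; rewrite mulmx0 mul0mx mxE. Qed.

Lemma psdmxD n (M N : 'M[C]_n) : psdmx M -> psdmx N -> psdmx (M + N).
Proof. by move=> [hM] [hN]; split=> v; rewrite mulmxDr mulmxDl mxE addr_ge0. Qed.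

Lemma psdmxZ n (a : C) (M : 'M[C]_n) : 0 <= a -> psdmx M -> psdmx (a *: M).
Proof. by move=> ha [hM]; split=> v; rewrite -scalemxAr -scalemxAl mxE mulr_ge0. Qed.

Lemma psdmx_sum n (I : finType) (P : pred I) (F : I -> 'M[C]_n) :
  (forall i, P i -> psdmx (F i)) -> psdmx (\sum_(i | P i) F i).
Proof.
move=> h; apply: (big_ind (@psdmx n)) => //; first exact: psdmx0.
by move=> M N; apply: psdmxD.
Qed.

Lemma psdmx_congr m n (A : 'M[C]_(m, n)) (M : 'M[C]_n) :
  psdmx M -> psdmx (A *m M *m A^H).
Proof. by move=> [h]; split=> v; have := h (A^H *m v); rewrite hadjM hadjK !mulmxA. Qed.

Lemma psdmx1 n : psdmx (1%:M : 'M[C]_n).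
Proof.
split=> v; rewrite mulmx1 mxE sumr_ge0// => i _; rewrite hadjE mulrC.
exact: mul_conjC_ge0.
Qed.

Lemma psdmx_gram m n (A : 'M[C]_(m, n)) : psdmx (A *m A^H).
Proof. by have := psdmx_congr A (@psdmx1 n); rewrite mulmx1. Qed.

Lemma psdmx_diag n (M : 'M[C]_n) i : psdmx M -> 0 <= M i i.
Proof.
case=> /(_ (delta_mx i ord0)).
have -> : (delta_mx i ord0 : 'cV[C]_n)^H = delta_mx ord0 i.
  by apply/matrixP=> a b; rewrite hadjE !mxE rmorph_nat andbC.
by rewrite -rowE -colE !mxE.
Qed.

(** Polarization: the values at [c = 1] and [c = 'i] determine the off-diagonal entries. *)
Lemma qf_delta2 n (N : 'M[C]_n) i j (c : C) :
  let v : 'cV[C]_n := delta_mx i ord0 + c *: delta_mx j ord0 in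
  (v^H *m N *m v) ord0 ord0 = N i i + c * N i j + c^* * N j i + c^* * c * N j j.
Proof.
move=> v; rewrite {}/v; have hd k : (delta_mx k ord0 : 'cV[C]_n)^H = delta_mx ord0 k.
  by apply/matrixP=> a b; rewrite hadjE !mxE rmorph_nat andbC.
rewrite hadjD hadjZ !hd !mulmxDl !mulmxDr -!scalemxAl -!scalemxAr.
have he k l : ((delta_mx ord0 k : 'rV[C]_n) *m N *m (delta_mx l ord0 : 'cV[C]_n)) ord0 ord0 = N k l.
  by rewrite -rowE -colE !mxE.
by rewrite !mxlinE !he; ring.
Qed.

(** Being nonnegative in [C] includes being real, so the quadratic form of [M - M^H] vanishes, and
    polarization kills each of its entries. *)
Lemma psdmx_herm n (M : 'M[C]_n) : psdmx M -> M^H = M.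
Proof.
move=> [h]; pose N := M - M^H.
have hN (v : 'cV[C]_n) : (v^H *m N *m v) ord0 ord0 = 0.
  have r : ((v^H *m M *m v) ord0 ord0)^* = (v^H *m M *m v) ord0 ord0.
    by apply/CrealP/ger0_real.
  rewrite /N mulmxBr mulmxBl mxE [X in _ + X]mxE -[X in X - _]r -hadjE.
  by rewrite !hadjM hadjK mulmxA subrr.
have hii i : N i i = 0.
  by have := hN (delta_mx i ord0 + 0 *: delta_mx i ord0); rewrite qf_delta2 rmorph0 !mul0r !addr0.
apply/eqP; rewrite eq_sym -subr_eq0 -/N; apply/eqP/matrixP=> i j; rewrite [RHS]mxE.
have h1 := hN (delta_mx i ord0 + 1 *: delta_mx j ord0).
have h2 := hN (delta_mx i ord0 + 'i *: delta_mx j ord0).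
move: h1 h2; rewrite !qf_delta2 !hii rmorph1 conjCi !mulr0 !mul1r !addr0 !add0r => /eqP.
rewrite addr_eq0 => /eqP -> /eqP; rewrite mulrN mulNr -opprD oppr_eq0 -mulrDr mulf_eq0.
rewrite (negPf (neq0Ci _)) /= -mulr2n mulrn_eq0 /= => /eqP ->; exact: oppr0.
Qed.

(** * Functional calculus *)

Definition sfun {n} (f : C -> C) (M : 'M[C]_n) : 'M[C]_n :=
  invmx (spectralmx M) *m diag_mx (\row_i f (spectral_diag M ord0 i)) *m spectralmx M.

Lemma spectralmx_inv n (M : 'M[C]_n) : invmx (spectralmx M) = (spectralmx M)^H.
Proof.
rewrite invmx_unitary ?spectral_unitarymx//.
by apply/matrixP=> i j; rewrite !mxE.
Qed.

Lemma spectralmx_mulV n (M : 'M[C]_n) : spectralmx M *m (spectralmx M)^H = 1%:M.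
Proof. by rewrite -spectralmx_inv mulmxV ?spectral_unit. Qed.

Lemma spectralmx_Vmul n (M : 'M[C]_n) : (spectralmx M)^H *m spectralmx M = 1%:M.
Proof. by rewrite -spectralmx_inv mulVmx ?spectral_unit. Qed.

Lemma sfunM n f g (M : 'M[C]_n) : sfun f M *m sfun g M = sfun (fun x => f x * g x) M.
Proof.
pose U := spectralmx M; pose d (f' : C -> C) : 'M[C]_n := diag_mx (\row_i f' (spectral_diag M ord0 i)).
have -> : sfun f M *m sfun g M = invmx U *m (d f *m (U *m invmx U) *m d g) *m U.
  by rewrite /sfun -/U !mulmxA.
rewrite mulmxV ?spectral_unit// mulmx1 mulmx_diag.
by congr (_ *m diag_mx _ *m _); apply/rowP=> i; rewrite !mxE.
Qed.

Lemma sfunD n f g (M : 'M[C]_n) : sfun f M + sfun g M = sfun (fun x => f x + g x) M.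
Proof.
rewrite /sfun -mulmxDl -mulmxDr -raddfD.
by congr (_ *m diag_mx _ *m _); apply/rowP=> i; rewrite !mxE.
Qed.

Lemma sfun_cst n (c : C) (M : 'M[C]_n) : sfun (fun => c) M = c%:M.
Proof.
rewrite /sfun (_ : \row_i c = const_mx c); last by apply/rowP=> i; rewrite !mxE.
by rewrite diag_const_mx mul_mx_scalar -scalemxAl mulVmx ?spectral_unit// scale_scalar_mx mulr1.
Qed.

Lemma eq_sfun n f g (M : 'M[C]_n) :
  (forall i, f (spectral_diag M ord0 i) = g (spectral_diag M ord0 i)) -> sfun f M = sfun g M.
Proof. by move=> h; congr (_ *m diag_mx _ *m _); apply/rowP=> i; rewrite !mxE h. Qed.

Lemma herm_normal n (M : 'M[C]_n) : M^H = M -> M \is normalmx.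
Proof.
move=> h; apply/normalmxP; have -> : map_mx conjC M^T = M.
  by rewrite -[RHS]h /hadj map_trmx.
by [].
Qed.

Lemma sfun_id n (M : 'M[C]_n) : M^H = M -> sfun id M = M.
Proof.
move=> /herm_normal/orthomx_spectralP {2}->; congr (_ *m diag_mx _ *m _).
by apply/rowP=> i; rewrite mxE.
Qed.

Lemma hadj_sfunV n (M : 'M[C]_n) : M^H = M ->
  M *m (spectralmx M)^H = (spectralmx M)^H *m diag_mx (spectral_diag M).
Proof.
move=> h; rewrite -{1}(sfun_id h) /sfun spectralmx_inv -!mulmxA spectralmx_mulV mulmx1.
by congr (_ *m diag_mx _); apply/rowP=> i; rewrite mxE.
Qed.

Lemma spectral_diagE n (M : 'M[C]_n) i : M^H = M ->
  spectral_diag M ord0 i = (spectralmx M *m M *m (spectralmx M)^H) i i.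
Proof.
by move=> h; rewrite -mulmxA hadj_sfunV// mulmxA spectralmx_mulV mul1mx !mxE eqxx mulr1n.
Qed.

Lemma psdmx_eig_ge n (M : 'M[C]_n) (d : C) i :
  M^H = M -> psdmx (M - d%:M) -> d <= spectral_diag M ord0 i.
Proof.
move=> hM /(psdmx_congr (spectralmx M))/(psdmx_diag i).
rewrite mulmxBr mulmxBl mxE -spectral_diagE// mul_mx_scalar -scalemxAl spectralmx_mulV.
by rewrite !mxE eqxx mulr1 subr_ge0.
Qed.

Lemma psdmx_eig_ge0 n (M : 'M[C]_n) i : psdmx M -> 0 <= spectral_diag M ord0 i.
Proof.
by move=> h; apply: psdmx_eig_ge; rewrite ?psdmx_herm// raddf0 subr0.
Qed.

Lemma psdmx_diag_mx n (d : 'rV[C]_n) : (forall i, 0 <= d ord0 i) -> psdmx (diag_mx d).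
Proof.
move=> h; split=> v; rewrite mxE sumr_ge0// => i _; rewrite mul_mx_diag !mxE mulrAC.
by rewrite mulr_ge0// mulrC mul_conjC_ge0.
Qed.

Lemma sfun_psd n f (M : 'M[C]_n) :
  (forall i, 0 <= f (spectral_diag M ord0 i)) -> psdmx (sfun f M).
Proof.
move=> h; have := @psdmx_diag_mx _ (\row_i f (spectral_diag M ord0 i)) _.
rewrite /sfun spectralmx_inv => /(_ _)/(psdmx_congr (spectralmx M)^H); rewrite hadjK.
by apply => i; rewrite mxE.
Qed.

(** Convertible to [msqrt], so that facts about it apply to the protocol without translation. *)
Definition sqrtmx {n} (M : 'M[C]_n) := sfun sqrtC M.

Lemma sqrtmx_psd n (M : 'M[C]_n) : psdmx M -> psdmx (sqrtmx M).
Proof. by move=> h; apply: sfun_psd => i; rewrite sqrtC_ge0 psdmx_eig_ge0. Qed.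

Lemma sqrtmxK n (M : 'M[C]_n) : psdmx M -> sqrtmx M *m sqrtmx M = M.
Proof.
move=> h; rewrite /sqrtmx sfunM -[RHS]sfun_id ?psdmx_herm//.
by apply: eq_sfun => i; rewrite -expr2 sqrtCK.
Qed.

Lemma sqrtmx_herm n (M : 'M[C]_n) : psdmx M -> (sqrtmx M)^H = sqrtmx M.
Proof. by move/sqrtmx_psd/psdmx_herm. Qed.

(** Applied only to operators that dominate some [d%:M] with [d > 0], where it is a true inverse of
    the square root. *)
Definition isqrtmx {n} (M : 'M[C]_n) := sfun (fun x => (sqrtC x)^-1) M.

Section Positive.
Variables (n : nat) (M : 'M[C]_n) (d : C).
Hypotheses (d0 : 0 < d) (hM : psdmx (M - d%:M)).

Lemma posmx_psd : psdmx M.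
Proof.
have : psdmx ((M - d%:M) + d *: 1%:M).
  by apply: psdmxD => //; apply: psdmxZ (@psdmx1 _); apply: ltW.
by rewrite scalemx1 subrK.
Qed.

Lemma posmx_eig i : 0 < spectral_diag M ord0 i.
Proof. by apply: lt_le_trans d0 (psdmx_eig_ge _ _ hM); rewrite psdmx_herm//; exact: posmx_psd. Qed.

Lemma isqrtmx_psd : psdmx (isqrtmx M).
Proof. by apply: sfun_psd => i; rewrite invr_ge0 sqrtC_ge0 ltW// posmx_eig. Qed.

Lemma isqrtmx_herm : (isqrtmx M)^H = isqrtmx M.
Proof. exact: psdmx_herm isqrtmx_psd. Qed.

Lemma isqrtmxK : isqrtmx M *m sqrtmx M = 1%:M.
Proof.
rewrite sfunM -(sfun_cst 1 M); apply: eq_sfun => i.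
by rewrite mulVf// sqrtC_eq0 gt_eqF// posmx_eig.
Qed.

Lemma sqrtmx_isqrt : sqrtmx M *m isqrtmx M = 1%:M.
Proof. by rewrite -isqrtmxK !sfunM; apply: eq_sfun => i; rewrite mulrC. Qed.

Lemma isqrtmx_mul : isqrtmx M *m M = sqrtmx M.
Proof. by rewrite -{2}(sqrtmxK posmx_psd) mulmxA isqrtmxK mul1mx. Qed.

Lemma isqrtmx_congr : isqrtmx M *m M *m isqrtmx M = 1%:M.
Proof. by rewrite isqrtmx_mul sqrtmx_isqrt. Qed.

End Positive.

Lemma herm_psdmx n (M : 'M[C]_n) : M^H = M ->
  (forall i, 0 <= spectral_diag M ord0 i) -> psdmx M.
Proof. by move=> hM h; rewrite -(sfun_id hM); apply: sfun_psd. Qed.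

(** The quadratic form at [v] is the squared norm of [sqrtmx M *m v]. *)
Lemma psdmx_ker n (M : 'M[C]_n) (v : 'cV[C]_n) : psdmx M ->
  (v^H *m M *m v) ord0 ord0 = 0 -> M *m v = 0.
Proof.
move=> hM h; have hz : (sqrtmx M *m v)^H *m (sqrtmx M *m v) = v^H *m M *m v.
  by rewrite hadjM sqrtmx_herm// -[in RHS](sqrtmxK hM) !mulmxA.
suff e : sqrtmx M *m v = 0 by rewrite -(sqrtmxK hM) -mulmxA e mulmx0.
move: h; rewrite -hz mxE => /psumr_eq0P h; apply/colP=> i; rewrite [RHS]mxE.
have /(_ i isT) : forall i, true -> (sqrtmx M *m v)^H ord0 i * (sqrtmx M *m v) i ord0 = 0.
  by apply: h => j _; rewrite hadjE mulrC mul_conjC_ge0.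
by rewrite hadjE mulrC => /eqP; rewrite mul_conjC_eq0 => /eqP.
Qed.

(* An eigenvector [v] of [B - A] with eigenvalue [e < 0] satisfies
   [v^H (B^2 - A^2) v = e v^H (A + B) v], so [A v = B v = 0] and [e v = 0]. *)
Lemma sqr_mono n (A B : 'M[C]_n) :
  psdmx A -> psdmx B -> psdmx (B *m B - A *m A) -> psdmx (B - A).
Proof.
move=> hA hB hAB; have hH : (B - A)^H = B - A by rewrite hadjB !psdmx_herm.
apply: herm_psdmx => // i; set e := spectral_diag _ _ _.
pose v := col i (spectralmx (B - A))^H.
have ev : (B - A) *m v = e *: v.
  rewrite /v colE mulmxA hadj_sfunV// -mulmxA -colE.
  rewrite (_ : col i _ = e *: delta_mx i ord0) ?scalemxAr -?colE//.
  by apply/colP=> k; rewrite !mxE; case: eqP => [->|_]; rewrite ?mulr1 ?mulr0 ?mulr1n.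
have nv : (v^H *m v) ord0 ord0 = 1.
  have /matrixP/(_ i i) := spectralmx_mulV (B - A); rewrite !mxE eqxx mulr1n => <-.
  by apply: eq_bigr => k _; rewrite !mxE conjCK.
have e_real : e \is Num.real.
  apply/CrealP; move: (congr1 (fun M => (v^H *m M) ord0 ord0) ev) => h1.
  have : ((v^H *m ((B - A) *m v)) ord0 ord0)^* = (v^H *m ((B - A) *m v)) ord0 ord0.
    by rewrite -hadjE !hadjM hadjK hH mulmxA.
  by rewrite h1 -scalemxAr mxE nv mulr1.
have [//|e_lt0] := real_leP (rpred0 _) e_real.
have ve : v^H *m (B - A) = e *: v^H.
  by rewrite -[LHS]hadjK hadjM hadjK hH ev hadjZ (CrealP e_real).
have key : v^H *m (B *m B - A *m A) *m v = e *: (v^H *m A *m v + v^H *m B *m v).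
  have -> : B *m B - A *m A = (B - A) *m B + A *m (B - A) by rewrite mulmxBl mulmxBr; mxlin.
  rewrite mulmxDr mulmxDl !mulmxA ve -(mulmxA _ A) -(mulmxA _ (A *m _)) -!mulmxA ev.
  by rewrite -!scalemxAl -!scalemxAr -scalerDr addrC !mulmxA.
have [/(_ v)] := hAB; rewrite key mxE nmulr_rge0// mxE => s_le0.
have [/(_ v) a0] := hA; have [/(_ v) b0] := hB.
have zA : (v^H *m A *m v) ord0 ord0 = 0.
  by apply/eqP; rewrite eq_le a0 andbT (le_trans _ s_le0)// lerDl.
have zB : (v^H *m B *m v) ord0 ord0 = 0.
  by apply/eqP; rewrite eq_le b0 andbT (le_trans _ s_le0)// lerDr.
move: ev; rewrite mulmxBl (psdmx_ker hA zA) (psdmx_ker hB zB) subrr.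
move=> /(congr1 (fun M => (v^H *m M) ord0 ord0)).
by rewrite -scalemxAr mulmx0 mxE [RHS]mxE nv mulr1 => e0; rewrite -e0 ltxx in e_lt0.
Qed.

End Psd.
Local Notation "M ^H" := (hadj M) (at level 8, format "M ^H").

(** * Operator inequalities for measurements *)

Section Operators.
Variable C : numClosedFieldType.

Lemma psdmx_trace_ge0 n (A : 'M[C]_n) : psdmx A -> 0 <= \tr A.
Proof. by move=> h; apply: sumr_ge0 => i _; apply: psdmx_diag. Qed.

Lemma psdmx_congrH m n (A : 'M[C]_(n, m)) (M : 'M[C]_n) : psdmx M -> psdmx (A^H *m M *m A).
Proof. by move/(psdmx_congr A^H); rewrite hadjK. Qed.

Lemma psdmx_conj n (A M : 'M[C]_n) : A^H = A -> psdmx M -> psdmx (A *m M *m A).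
Proof. by move=> hA /(psdmx_congr A); rewrite hA. Qed.

Lemma psdmx_sqr n (A : 'M[C]_n) : A^H = A -> psdmx (A *m A).
Proof. by move=> hA; have := psdmx_gram A; rewrite hA. Qed.

Lemma psdmx_tr_mul_ge0 n (A B : 'M[C]_n) : psdmx A -> psdmx B -> 0 <= \tr (A *m B).
Proof.
move=> hA hB; rewrite -(sqrtmxK hA) -mulmxA mxtrace_mulC.
by apply/psdmx_trace_ge0/psdmx_conj; rewrite ?sqrtmx_herm.
Qed.

Lemma psdmx_trans n (A B D : 'M[C]_n) : psdmx (B - A) -> psdmx (D - B) -> psdmx (D - A).
Proof. by move=> h1 h2; have := psdmxD h1 h2; congr psdmx; mxlin. Qed.

(** Conjugation of [1 - S] by the square root of [S]. *)
Lemma psdmx_sub_sqr n (S : 'M[C]_n) : psdmx S -> psdmx (1%:M - S) -> psdmx (S - S *m S).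
Proof.
move=> h0 h1; have := psdmx_conj (sqrtmx_herm h0) h1; congr psdmx.
move: (sqrtmx S) (sqrtmxK h0) => s h.
by rewrite mulmxBr mulmxBl mulmx1 -h !mulmxA.
Qed.

Lemma psdmx_sqrt_ge n (S : 'M[C]_n) : psdmx S -> psdmx (1%:M - S) -> psdmx (sqrtmx S - S).
Proof.
move=> h0 h1; apply: sqr_mono => //; first exact: sqrtmx_psd.
by rewrite sqrtmxK//; apply: psdmx_sub_sqr.
Qed.

(** The difference is twice [sqrtmx S - S]. This bounds the disturbance caused by the measurement
    operator [sqrtmx S] by the probability that the outcome [S] fails to occur. *)
Lemma psdmx_one_sub_sqrt n (S : 'M[C]_n) : psdmx S -> psdmx (1%:M - S) ->
  psdmx ((1%:M - S) - (1%:M - sqrtmx S) *m (1%:M - sqrtmx S)).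
Proof.
move=> h0 h1; have := psdmxZ (ler0n C 2) (psdmx_sqrt_ge h0 h1); congr psdmx.
rewrite mulmxBl !mulmxBr sqrtmxK// !mulmx1 !mul1mx; mxlin.
Qed.

(* [1 - V^H V = (1 - V^H V)^2 + V^H (1 - V V^H) V] *)
Lemma contraction_hadj m n (V : 'M[C]_(m, n)) :
  psdmx (1%:M - V *m V^H) -> psdmx (1%:M - V^H *m V).
Proof.
move=> h; set X := V^H *m V.
have hX : (1%:M - X)^H = 1%:M - X by rewrite hadjB hadj1 /X hadjM hadjK.
have := psdmxD (psdmx_sqr hX) (psdmx_congrH V h); congr psdmx.
rewrite /X !(mulmxBl, mulmxBr) ?mul1mx ?mulmx1 ?mulmxA; mxlin.
Qed.

(** [V] is the sign of [M], so [V *m M] is the absolute value of [M]. The square root on the right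
    is built from an eigenbasis of [M *m M] that need not be related to that of [M]; the two are
    compared through their squares by [sqr_mono]. *)
Lemma sqrtmx_sqr_le n (M : 'M[C]_n) : M^H = M ->
  exists V, [/\ psdmx (1%:M - V), psdmx (1%:M + V) & psdmx (V *m M - sqrtmx (M *m M))].
Proof.
move=> hM; pose sg (x : C) : C := if 0 <= x then 1 else -1.
have sgP x : 0 <= 1 - sg x /\ 0 <= 1 + sg x.
  by rewrite /sg; case: ifP => _; rewrite ?subrr ?opprK ?addr_ge0.
exists (sfun sg M); have h1 c : c%:M = sfun (fun=> c) M by rewrite sfun_cst.
split.
- have -> : 1%:M - sfun sg M = sfun (fun x => 1 - sg x) M.
    by apply/eqP; rewrite subr_eq sfunD (h1 1); apply/eqP/eq_sfun => i; rewrite subrK.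
  by apply: sfun_psd => i; have [] := sgP (spectral_diag M ord0 i).
- by rewrite (h1 1) sfunD; apply: sfun_psd => i; have [] := sgP (spectral_diag M ord0 i).
have real_d i : spectral_diag M ord0 i \is Num.real.
  have -> : spectral_diag M ord0 i = (spectralmx M *m M *m (spectralmx M)^H) i i.
    exact: spectral_diagE.
  by apply/CrealP; rewrite -hadjE !hadjM hadjK hM mulmxA.
have hVM : sfun sg M *m M = sfun (fun x => `|x|) M.
  rewrite -{2}(sfun_id hM) sfunM; apply: eq_sfun => i; rewrite /sg.
  case: ifPn => [h|]; first by rewrite mul1r ger0_norm.
  by rewrite real_leNgt ?real0// negbK => h; rewrite mulN1r ltr0_norm.
have hMM : psdmx (M *m M) by apply: psdmx_sqr.
rewrite hVM; apply: sqr_mono; first exact: sqrtmx_psd.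
  by apply: sfun_psd => i; apply: normr_ge0.
rewrite sqrtmxK// sfunM; have := sfunM id id M; rewrite sfun_id// => ->.
rewrite (@eq_sfun _ _ (fun x => `|x| * `|x|) (fun x => x * x)) => [|i]; last first.
  by rewrite -!expr2 real_normK.
by rewrite subrr; apply: psdmx0.
Qed.

(** As [Z (S + T) Z = 1], the error [1 - Z S Z] is [Z T Z]. With [Y = S + T], the bound minus
    [Z T Z] equals [(Z - 2) T (Z - 2) + 2 (Z - 1) S (Z - 1) + 4 (sqrt Y - S)]. The last term is
    positive because [S^2 <= S <= Y] and the square root is monotone. *)
Lemma hayashi_nagaoka n (S T : 'M[C]_n) (d : C) : 0 < d ->
  psdmx S -> psdmx (1%:M - S) -> psdmx T -> psdmx (S + T - d%:M) ->
  let Z := isqrtmx (S + T) in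
  psdmx (2 *: (1%:M - S) + 4 *: T - (1%:M - Z *m S *m Z)).
Proof.
move=> d0 hS hS1 hT hY Z; set Y := S + T in hY Z *.
have pY : psdmx Y := posmx_psd d0 hY.
have hZ : Z^H = Z := isqrtmx_herm d0 hY.
have eT : Z *m T *m Z = 1%:M - Z *m S *m Z.
  have -> : T = Y - S by rewrite /Y; mxlin.
  by rewrite mulmxBr mulmxBl (isqrtmx_congr d0 hY).
have h1 : psdmx ((Z - 2%:M) *m T *m (Z - 2%:M)).
  apply: psdmx_conj => //; rewrite hadjB hZ; congr (_ - _).
  by rewrite -scalemx1 hadjZ hadj1 rmorph_nat.
have h2 : psdmx ((Z - 1%:M) *m S *m (Z - 1%:M)).
  by apply: psdmx_conj; rewrite // hadjB hZ hadj1.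
have h3 : psdmx (sqrtmx Y - S).
  apply: sqr_mono => //; first exact: sqrtmx_psd.
  rewrite sqrtmxK//; apply: psdmx_trans (psdmx_sub_sqr hS hS1) _.
  by rewrite /Y addrAC subrr add0r.
have h4 : (Z - 1%:M) *m S *m (Z - 1%:M) + (Z - 1%:M) *m T *m (Z - 1%:M)
    = 1%:M - 2 *: sqrtmx Y + Y.
  rewrite -mulmxDl -mulmxDr -/Y !mulmxBl !mulmxBr !mul1mx !mulmx1.
  rewrite (isqrtmx_mul d0 hY) (sqrtmx_isqrt d0 hY).
  have -> : Y *m Z = sqrtmx Y by rewrite -[Y in LHS](sqrtmxK pY) -mulmxA (sqrtmx_isqrt d0 hY) mulmx1.
  mxlin.
have := psdmxD h1 (psdmxZ (ler0n C 2) (psdmxD h2 (psdmxZ (ler0n C 2) h3))).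
congr psdmx; rewrite -eT.
have -> : (Z - 1%:M) *m S *m (Z - 1%:M) =
   1%:M - 2 *: sqrtmx Y + Y - (Z - 1%:M) *m T *m (Z - 1%:M) by rewrite -h4; mxlin.
rewrite -(scalemx1 _ 2) !mulmxBl !mulmxBr !mul1mx !mulmx1 -!scalemxAl -!scalemxAr !mul1mx ?mulmx1 /Y.
mxlin.
Qed.

(* With [Y = Phi Phi^H + Delta + d], the operators [K W K^H] for
   [sum W <= Y] form a sub-POVM steering [Phi] to [G W G^H], [G = Phi K],
   and [tr Y |G - 1|^2] is controlled by the trace of [Delta]. *)
Lemma steering_operator m n (Phi : 'M[C]_(m, n)) (Delta : 'M[C]_m) (d : C) :
  0 < d -> psdmx Delta ->
  let Y := Phi *m Phi^H + Delta + d%:M in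
  exists K : 'M[C]_(n, m),
    psdmx (1%:M - K *m Y *m K^H) /\
    let F := Phi *m K - 1%:M in \tr (F *m Y *m F^H) <= \tr (Delta + d%:M).
Proof.
move=> d0 hD; set om := Phi *m Phi^H => Y.
have pom : psdmx om := psdmx_gram Phi.
pose N := om + d%:M; have hN : psdmx (N - d%:M) by rewrite addrK.
have hY : psdmx (Y - d%:M) by rewrite addrK; apply: psdmxD.
have pN := posmx_psd d0 hN; have pY := posmx_psd d0 hY.
pose z := isqrtmx N; pose y := isqrtmx Y.
have hz : z^H = z := isqrtmx_herm d0 hN.
have hy : y^H = y := isqrtmx_herm d0 hY.
have Nd i : d <= spectral_diag N ord0 i by apply: psdmx_eig_ge; rewrite ?psdmx_herm.
have N0 i : 0 < spectral_diag N ord0 i := posmx_eig d0 hN i.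
have omE : om = sfun (fun x => x - d) N.
  rewrite -(sfunD id (fun=> - d)) sfun_id ?psdmx_herm// sfun_cst raddfN; exact/esym/addrK.
have oz : om *m z = sfun (fun x => (x - d) / sqrtC x) N by rewrite omE sfunM.
have zo : z *m om = om *m z by rewrite omE !sfunM; apply: eq_sfun => i; rewrite mulrC.
have poz : psdmx (om *m z).
  rewrite oz; apply: sfun_psd => i.
  by rewrite mulr_ge0 ?subr_ge0 ?invr_ge0 ?sqrtC_ge0// ltW.
have yYy : y *m Y *m y = 1%:M := isqrtmx_congr d0 hY.
have yY : y *m Y = sqrtmx Y := isqrtmx_mul d0 hY.
have Yy : Y *m y = sqrtmx Y.
  by rewrite -[Y in LHS](sqrtmxK pY) -mulmxA (sqrtmx_isqrt d0 hY) mulmx1.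
have zNz : z *m N *m z = 1%:M := isqrtmx_congr d0 hN.
have zN : z *m sqrtmx N = 1%:M := isqrtmxK d0 hN.
clearbody y z.
(* Up to the regularization, [Phi^H *m z] is the adjoint of the polar part of [Phi] and carries the
   system over to [A]; [y] normalizes as in a pretty good measurement. Then [Phi K = om z y], which
   is close to 1 because [om z] is close to the square root of [Y]. *)
exists (Phi^H *m z *m y); split.
  rewrite !hadjM !hadjK hy hz.
  have -> : Phi^H *m z *m y *m Y *m (y *m (z *m Phi)) = (z *m Phi)^H *m (z *m Phi).
    have -> : Phi^H *m z *m y *m Y *m (y *m (z *m Phi)) =
              Phi^H *m z *m (y *m Y *m y) *m z *m Phi by rewrite !mulmxA.
    by rewrite yYy mulmx1 hadjM hz !mulmxA.
  apply: contraction_hadj; rewrite hadjM hz.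
  have -> : z *m Phi *m (Phi^H *m z) = z *m om *m z by rewrite !mulmxA.
  have -> : 1%:M - z *m om *m z = d *: (z *m z).
    rewrite -zNz -mulmxBl -mulmxBr.
    have -> : N - om = d%:M by rewrite /N addrC addKr.
    by rewrite mul_mx_scalar -scalemxAl.
  by apply: psdmxZ; [exact: ltW|apply: psdmx_sqr].
have -> : Phi *m (Phi^H *m z *m y) = om *m z *m y by rewrite !mulmxA.
cbv zeta; set F := _ - 1%:M.
have hoz : (om *m z)^H = om *m z by rewrite psdmx_herm.
(* The first term has trace at most [\tr om], and each cross term at least [\tr om] since
   [sqrt Y >= sqrt N] and [om z sqrt N = om]. What remains of [\tr Y] is the trace of
   [Delta + d]. *)
have -> : F *m Y *m F^H = om *m z *m (z *m om) - om *m z *m sqrtmx Y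
    - sqrtmx Y *m (om *m z) + Y.
  rewrite /F hadjB hadj1 hadjM hy hoz !mulmxBl !mulmxBr !mul1mx !mulmx1 zo.
  have -> : om *m z *m y *m Y *m (y *m (om *m z)) =
     om *m z *m (y *m Y *m y) *m (om *m z) by rewrite !mulmxA.
  rewrite yYy mulmx1 -(mulmxA _ y Y) yY (mulmxA Y y) Yy; mxlin.
have tsq : \tr om <= \tr (om *m z *m sqrtmx Y).
  have h : psdmx (sqrtmx Y - sqrtmx N).
    apply: sqr_mono; rewrite ?sqrtmxK//; try exact: sqrtmx_psd.
    by have -> : Y - N = Delta by rewrite /Y /N; mxlin.
  have := psdmx_tr_mul_ge0 poz h; rewrite mulmxBr raddfB /= subr_ge0.
  by rewrite -(mulmxA om z (sqrtmx N)) zN mulmx1.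
have tzz : \tr (om *m z *m (z *m om)) <= \tr om.
  have : psdmx (om - om *m z *m (z *m om)).
    rewrite zo oz sfunM omE.
    have -> : sfun (fun x => x - d) N - sfun (fun x => (x - d) / sqrtC x * ((x - d) / sqrtC x)) N
       = sfun (fun x => (x - d) * (d / x)) N.
      apply/eqP; rewrite subr_eq sfunD; apply/eqP/eq_sfun => i.
      have xn0 : spectral_diag N ord0 i != 0 by rewrite gt_eqF.
      have sx := sqrtCK (spectral_diag N ord0 i).
      set x := spectral_diag N ord0 i in xn0 sx *.
      have -> : (x - d) / sqrtC x * ((x - d) / sqrtC x) = (x - d) ^+ 2 / x.
        by rewrite mulrACA -expr2 -invfM -[sqrtC x * _]expr2 sx.
      by field.
    apply: sfun_psd => i.
    by rewrite mulr_ge0 ?subr_ge0 ?divr_ge0 // ltW.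
  by move/psdmx_trace_ge0; rewrite raddfB /= subr_ge0.
have trY : \tr Y = \tr om + \tr (Delta + d%:M) by rewrite -mxtraceD addrA.
rewrite mxtraceD trY !raddfB /= [\tr (sqrtmx Y *m _)]mxtrace_mulC.
move: tsq tzz; set a := \tr om; set b := \tr (om *m z *m sqrtmx Y).
set e := \tr (om *m z *m (z *m om)); set t := \tr (Delta + _) => tsq tzz; rewrite -subr_ge0.
have -> : t - (e - b - b + (a + t)) = (a - e) + ((b - a) + (b - a)) by ring.
by apply: addr_ge0; [|apply: addr_ge0]; rewrite subr_ge0.
Qed.

(** Polarization writes the cross terms [F W + W F^H] as a difference of two positive operators; [t]
    sets the balance that Cauchy-Schwarz would optimize. *)
Lemma gentle_split n (F W : 'M[C]_n) (t : C) : 0 < t ->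
  (1%:M + F) *m W *m (1%:M + F)^H - W =
  (F *m W *m F^H + (t / 2) *: ((F + t^-1%:M) *m W *m (F + t^-1%:M)^H))
  - (t / 2) *: ((F - t^-1%:M) *m W *m (F - t^-1%:M)^H).
Proof.
move=> t0; have tr : (t^-1)^* = t^-1 by apply/CrealP; rewrite realV gtr0_real.
have tn : t != 0 by rewrite gt_eqF.
rewrite !(hadjD, hadjN) hadj1 -(scalemx1 _ t^-1) !hadjZ hadj1 tr.
rewrite !(mulmxDl, mulmxDr, mulmxBl, mulmxBr, mulNmx, mulmxN) ?mul1mx ?mulmx1 -?scalemxAl -?scalemxAr ?mul1mx ?mulmx1.
apply/matrixP => i j; rewrite ?mxlinE; field; exact: tn.
Qed.

Lemma gentle_parallelogram n (F W : 'M[C]_n) (t : C) : 0 < t ->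
  (F + t^-1%:M) *m W *m (F + t^-1%:M)^H + (F - t^-1%:M) *m W *m (F - t^-1%:M)^H
  = 2 *: (F *m W *m F^H) + (2 * (t^-1 * t^-1)) *: W.
Proof.
move=> t0; have h : (t^-1%:M : 'M[C]_n)^H = t^-1%:M.
  rewrite -scalemx1 hadjZ hadj1; congr (_ *: _); apply/CrealP.
  by rewrite realV gtr0_real.
rewrite !(hadjD, hadjN) h -(scalemx1 _ t^-1).
rewrite !(mulmxDl, mulmxDr, mulNmx, mulmxN) -?scalemxAl -?scalemxAr ?mul1mx ?mulmx1.
mxlin.
Qed.

(** Polarization against the projector [Pi]: both cross terms [M Pi] and [Pi M] are equal to [M]. *)
Lemma rank_split n (M Pi : 'M[C]_n) (t : C) : 0 < t ->
  M^H = M -> Pi^H = Pi -> M *m Pi = M -> Pi *m M = M ->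
  M = (t / 4) *: ((M + t^-1 *: Pi) *m (M + t^-1 *: Pi)^H)
    - (t / 4) *: ((M - t^-1 *: Pi) *m (M - t^-1 *: Pi)^H).
Proof.
move=> t0 hM hP h1 h2; have tr : (t^-1)^* = t^-1 by apply/CrealP; rewrite realV gtr0_real.
have tn : t != 0 by rewrite gt_eqF.
rewrite !(hadjD, hadjN) !hadjZ tr hM hP.
rewrite !(mulmxDl, mulmxDr, mulmxBl, mulmxBr, mulNmx, mulmxN) -?scalemxAl -?scalemxAr ?h1 ?h2.
apply/matrixP => i j; rewrite ?mxlinE; field; exact: tn.
Qed.

End Operators.

(** * Trace-norm bounds *)

Section TraceNorm.
Variable R : realType.
Local Notation C := R[i].

Definition rtr {n} (M : 'M[C]_n) : R := complex.Re (\tr M).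

Lemma ReD (x y : C) : complex.Re (x + y) = complex.Re x + complex.Re y.
Proof. by case: x; case: y. Qed.

Lemma ReN (x : C) : complex.Re (- x) = - complex.Re x.
Proof. by case: x. Qed.

Lemma ReM (a : R) (x : C) : complex.Re (a%:C%C * x) = a * complex.Re x.
Proof. by case: x => u v /=; rewrite mul0r subr0. Qed.

Lemma Re_sum (I : finType) (P : pred I) (F : I -> C) :
  complex.Re (\sum_(i | P i) F i) = \sum_(i | P i) complex.Re (F i).
Proof. by apply: (big_morph (@complex.Re R)) => // x y; rewrite ReD. Qed.

Lemma Re_le (x y : C) : x <= y -> complex.Re x <= complex.Re y.
Proof. by rewrite lecE => /andP[]. Qed.

Lemma ger0_ReE (x : C) : 0 <= x -> x = (complex.Re x)%:C%C.
Proof. by move=> x0; rewrite RRe_real// ger0_real. Qed.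

Section Linear.
Variable n : nat.
Implicit Types M N : 'M[C]_n.

Lemma rtrD M N : rtr (M + N) = rtr M + rtr N.
Proof. by rewrite /rtr mxtraceD ReD. Qed.

Lemma rtrN M : rtr (- M) = - rtr M.
Proof. by rewrite /rtr raddfN ReN. Qed.

Lemma rtrB M N : rtr (M - N) = rtr M - rtr N.
Proof. by rewrite rtrD rtrN. Qed.

Lemma rtrZ (a : R) M : rtr (a%:C%C *: M) = a * rtr M.
Proof. by rewrite /rtr mxtraceZ ReM. Qed.

Lemma rtr0 : rtr (0 : 'M[C]_n) = 0.
Proof. by rewrite /rtr mxtrace0. Qed.

Lemma rtr_sum (I : finType) (P : pred I) (F : I -> 'M[C]_n) :
  rtr (\sum_(i | P i) F i) = \sum_(i | P i) rtr (F i).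
Proof. by apply: (big_morph rtr) => [x y|]; rewrite ?rtrD ?rtr0. Qed.

Lemma rtr_ge0 M : psdmx M -> 0 <= rtr M.
Proof. by move=> /psdmx_trace_ge0/Re_le. Qed.

Lemma rtr_le M N : psdmx (N - M) -> rtr M <= rtr N.
Proof. by move/rtr_ge0; rewrite rtrB subr_ge0. Qed.

Lemma rtr_mul_ge0 M N : psdmx M -> psdmx N -> 0 <= rtr (M *m N).
Proof. by move=> hM hN; apply: Re_le (psdmx_tr_mul_ge0 hM hN). Qed.

Lemma rtr_mul_lel M N P : psdmx P -> psdmx (N - M) -> rtr (M *m P) <= rtr (N *m P).
Proof. by move=> hP h; rewrite -subr_ge0 -rtrB -mulmxBl rtr_mul_ge0. Qed.

Lemma rtr_mul_ler M N P : psdmx P -> psdmx (N - M) -> rtr (P *m M) <= rtr (P *m N).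
Proof. by move=> hP h; rewrite -subr_ge0 -rtrB -mulmxBr rtr_mul_ge0. Qed.

Lemma trE_psd M : psdmx M -> \tr M = (rtr M)%:C%C.
Proof. by move=> /psdmx_trace_ge0/ger0_ReE. Qed.

Lemma psdmxZr (a : R) M : 0 <= a -> psdmx M -> psdmx (a%:C%C *: M).
Proof. by move=> ha; apply: psdmxZ; rewrite ler0c. Qed.

End Linear.

Lemma rtrC m n (M : 'M[C]_(m, n)) (N : 'M[C]_(n, m)) : rtr (M *m N) = rtr (N *m M).
Proof. by rewrite /rtr mxtrace_mulC. Qed.

Lemma rtr1 n : rtr (1%:M : 'M[C]_n) = n%:R.
Proof. by rewrite /rtr mxtrace1 -(rmorph_nat (real_complex R)). Qed.

(* For Hermitian [M] this says that the trace norm of [M] is at most [c]. *)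
Definition tnb {n} (M : 'M[C]_n) (c : R) : Prop :=
  exists P Q : 'M[C]_n, [/\ psdmx P, psdmx Q, M = P - Q & rtr P + rtr Q <= c].

Section Tnb.
Variable n : nat.
Implicit Types M N : 'M[C]_n.

Lemma tnb_le M c c' : c <= c' -> tnb M c -> tnb M c'.
Proof. by move=> h [P [Q [hP hQ e l]]]; exists P, Q; split=> //; apply: le_trans h. Qed.

Lemma tnb_psd M : psdmx M -> tnb M (rtr M).
Proof. by move=> h; exists M, 0; rewrite subr0 rtr0 addr0; split => //; apply: psdmx0. Qed.

Lemma tnb0 : tnb (0 : 'M[C]_n) 0.
Proof. by have := tnb_psd (@psdmx0 C n); rewrite rtr0. Qed.

Lemma tnbD M N a b : tnb M a -> tnb N b -> tnb (M + N) (a + b).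
Proof.
move=> [P [Q [hP hQ -> l]]] [P' [Q' [hP' hQ' -> l']]].
exists (P + P'), (Q + Q'); split; [exact: psdmxD|exact: psdmxD|by rewrite opprD addrACA|].
by rewrite !rtrD; lra.
Qed.

Lemma tnbN M a : tnb M a -> tnb (- M) a.
Proof.
by move=> [P [Q [hP hQ -> l]]]; exists Q, P; split=> //; rewrite ?opprB// addrC.
Qed.

Lemma tnbB M N a b : tnb M a -> tnb N b -> tnb (M - N) (a + b).
Proof. by move=> h1 /tnbN; apply: tnbD. Qed.

Lemma tnbZ (s : R) M a : 0 <= s -> tnb M a -> tnb (s%:C%C *: M) (s * a).
Proof.
move=> s0 [P [Q [hP hQ -> l]]]; exists (s%:C%C *: P), (s%:C%C *: Q).
split; try exact: psdmxZr; first by rewrite scalerBr.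
by rewrite !rtrZ -mulrDr ler_wpM2l.
Qed.

Lemma tnbZ_psd (s : R) M : psdmx M -> tnb (s%:C%C *: M) (`|s| * rtr M).
Proof.
move=> hM; have [s0|s0] := leP 0 s.
  by rewrite ger0_norm//; apply: tnbZ => //; apply: tnb_psd.
rewrite ltr0_norm// -[s]opprK rmorphN scaleNr opprK; apply: tnbN.
by apply: tnbZ; [rewrite oppr_ge0 ltW | apply: tnb_psd].
Qed.

Lemma tnb_sum (I : finType) (P : pred I) (F : I -> 'M[C]_n) (c : I -> R) :
  (forall i, P i -> tnb (F i) (c i)) -> tnb (\sum_(i | P i) F i) (\sum_(i | P i) c i).
Proof.
move=> h; apply: (big_ind2 (@tnb n)) => //; first exact: tnb0.
by move=> M a N b; apply: tnbD.
Qed.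

Lemma tnb_trace M c : tnb M c -> `|rtr M| <= c.
Proof.
move=> [P [Q [/rtr_ge0 hP /rtr_ge0 hQ -> l]]]; rewrite rtrB ler_norml; lra.
Qed.

Lemma tnb_congr m (A : 'M[C]_(m, n)) M c :
  psdmx (1%:M - A^H *m A) -> tnb M c -> tnb (A *m M *m A^H) c.
Proof.
move=> hA [P [Q [hP hQ -> l]]]; exists (A *m P *m A^H), (A *m Q *m A^H).
split; try exact: psdmx_congr; first by rewrite mulmxBr mulmxBl.
have h (S : 'M[C]_n) : psdmx S -> rtr (A *m S *m A^H) <= rtr S.
  move=> hS; rewrite rtrC mulmxA; have := rtr_mul_lel hS hA.
  by rewrite mul1mx.
by apply: le_trans l; apply: lerD; apply: h.
Qed.

Lemma tnb_mul_le M c (E : 'M[C]_n) :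
  tnb M c -> psdmx E -> psdmx (1%:M - E) -> rtr (E *m M) <= c.
Proof.
move=> [P [Q [hP hQ -> l]]] h0 h1; rewrite mulmxBr rtrB.
have := rtr_mul_lel hP h1; rewrite mul1mx.
by have := rtr_mul_ge0 h0 hQ; have := rtr_ge0 hQ; lra.
Qed.

(** Linear form of the gentle measurement bound [e + 2 sqrt (e w)], where [w] is the trace of
    [W]. *)
Lemma tnb_gentle (G W : 'M[C]_n) (t e : R) : 0 < t -> psdmx W ->
  rtr ((G - 1%:M) *m W *m (G - 1%:M)^H) <= e ->
  tnb (G *m W *m G^H - W) ((1 + t) * e + rtr W / t).
Proof.
move=> t0 hW; set F := G - 1%:M => he.
have tC0 : 0 < t%:C%C :> C by rewrite ltcE /= eqxx.
have := gentle_split F W tC0; have -> : 1%:M + F = G by rewrite /F addrC subrK.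
move=> ->; have t20 : 0 <= t%:C%C / 2 :> C by rewrite divr_ge0// ltW.
eexists; eexists; split; [| | reflexivity |].
- by apply: psdmxD; [|apply: psdmxZ => //]; apply: psdmx_congr.
- by apply: psdmxZ => //; apply: psdmx_congr.
set tC := t%:C%C.
have -> : tC / 2 = (t / 2)%:C%C by rewrite rmorphM fmorphV rmorph_nat.
rewrite rtrD !rtrZ.
(* The two polarized terms are not bounded separately: by the parallelogram law their traces add up
   to a combination of those of [F *m W *m F^H] and [W]. *)
suff -> : rtr ((F + tC^-1%:M) *m W *m (F + tC^-1%:M)^H)
   = 2 * (rtr (F *m W *m F^H) + (t^-1) ^+ 2 * rtr W)
     - rtr ((F - tC^-1%:M) *m W *m (F - tC^-1%:M)^H).
  have -> : rtr W / t = t * (t^-1 ^+ 2 * rtr W) by field; rewrite gt_eqF.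
  move: (rtr (F *m W *m F^H)) (rtr ((F - tC^-1%:M) *m W *m _)) he => x y he.
  have -> : x + t / 2 * (2 * (x + t^-1 ^+ 2 * rtr W) - y) + t / 2 * y
    = (1 + t) * x + t * (t^-1 ^+ 2 * rtr W) by field; rewrite gt_eqF.
  by rewrite lerD2r ler_wpM2l// addr_ge0// ltW.
apply/eqP; rewrite -subr_eq opprK -rtrD; apply/eqP.
rewrite gentle_parallelogram//.
have -> : 2 = (2%:R)%:C%C :> C by rewrite rmorph_nat.
rewrite -fmorphV -!rmorphM rtrD !rtrZ expr2; ring.
Qed.

(** Stands for the bound of the trace norm by [sqrt (tr Pi * tr M^2)]. Being linear in
    [rtr (M *m M)], it only calls for a second moment of the random operator [M]. *)
Lemma tnb_rank (M Pi : 'M[C]_n) (t : R) : 0 < t ->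
  M^H = M -> Pi^H = Pi -> Pi *m Pi = Pi -> M *m Pi = M -> Pi *m M = M ->
  tnb M ((t * rtr (M *m M) + rtr Pi / t) / 2).
Proof.
move=> t0 hM hP hPP h1 h2.
have tC0 : 0 < t%:C%C :> C by rewrite ltcE /= eqxx.
exists ((t / 4)%:C%C *: ((M + (t^-1)%:C%C *: Pi) *m (M + (t^-1)%:C%C *: Pi)^H)).
exists ((t / 4)%:C%C *: ((M - (t^-1)%:C%C *: Pi) *m (M - (t^-1)%:C%C *: Pi)^H)).
have t40 : 0 <= t / 4 by lra.
split; try by apply: psdmxZr => //; apply: psdmx_gram.
  have -> : (t / 4)%:C%C = t%:C%C / 4 :> C by rewrite rmorphM fmorphV rmorph_nat.
  by rewrite fmorphV; apply: rank_split.
have -> : (M + (t^-1)%:C%C *: Pi)^H = M + (t^-1)%:C%C *: Pi.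
  by rewrite hadjD hadjZ hM hP; congr (_ + _ *: _); apply/CrealP; rewrite ger0_real// ler0c invr_ge0 ltW.
have -> : (M - (t^-1)%:C%C *: Pi)^H = M - (t^-1)%:C%C *: Pi.
  by rewrite hadjB hadjZ hM hP; congr (_ - _ *: _); apply/CrealP; rewrite ger0_real// ler0c invr_ge0 ltW.
rewrite !(mulmxDl, mulmxDr, mulNmx, mulmxN) -?scalemxAl -?scalemxAr h1 h2 hPP.
rewrite ?(rtrZ, rtrD, rtrN) le_eqVlt; apply/orP; left; apply/eqP; field.
by rewrite gt_eqF.
Qed.

End Tnb.

(** Pairing [P - Q] with the sign [V] of [M], which lies between -1 and 1, yields at most
    [rtr P + rtr Q]. *)
Lemma trnorm_le (T : finType) (M : op R T) (c : R) : tnb M c -> trnorm M <= c.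
Proof.
move=> [P [Q [hP hQ eM l]]].
have hM : M^H = M by rewrite eM hadjB !psdmx_herm.
have [V [h1 h2 h3]] := sqrtmx_sqr_le hM.
have -> : trnorm M = rtr (sqrtmx (M *m M)) by rewrite /trnorm /adj -/(hadj M) hM.
apply: le_trans (rtr_le h3) _; apply: le_trans l.
have a1 := rtr_mul_ge0 h1 hP; have a2 := rtr_mul_ge0 h2 hQ; move: a1 a2.
by rewrite eM mulmxBr mulmxBl mulmxDl !mul1mx !rtrB rtrD; lra.
Qed.

End TraceNorm.

(** * Operators indexed by finite types *)

Section Indexed.
Variable R : realType.
Local Notation C := R[i].

(** Rectangular operators are needed for the map from [A] to [RB] whose vectorization is the
    purification, and for the isometries that attach a register. *)
Definition rop (S T : finType) := 'M[C]_(#|S|, #|T|).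

Definition rent {S T : finType} (M : rop S T) (s : S) (t : T) : C :=
  M (enum_rank s) (enum_rank t).

Definition mkrop {S T : finType} (F : S -> T -> C) : rop S T :=
  \matrix_(i, j) F (enum_val i) (enum_val j).

Lemma rent_mkrop (S T : finType) (F : S -> T -> C) s t : rent (mkrop F) s t = F s t.
Proof. by rewrite /rent mxE !enum_rankK. Qed.

Lemma rent_mkop (T : finType) (F : T -> T -> C) s t : rent (mkop F) s t = F s t.
Proof. exact: rent_mkrop. Qed.

Lemma ropP (S T : finType) (M N : rop S T) :
  (forall s t, rent M s t = rent N s t) -> M = N.
Proof. by move=> h; apply/matrixP=> k l; rewrite -[k]enum_valK -[l]enum_valK; apply: h. Qed.

Lemma sum_enum_rank (S : finType) (F : 'I_#|S| -> C) : \sum_i F i = \sum_s F (enum_rank s).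
Proof. by rewrite (reindex enum_rank) //; exact/onW_bij/enum_rank_bij. Qed.

Lemma rent_mul (S T U : finType) (M : rop S T) (N : rop T U) s u :
  rent (M *m N) s u = \sum_t rent M s t * rent N t u.
Proof. by rewrite /rent mxE sum_enum_rank. Qed.

Lemma rent_hadj (S T : finType) (M : rop S T) s t : rent M^H t s = (rent M s t)^*.
Proof. by rewrite /rent hadjE. Qed.

Lemma rentB (S T : finType) (M N : rop S T) s t :
  rent (M - N) s t = rent M s t - rent N s t.
Proof. by rewrite /rent !mxE. Qed.

Lemma rentZ (S T : finType) a (M : rop S T) s t :
  rent (a *: M) s t = a * rent M s t.
Proof. by rewrite /rent mxE. Qed.

Lemma rent_sum (S T I : finType) (P : pred I) (F : I -> rop S T) s t :
  rent (\sum_(i | P i) F i) s t = \sum_(i | P i) rent (F i) s t.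
Proof. by rewrite /rent summxE. Qed.

Lemma rent1 (T : finType) (s t : T) : rent 1%:M s t = (s == t)%:R.
Proof. by rewrite /rent mxE (inj_eq enum_rank_inj). Qed.

Lemma trE (T : finType) (M : 'M[C]_#|T|) : \tr M = \sum_t rent M t t.
Proof. by rewrite /mxtrace sum_enum_rank. Qed.

Lemma rent_tens (S T : finType) (M : op R S) (N : op R T) p q :
  rent (tens M N) p q = rent M p.1 q.1 * rent N p.2 q.2.
Proof. exact: rent_mkop. Qed.

Lemma rent_proj (T : finType) (x s t : T) : rent (Defs.proj R x) s t = ((s == x) && (t == x))%:R.
Proof. exact: rent_mkop. Qed.

Lemma sum_delta (T : finType) (t : T) (F : T -> C) : \sum_s (t == s)%:R * F s = F t.
Proof.
rewrite (bigD1 t)//= eqxx mul1r big1 ?addr0// => s.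
by rewrite eq_sym => /negPf->; rewrite mul0r.
Qed.

Section Injection.
Variables (S T : finType) (s : S).

(* [|s> (x) 1_T] *)
Definition jinj : rop (S * T)%type T :=
  mkrop (fun p t => (p.1 == s)%:R * (p.2 == t)%:R).

Lemma rent_jinj_mul (U : finType) (N : rop T U) (p : S * T) (u : U) :
  rent (jinj *m N) p u = (p.1 == s)%:R * rent N p.2 u.
Proof.
rewrite rent_mul -(sum_delta p.2 (fun t => rent N t u)) mulr_sumr.
by apply: eq_bigr => t _; rewrite rent_mkrop mulrA.
Qed.

Lemma rent_mul_jinjH (U : finType) (N : rop U T) (p : S * T) (u : U) :
  rent (N *m jinj^H) u p = (p.1 == s)%:R * rent N u p.2.
Proof.
rewrite -[N]hadjK -hadjM rent_hadj rent_jinj_mul rmorphM rmorph_nat.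
by rewrite [in RHS]rent_hadj.
Qed.

Lemma rent_jinjH_mul (U : finType) (N : rop (S * T)%type U) t u :
  rent (jinj^H *m N) t u = rent N (s, t) u.
Proof.
rewrite rent_mul -(sum_delta (s, t) (fun p => rent N p u)).
apply: eq_bigr => -[s' t'] _; rewrite rent_hadj rent_mkrop /= rmorphM !rmorph_nat.
by rewrite xpair_eqE -mulnb natrM (eq_sym s) (eq_sym t).
Qed.

Lemma rent_mul_jinj (U : finType) (N : rop U (S * T)%type) t u :
  rent (N *m jinj) u t = rent N u (s, t).
Proof.
by rewrite -[N]hadjK -[jinj]hadjK -hadjM rent_hadj rent_jinjH_mul !rent_hadj conjCK.
Qed.

Lemma jinjH_jinj : jinj^H *m jinj = 1%:M.
Proof.
by apply: ropP => t t'; rewrite rent_jinjH_mul rent_mkrop rent1 eqxx mul1r.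
Qed.

Lemma tens_projE (M : op R T) : tens (Defs.proj R s) M = jinj *m M *m jinj^H.
Proof.
apply: ropP => p q; rewrite rent_tens rent_proj rent_mul_jinjH rent_jinj_mul.
by rewrite -mulnb natrM mulrA [_ * (q.1 == s)%:R]mulrC.
Qed.

Lemma tens_proj_psd (M : op R T) : psdmx M -> psdmx (tens (Defs.proj R s) M).
Proof. by move=> h; rewrite tens_projE; apply: psdmx_congr. Qed.

Lemma tnb_tens_proj (M : op R T) c : tnb M c -> tnb (tens (Defs.proj R s) M) c.
Proof.
move=> h; rewrite tens_projE; apply: tnb_congr h.
by rewrite jinjH_jinj subrr; apply: psdmx0.
Qed.

End Injection.

Section TensId.
Variables S T : finType.
Implicit Types M N : op R T.

(** Splitting the identity into basis projectors reduces positivity and trace identities to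
    congruences by the isometries [jinj]. *)
Lemma tens_idE M : tens (idop R S) M = \sum_s tens (Defs.proj R s) M.
Proof.
apply: ropP => p q; rewrite rent_sum rent_tens rent1.
under eq_bigr => s _ do rewrite rent_tens rent_proj -mulnb natrM -mulrA.
by rewrite (sum_delta p.1 (fun s => (q.1 == s)%:R * rent M p.2 q.2)) [q.1 == _]eq_sym.
Qed.

Lemma tens_id_psd M : psdmx M -> psdmx (tens (idop R S) M).
Proof. by move=> h; rewrite tens_idE; apply: psdmx_sum => s _; apply: tens_proj_psd. Qed.

Lemma tens_idM M N : tens (idop R S) M *m tens (idop R S) N = tens (idop R S) (M *m N).
Proof.
apply: ropP => p q; rewrite rent_mul rent_tens rent1 rent_mul mulr_sumr.
rewrite (eq_bigr (fun r : S * T => (p.1 == r.1)%:R * rent M p.2 r.2 *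
  ((r.1 == q.1)%:R * rent N r.2 q.2))); last by move=> r _; rewrite !rent_tens !rent1.
rewrite -(pair_bigA _ (fun s t => (p.1 == s)%:R * rent M p.2 t *
  ((s == q.1)%:R * rent N t q.2))) exchange_big /=; apply: eq_bigr => t _.
rewrite -(sum_delta p.1 (fun s => (s == q.1)%:R * (rent M p.2 t * rent N t q.2))).
by apply: eq_bigr => s _; ring.
Qed.

Lemma tens_id1 : tens (idop R S) (1%:M : op R T) = 1%:M.
Proof.
apply: ropP => p q; rewrite rent_tens !rent1 -natrM mulnb.
by rewrite -[p == q]/((p.1 == q.1) && (p.2 == q.2)).
Qed.

Lemma tens_idB M N : tens (idop R S) (M - N) = tens (idop R S) M - tens (idop R S) N.
Proof. by apply: ropP => p q; rewrite !(rent_tens, rentB) mulrBr. Qed.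

Lemma ptrace1E (M : op R (S * T)%type) : ptrace1 M = \sum_s (jinj T s)^H *m M *m jinj T s.
Proof.
apply: ropP => t t'; rewrite rent_sum rent_mkop; apply: eq_bigr => s _.
by rewrite rent_mul_jinj rent_jinjH_mul.
Qed.

Lemma ptrace1_psd (M : op R (S * T)%type) : psdmx M -> psdmx (ptrace1 M).
Proof. by move=> h; rewrite ptrace1E; apply: psdmx_sum => s _; apply: psdmx_congrH. Qed.

Lemma tr_tens_id_mul M (N : op R (S * T)%type) :
  \tr (tens (idop R S) M *m N) = \tr (M *m ptrace1 N).
Proof.
rewrite tens_idE ptrace1E mulmx_suml mulmx_sumr !raddf_sum /=; apply: eq_bigr => s _.
have -> : tens (Defs.proj R s) M *m N = jinj T s *m (M *m (jinj T s)^H *m N).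
  by rewrite tens_projE !mulmxA.
by rewrite mxtrace_mulC !mulmxA.
Qed.

Lemma tr_ptrace1 (N : op R (S * T)%type) : \tr (ptrace1 N) = \tr N.
Proof. by rewrite -[ptrace1 N]mul1mx -tr_tens_id_mul tens_id1 mul1mx. Qed.

End TensId.

(** [Pur] is the rank-one operator on the vectorization of [Phi], and moving an operator on [A]
    through a vectorization transposes it. *)
Lemma steer_ptrace1 (A D : finType) (Phi : rop D A) (Pur : op R (A * D)%type)
    (Om : op R A) :
  (forall a d a' d', rent Pur (a, d) (a', d') = rent Phi d a * (rent Phi d' a')^*) ->
  ptrace1 (tens Om (idop R D) *m Pur) = Phi *m Om^T *m Phi^H.
Proof.
move=> hP; apply: ropP => d d'; rewrite rent_mkop rent_mul; apply: eq_bigr => a _.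
have -> : ent (tens Om (idop R D) *m Pur) (a, d) (a, d') =
  rent (tens Om (idop R D) *m Pur) (a, d) (a, d') by [].
rewrite rent_hadj !rent_mul mulr_suml.
rewrite (eq_bigr (fun r : A * D => (d == r.2)%:R * (rent Om a r.1 *
  (rent Phi r.2 r.1 * (rent Phi d' a)^*)))); last first.
  by move=> [a' u] _; rewrite rent_tens rent1 hP /=; ring.
rewrite -(pair_bigA _ (fun a' u => (d == u)%:R * (rent Om a a' *
  (rent Phi u a' * (rent Phi d' a)^*)))) /=; apply: eq_bigr => a' _.
rewrite (sum_delta d (fun u => rent Om a a' * (rent Phi u a' * (rent Phi d' a)^*))).
by rewrite /rent [Om^T _ _]mxE; ring.
Qed.

Lemma psdmx_tr n (M : 'M[C]_n) : psdmx M -> psdmx M^T.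
Proof.
move=> /psdmxP h; apply/psdmxP => v; have := h (map_mx conjC v).
suff -> : v^H *m M^T *m v = ((map_mx conjC v)^H *m M *m map_mx conjC v)^T by rewrite [X in _ -> _ <= X]mxE.
rewrite !trmx_mul mulmxA; congr (_ *m _ *m _).
by apply/matrixP=> k l; rewrite !mxE conjCK.
Qed.

End Indexed.

(** * One-shot protocol from a codebook *)

Section OneShot.
Variable R : realType.
Local Notation C := R[i].

Lemma psdE (T : finType) (M : op R T) : psd M <-> psdmx M.
Proof. by rewrite psdmxP. Qed.

Lemma rtr_tens_id_mul (S T : finType) (M : op R T) (N : op R (S * T)%type) :
  rtr (tens (idop R S) M *m N) = rtr (M *m ptrace1 N).
Proof. by rewrite /rtr tr_tens_id_mul. Qed.

Lemma rtr_ptrace1 (S T : finType) (N : op R (S * T)%type) : rtr (ptrace1 N) = rtr N.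
Proof. by rewrite /rtr tr_ptrace1. Qed.

Lemma psdmx_scalar n (d : R) : 0 <= d -> psdmx (d%:C%C%:M : 'M[C]_n).
Proof. by move=> h; rewrite -scalemx1; apply: psdmxZr => //; apply: psdmx1. Qed.

(** The target is weighted by the actual probabilities [\tr (tau m k)], while the approximation is
    known for weights [c m k]. Taking traces in the hypothesis shows that the two differ by at most
    [e m k], whence the factor 2. *)
Lemma classical_register_bound (X T : finType) (Th Thb : nat) (f : 'I_Th -> 'I_Thb -> X)
    (tau V : 'I_Th -> 'I_Thb -> op R T) (c e : 'I_Th -> 'I_Thb -> R) :
  (forall m k, psdmx (tau m k)) -> (forall m k, psdmx (V m k)) ->
  (forall m k, rtr (V m k) = 1) ->
  (forall m k, tnb (tau m k - (c m k)%:C%C *: V m k) (e m k)) ->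
  tnb (\sum_m \sum_k tens (Defs.proj R (f m k)) (tau m k)
       - \sum_m \sum_k \tr (tau m k) *: tens (Defs.proj R (f m k)) (V m k))
    (2 * \sum_m \sum_k e m k).
Proof.
move=> ht hV trV h; rewrite -sumrB mulr_sumr; apply: tnb_sum => m _.
rewrite -sumrB mulr_sumr; apply: tnb_sum => k _.
have -> : tens (Defs.proj R (f m k)) (tau m k)
       - \tr (tau m k) *: tens (Defs.proj R (f m k)) (V m k)
  = tens (Defs.proj R (f m k)) (tau m k - \tr (tau m k) *: V m k).
  by rewrite !tens_projE mulmxBr mulmxBl -scalemxAr -scalemxAl.
apply: tnb_tens_proj; rewrite trE_psd//.
have -> : tau m k - (rtr (tau m k))%:C%C *: V m k =
  (tau m k - (c m k)%:C%C *: V m k) + (c m k - rtr (tau m k))%:C%C *: V m k.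
  by rewrite rmorphB scalerBl addrA subrK.
rewrite (_ : 2 * e m k = e m k + e m k); last by ring.
apply: tnbD => //; apply: tnb_le (tnbZ_psd _ (hV m k)).
have := tnb_trace (h m k); rewrite rtrB rtrZ trV !mulr1 distrC; exact.
Qed.

(** With [E i = K (w i) K^H] for the steering operator [K], every error is a gentle one with
    [G = Phi K]. They are controlled only in total: as the [w i] sum to at most [Y], the sum is
    bounded by the trace of [F Y F^H]. *)
Lemma encoder (A D I : finType) (Phi : rop R D A) (Delta : op R D) (w : I -> op R D) (d : R) :
  0 < d -> psdmx Delta -> (forall i, psdmx (w i)) ->
  psdmx (Phi *m Phi^H + Delta - \sum_i w i) ->
  exists E : I -> op R A, [/\ forall i, psdmx (E i), psdmx (1%:M - \sum_i E i) &
    forall t : R, 0 < t -> exists2 e : I -> R,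
      (forall i, tnb (Phi *m E i *m Phi^H - w i) (e i)) &
      \sum_i e i <= (1 + t) * (rtr Delta + d) + (\sum_i rtr (w i)) / t].
Proof.
(* Scaled so that [d'%:M] has trace at most [d]; the successor keeps the denominator nonzero. *)
move=> d0 hD hw hS; pose d' := d / (#|D|.+1)%:R.
have d'0 : 0 < d' by rewrite divr_gt0.
have d'C : 0 < d'%:C%C :> C by rewrite ltcE /= eqxx.
have [K [hK1 hK2]] := steering_operator Phi d'C hD.
set Y := _ + Delta + _ in hK1 hK2.
have hY : psdmx (Y - \sum_i w i).
  rewrite /Y addrAC; apply: psdmxD => //.
  by apply: psdmx_scalar; apply: ltW.
exists (fun i => K *m w i *m K^H); split=> [i||t t0]; first exact: psdmx_congr.
  rewrite -mulmx_suml -mulmx_sumr.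
  by apply: psdmx_trans hK1; have := psdmx_congr K hY; rewrite mulmxBr mulmxBl.
pose F := Phi *m K - 1%:M.
exists (fun i => (1 + t) * rtr (F *m w i *m F^H) + rtr (w i) / t) => [i|].
  have -> : Phi *m (K *m w i *m K^H) *m Phi^H = (Phi *m K) *m w i *m (Phi *m K)^H.
    by rewrite hadjM !mulmxA.
  exact: tnb_gentle.
rewrite big_split /= -mulr_sumr -mulr_suml lerD2r; apply: ler_wpM2l; first by rewrite addr_ge0// ltW.
rewrite -rtr_sum -mulmx_suml -mulmx_sumr.
apply: le_trans (_ : rtr (F *m Y *m F^H) <= _).
  by apply: rtr_le; have := psdmx_congr F hY; rewrite mulmxBr mulmxBl.
apply: le_trans (Re_le hK2) _; rewrite -/(rtr _) rtrD lerD2l.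
rewrite -scalemx1 rtrZ rtr1 /d' mulrAC ler_pdivrMr// ler_pM2l//.
by rewrite ler_nat.
Qed.

(** Pretty good measurement for the tests [Th]. The regularization is counted among the competitors
    of [i], so that [hayashi_nagaoka] applies to [S = Th i] for every [i]. *)
Lemma decoder (B I : finType) (Th : I -> op R B) (d : R) :
  0 < d -> (forall i, psdmx (Th i)) -> (forall i, psdmx (1%:M - Th i)) ->
  exists L : I -> op R B, [/\ forall i, psdmx (L i), psdmx (1%:M - \sum_i L i) &
    forall i, psdmx (2 *: (1%:M - Th i) + 4 *: (\sum_(j | j != i) Th j + d%:C%C%:M)
                     - (1%:M - L i))].
Proof.
move=> d0 h0 h1; pose Y := \sum_i Th i + d%:C%C%:M.
have dC : 0 < d%:C%C :> C by rewrite ltcE /= eqxx.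
have hd : psdmx (d%:C%C%:M : op R B) by apply: psdmx_scalar; apply: ltW.
have hY : psdmx (Y - d%:C%C%:M) by rewrite addrK; apply: psdmx_sum.
have hZ := isqrtmx_herm dC hY; have hZ1 := isqrtmx_congr dC hY.
exists (fun i => isqrtmx Y *m Th i *m isqrtmx Y); split=> [i||i].
- exact: psdmx_conj.
- rewrite -mulmx_suml -mulmx_sumr -{1}hZ1 -mulmxBl -mulmxBr.
  by apply: psdmx_conj => //; rewrite /Y addrC addKr.
have eY : Th i + (\sum_(j | j != i) Th j + d%:C%C%:M) = Y by rewrite addrA /Y [X in _ = X + _](bigD1 i).
rewrite -eY; apply: (@hayashi_nagaoka _ _ (Th i) _ d%:C%C) => //; last by rewrite eY.
by apply: psdmxD => //; apply: psdmx_sum.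
Qed.

(** Three errors occur at outcome [i]: the deviations [s j - w j] as seen by [L i], the weight [L i]
    takes from a wrong [w j], and the disturbance of the right [w i]. Summed over [i], the wrong
    weight is at most the total failure probability and the disturbance [1 + t] times it plus the
    [1 / t] terms, which gives [2 + t]. *)
Lemma decoding_error (S B I : finType) (L : I -> op R B) (w s : I -> op R (S * B)%type)
    (a : I -> R) (t : R) :
  0 < t -> (forall i, psdmx (L i)) -> psdmx (1%:M - \sum_i L i) ->
  (forall i, psdmx (w i)) -> (forall i, tnb (s i - w i) (a i)) ->
  let sL i := tens (idop R S) (sqrtmx (L i)) in
  exists2 e : I -> R, (forall i, tnb (sL i *m (\sum_j s j) *m sL i - w i) (e i)) &
    \sum_i e i <= \sum_i a i + \sum_i ((2 + t) * (rtr (w i) - rtr (L i *m ptrace1 (w i)))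
                                       + rtr (w i) / t).
Proof.
move=> t0 hL hL1 hw hs sL.
pose good i (pq : op R (S * B)%type * op R (S * B)%type) :=
  [/\ psdmx pq.1, psdmx pq.2, s i - w i = pq.1 - pq.2 & rtr pq.1 + rtr pq.2 <= a i].
have /boolp.choice[PQ hPQ] i : exists pq, good i pq.
  by have [P [Q h]] := hs i; exists (P, Q).
have sLH i : (sL i)^H = sL i by apply/psdmx_herm/tens_id_psd/sqrtmx_psd.
have sLK i : sL i *m sL i = tens (idop R S) (L i) by rewrite tens_idM sqrtmxK.
have sLtr i N : rtr (sL i *m N *m sL i) = rtr (L i *m ptrace1 N).
  by rewrite rtrC mulmxA sLK rtr_tens_id_mul.
have Lle i : psdmx (1%:M - L i).
  apply: psdmx_trans hL1; rewrite (bigD1 i)//= addrAC subrr add0r.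
  exact: psdmx_sum.
have sum_le (N : op R (S * B)%type) : psdmx N -> \sum_i rtr (L i *m ptrace1 N) <= rtr N.
  move=> hN; rewrite -rtr_sum -mulmx_suml; have := rtr_mul_lel (ptrace1_psd hN) hL1.
  by rewrite mul1mx rtr_ptrace1.
pose e1 i := \sum_j (rtr (L i *m ptrace1 (PQ j).1) + rtr (L i *m ptrace1 (PQ j).2)).
pose e2 i := \sum_(j | j != i) rtr (L i *m ptrace1 (w j)).
pose e3 i := (1 + t) * (rtr (w i) - rtr (L i *m ptrace1 (w i))) + rtr (w i) / t.
exists (fun i => e1 i + e2 i + e3 i) => [i|].
  have -> : sL i *m (\sum_j s j) *m sL i - w i =
    \sum_j sL i *m (s j - w j) *m sL i + \sum_(j | j != i) sL i *m w j *m sL i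
    + (sL i *m w i *m (sL i)^H - w i).
    rewrite sLH -!mulmx_suml -!mulmx_sumr sumrB mulmxBr mulmxBl [\sum_j w j](bigD1 i)//=.
    by rewrite mulmxDr mulmxDl; move: (sL i *m w i *m sL i) => z; mxlin.
  apply: tnbD; [apply: tnbD|].
  - apply: tnb_sum => j _; have [hP hQ -> _] := hPQ j; rewrite mulmxBr mulmxBl.
    exists (sL i *m (PQ j).1 *m sL i), (sL i *m (PQ j).2 *m sL i).
    by split; rewrite ?sLtr//; apply: psdmx_conj.
  - apply: tnb_sum => j _; rewrite -sLtr; apply: tnb_psd.
    exact: psdmx_conj.
  apply: tnb_gentle => //.
  have hF : sL i - 1%:M = tens (idop R S) (sqrtmx (L i) - 1%:M) by rewrite tens_idB tens_id1.
  have hFH : (sL i - 1%:M)^H = sL i - 1%:M by rewrite hadjB hadj1 sLH.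
  rewrite hFH rtrC mulmxA hF tens_idM rtr_tens_id_mul.
  have := rtr_mul_lel (ptrace1_psd (hw i)) (psdmx_one_sub_sqrt (hL i) (Lle i)).
  have -> : rtr ((1%:M - L i) *m ptrace1 (w i)) = rtr (w i) - rtr (L i *m ptrace1 (w i)).
    by rewrite mulmxBl mul1mx rtrB rtr_ptrace1.
  apply: le_trans.
  have -> : (sqrtmx (L i) - 1%:M) *m (sqrtmx (L i) - 1%:M)
      = (1%:M - sqrtmx (L i)) *m (1%:M - sqrtmx (L i)).
    by rewrite -(opprB 1%:M) mulNmx mulmxN opprK.
  exact: lexx.
rewrite !big_split /= -!addrA lerD//.
  rewrite exchange_big /=; apply: ler_sum => j _; have [hP hQ _] := hPQ j; apply: le_trans.
  by rewrite big_split /= lerD// sum_le.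
have -> : \sum_i e2 i = \sum_j \sum_(i | i != j) rtr (L i *m ptrace1 (w j)).
  rewrite /e2 [RHS](exchange_big_dep xpredT)//=; apply: eq_bigr => i _.
  by apply: eq_bigl => j; rewrite eq_sym.
rewrite addrA lerD2r -big_split /= ; apply: ler_sum => j _.
have := sum_le (w j) (hw j); rewrite (bigD1 j)//=; lra.
Qed.

End OneShot.

(** * From a codebook to a complete protocol *)

Section CodebookProtocol.
Variable R : realType.
Local Notation C := R[i].

(** The completing outcome sits at index 0 and the others are shifted by [lift ord0]; this is the
    origin of [M.+1] messages and [K.+1] decoder outcomes. *)
Lemma povm_option (T : finType) n (E : 'I_n -> op R T) :
  (forall i, psdmx (E i)) -> psdmx (1%:M - \sum_i E i) ->
  povm (fun i : 'I_n.+1 => oapp E (1%:M - \sum_i E i) (unlift ord0 i)).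
Proof.
move=> h h1; split=> [i|].
  by apply/psdE; case: (unlift ord0 i) => [j|]; [apply: h | apply: h1].
rewrite big_ord_recl unlift_none /= [X in _ + X](eq_bigr E) ?subrK// => i _.
by rewrite liftK.
Qed.

Lemma sum_lift0 (V : nmodType) m n (F : 'I_m.+1 -> 'I_n.+1 -> V) :
  (forall j, F ord0 j = 0) -> (forall i, F i ord0 = 0) ->
  \sum_i \sum_j F i j = \sum_i \sum_j F (lift ord0 i) (lift ord0 j).
Proof.
move=> h1 h2; rewrite big_ord_recl big1 ?add0r//; apply: eq_bigr => i _.
by rewrite big_ord_recl h2 add0r.
Qed.

Section Protocol.
Variables (S B A X : finType) (Phi : rop R (S * B)%type A) (W : X -> op R (S * B)%type).
Variables (Theta : X -> op R B) (M K : nat) (c : 'I_M -> 'I_K -> X).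
Variables (Delta : op R (S * B)%type) (d t : R) (Pur : op R (A * (S * B))%type).
Hypothesis hPur : forall a p a' q,
  rent Pur (a, p) (a', q) = rent Phi p a * (rent Phi q a')^*.
Hypotheses (M0 : (0 < M)%N) (K0 : (0 < K)%N) (d0 : 0 < d) (t0 : 0 < t).
Hypotheses (hW : forall x, psdmx (W x)) (trW : forall x, rtr (W x) = 1).
Hypotheses (hTh : forall x, psdmx (Theta x)) (hTh1 : forall x, psdmx (1%:M - Theta x)).
Hypothesis trPhi : rtr (Phi *m Phi^H) = 1.
Hypothesis hDelta : psdmx Delta.

Let L : R := (M * K)%:R.
Let v : R := L^-1.

Hypothesis hcov : psdmx (Phi *m Phi^H + Delta - \sum_m \sum_k v%:C%C *: W (c m k)).

(** The Hayashi-Nagaoka bound on the decoding error inside a bin, averaged over all codewords. *)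
Definition decoding_failure : R := v * \sum_m \sum_k
  (2 * (1 - rtr (Theta (c m k) *m ptrace1 (W (c m k))))
   + 4 * (\sum_(j | j != k) rtr (Theta (c m j) *m ptrace1 (W (c m k))) + d)).

Lemma codebook_size_gt0 : 0 < L.
Proof. by rewrite ltr0n muln_gt0 M0 K0. Qed.

Lemma sum_codebook : \sum_(m < M) \sum_(k < K) v = 1.
Proof.
under eq_bigr => m _ do rewrite sumr_const card_ord.
rewrite sumr_const card_ord -mulrnA -[_ *+ _]mulr_natr mulnC mulVf//.
by rewrite gt_eqF// codebook_size_gt0.
Qed.

Lemma codebook_protocol :
  exists (Om : 'I_M.+1 -> op R A) (Lam : 'I_M.+1 -> 'I_K.+1 -> op R B)
         (f : 'I_M.+1 -> 'I_K.+1 -> X),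
  [/\ povm Om, forall m, povm (Lam m) &
   let sL m k := tens (idop R S) (msqrt (Lam m k)) in
   let tau m k := sL m k *m ptrace1 (tens (Om m) (idop R (S * B)%type) *m Pur) *m sL m k in
   trnorm (\sum_m \sum_k tens (Defs.proj R (f m k)) (tau m k)
           - \sum_m \sum_k \tr (tau m k) *: tens (Defs.proj R (f m k)) (W (f m k)))
     <= 4 * ((1 + t) * (rtr Delta + d) + 2 / t + (2 + t) * decoding_failure)].
Proof.
have L0 := codebook_size_gt0; have v0 : 0 <= v by rewrite invr_ge0 ltW.
(* Arbitrary reconstruction assigned to the failure outcomes. *)
pose x0 : X := c (Ordinal M0) (Ordinal K0).
pose w (p : 'I_M * 'I_K) := v%:C%C *: W (c p.1 p.2).
have hw p : psdmx (w p) by apply: psdmxZr.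
have trw p : rtr (w p) = v by rewrite rtrZ trW mulr1.
have sum_w : \sum_p rtr (w p) = 1.
  by rewrite -sum_codebook pair_big; apply: eq_bigr => p _; rewrite trw.
have hcov' : psdmx (Phi *m Phi^H + Delta - \sum_p w p).
  by move: hcov; rewrite pair_big.
have [E [hE hE1 /(_ t t0)[a ha sum_a]]] := encoder d0 hDelta hw hcov'.
have /boolp.choice[Lm hLm] m := decoder d0 (fun k => hTh (c m k)) (fun k => hTh1 (c m k)).
have hL m k : psdmx (Lm m k) by have [] := hLm m.
have hL1 m : psdmx (1%:M - \sum_k Lm m k) by have [] := hLm m.
pose s m k : op R (S * B)%type := Phi *m E (m, k) *m Phi^H.
pose sL m k := tens (idop R S) (sqrtmx (Lm m k)).
pose wrong m k := v - rtr (Lm m k *m ptrace1 (w (m, k))).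
pose good m (e : 'I_K -> R) :=
  (forall k, tnb (sL m k *m (\sum_j s m j) *m sL m k - w (m, k)) (e k)) /\
  \sum_k e k <= \sum_k a (m, k) + \sum_k ((2 + t) * wrong m k + v / t).
have /boolp.choice[e he] m : exists e, good m e.
  have [e h1 h2] := decoding_error t0 (hL m) (hL1 m) (fun k => hw (m, k))
    (fun k => ha (m, k)).
  exists e; split=> //; apply: le_trans h2 _; rewrite lerD2l.
  by apply: ler_sum => k _; rewrite trw.
have wrong_le m k : wrong m k <= v * (2 * (1 - rtr (Theta (c m k) *m ptrace1 (W (c m k))))
   + 4 * (\sum_(j | j != k) rtr (Theta (c m j) *m ptrace1 (W (c m k))) + d)).
  have [_ _ /(_ k) h] := hLm m.
  have hWB := ptrace1_psd (hW (c m k)).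
  have -> : wrong m k = v * rtr ((1%:M - Lm m k) *m ptrace1 (W (c m k))).
    rewrite /wrong mulmxBl mul1mx rtrB rtr_ptrace1 trW mulrBr mulr1; congr (_ - _).
    rewrite -rtrZ; congr rtr; rewrite scalemxAr; congr (_ *m _).
    rewrite !ptrace1E scaler_sumr; apply: eq_bigr => i _.
    by rewrite /w -scalemxAr -scalemxAl.
  apply: ler_wpM2l => //; apply: le_trans (rtr_mul_lel hWB h) _.
  have -> : 2 = (2%:R)%:C%C :> C by rewrite rmorph_nat.
  have -> : 4 = (4%:R)%:C%C :> C by rewrite rmorph_nat.
  rewrite mulmxDl -!scalemxAl rtrD !rtrZ mulmxBl mulmxDl mul1mx rtrB rtrD rtr_ptrace1 trW.
  rewrite mul_scalar_mx rtrZ rtr_ptrace1 trW mulr1 mulmx_suml rtr_sum; exact: lexx.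
(* The sum over [k] means that only the bin is announced. The transpose cancels the one produced by
   [steer_ptrace1]. *)
pose Es m : op R A := (\sum_k E (m, k))^T.
have hEs m : psdmx (Es m) by apply/psdmx_tr/psdmx_sum.
have hEs1 : psdmx (1%:M - \sum_m Es m).
  have -> : 1%:M - \sum_m Es m = (1%:M - \sum_p E p)^T.
    rewrite raddfB /= trmx1 -raddf_sum /=; congr (_ - _^T).
    by rewrite pair_big; apply: eq_bigr => -[].
  exact: psdmx_tr.
pose Om (i : 'I_M.+1) : op R A := oapp Es (1%:M - \sum_m Es m) (unlift ord0 i).
have hOm : povm Om by apply: povm_option.
pose Lf m (j : 'I_K.+1) : op R B := oapp (Lm m) (1%:M - \sum_k Lm m k) (unlift ord0 j).
(* After the failure message the decoder always answers index 0. *)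
pose L0f (j : 'I_K.+1) : op R B :=
  oapp (fun=> 0) (1%:M - \sum_(k < K) (0 : op R B)) (unlift ord0 j).
pose Lam (i : 'I_M.+1) : 'I_K.+1 -> op R B := oapp Lf L0f (unlift ord0 i).
have hLam i : povm (Lam i).
  rewrite /Lam; case: (unlift ord0 i) => [m|] /=; apply: povm_option => //.
    by move=> k; apply: psdmx0.
  by rewrite big1// subr0; apply: psdmx1.
have hLamp i j : psdmx (Lam i j) by apply/psdE; have [] := hLam i.
pose f (i : 'I_M.+1) (j : 'I_K.+1) : X :=
  if unlift ord0 i is Some m then oapp (c m) x0 (unlift ord0 j) else x0.
exists Om, Lam, f; split=> //= .
pose tau i j := tens (idop R S) (msqrt (Lam i j)) *m
  ptrace1 (tens (Om i) (idop R (S * B)%type) *m Pur) *m tens (idop R S) (msqrt (Lam i j)).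
rewrite -[X in trnorm X]/(\sum_m \sum_k tens (Defs.proj R (f m k)) (tau m k)
  - \sum_m \sum_k \tr (tau m k) *: tens (Defs.proj R (f m k)) (W (f m k))).
have tauE i j : tau i j = tens (idop R S) (sqrtmx (Lam i j)) *m
    (Phi *m (Om i)^T *m Phi^H) *m tens (idop R S) (sqrtmx (Lam i j)).
  by rewrite /tau (steer_ptrace1 _ hPur).
have sqH i j : (tens (idop R S) (sqrtmx (Lam i j)))^H = tens (idop R S) (sqrtmx (Lam i j)).
  exact/psdmx_herm/tens_id_psd/sqrtmx_psd.
have htau i j : psdmx (tau i j).
  rewrite tauE; apply: psdmx_conj => //; apply/psdmx_congr/psdmx_tr.
  by apply/psdE; have [] := hOm.
have tr_tau i j : rtr (tau i j) = rtr (Lam i j *m ptrace1 (Phi *m (Om i)^T *m Phi^H)).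
  by rewrite tauE rtrC mulmxA tens_idM sqrtmxK// rtr_tens_id_mul.
have tr_tot : \sum_i \sum_j rtr (tau i j) = 1.
  rewrite -trPhi; have -> : Phi *m Phi^H = \sum_i Phi *m (Om i)^T *m Phi^H.
    rewrite -mulmx_suml -mulmx_sumr -raddf_sum /=.
    by have [_ ->] := hOm; rewrite trmx1 mulmx1.
  rewrite rtr_sum; apply: eq_bigr => i _; under eq_bigr => j _ do rewrite tr_tau.
  rewrite -rtr_sum -mulmx_suml; have [_ ->] := hLam i.
  by rewrite mul1mx rtr_ptrace1.
have tau_reg m k : tau (lift ord0 m) (lift ord0 k) = sL m k *m (\sum_j s m j) *m sL m k.
  rewrite tauE /Lam /Om !liftK /= /Lf liftK /= /Es trmxK; congr (_ *m _ *m _).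
  by rewrite mulmx_sumr mulmx_suml.
(* The error is [e m k] at a regular pair and the whole trace of [tau] at a failure pair. Writing
   both as a trace plus [g] makes it possible to use that all the traces sum to 1. *)
pose g (i : 'I_M.+1) (j : 'I_K.+1) : R :=
  if unlift ord0 i is Some m then oapp (fun k => e m k - rtr (tau i j)) 0 (unlift ord0 j)
  else 0.
pose cc (i : 'I_M.+1) (j : 'I_K.+1) : R :=
  if unlift ord0 i is Some m then oapp (fun k => v) 0 (unlift ord0 j) else 0.
have htnb i j : tnb (tau i j - (cc i j)%:C%C *: W (f i j)) (rtr (tau i j) + g i j).
  have triv : tnb (tau i j - 0%:C%C *: W (f i j)) (rtr (tau i j) + 0).
    by rewrite scale0r subr0 addr0; apply: tnb_psd.
  rewrite /cc /g /f in triv *; case: (unliftP ord0 i) triv => [m ei|ei //] triv.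
  case: (unliftP ord0 j) triv => [k ej|ej //] _ /=.
  by rewrite [X in tnb _ X]addrC subrK ei ej tau_reg; have [h _] := he m; apply: h.
apply: trnorm_le; apply: tnb_le (classical_register_bound f htau _ _ htnb) => //.
under eq_bigr => i _ do rewrite big_split /=.
rewrite big_split /= tr_tot.
have -> : \sum_i \sum_j g i j = \sum_m \sum_k (e m k - rtr (tau (lift ord0 m) (lift ord0 k))).
  rewrite sum_lift0 => [|j|i]; last 2 first.
  - by rewrite /g unlift_none.
  - by rewrite /g unlift_none; case: (unlift ord0 i).
  by apply: eq_bigr => m _; apply: eq_bigr => k _; rewrite /g !liftK.
have -> : 1 + \sum_m \sum_k (e m k - rtr (tau (lift ord0 m) (lift ord0 k)))
   = \sum_m \sum_k (v + (e m k - rtr (tau (lift ord0 m) (lift ord0 k)))).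
  by rewrite -{1}sum_codebook -big_split; apply: eq_bigr => m _; rewrite -big_split.
(* Regular traces differ from [v] by at most [e m k], so the failure mass is again at most the sum
   of the [e m k]. With the 2 of [classical_register_bound] this makes the factor 4. *)
have step1 : \sum_m \sum_k (v + (e m k - rtr (tau (lift ord0 m) (lift ord0 k))))
   <= \sum_m \sum_k 2 * e m k.
  apply: ler_sum => m _; apply: ler_sum => k _; have [h _] := he m.
  have := tnb_trace (h k); rewrite -tau_reg rtrB trw ler_norml; lra.
have step2 : \sum_m \sum_k e m k <= (1 + t) * (rtr Delta + d) + 1 / t
    + ((2 + t) * decoding_failure + 1 / t).
  apply: le_trans (_ : \sum_m (\sum_k a (m, k) + \sum_k ((2 + t) * wrong m k + v / t)) <= _).
    by apply: ler_sum => m _; have [] := he m.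
  rewrite big_split /=; apply: lerD.
    have -> : \sum_m \sum_k a (m, k) = \sum_p a p by rewrite pair_big; apply: eq_bigr => -[].
    by move: sum_a; rewrite sum_w.
  under eq_bigr => m _ do rewrite big_split /= -mulr_sumr -mulr_suml.
  rewrite big_split /= -mulr_sumr -mulr_suml sum_codebook lerD2r.
  apply: ler_wpM2l; first by rewrite addr_ge0// ltW.
  rewrite /decoding_failure mulr_sumr; apply: ler_sum => m _.
  by rewrite mulr_sumr; apply: ler_sum.
have step3 : \sum_m \sum_k 2 * e m k = 2 * \sum_m \sum_k e m k.
  by rewrite mulr_sumr; apply: eq_bigr => m _; rewrite mulr_sumr.
have tt : 2 / t = 1 / t + 1 / t by field; rewrite gt_eqF.
move: step1 step2; rewrite step3 tt; lra.
Qed.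

End Protocol.
End CodebookProtocol.

(** * Independent sampling *)

Section Average.
Variables (R : realType) (I : finType) (q : I -> R).
Implicit Types F G : I -> R.

Definition avg F : R := \sum_i q i * F i.

Lemma eq_avg F G : F =1 G -> avg F = avg G.
Proof. by move=> h; apply: eq_bigr => i _; rewrite h. Qed.

Lemma avgD F G : avg (fun i => F i + G i) = avg F + avg G.
Proof. by rewrite /avg -big_split; apply: eq_bigr => i _; rewrite mulrDr. Qed.

Lemma avgB F G : avg (fun i => F i - G i) = avg F - avg G.
Proof. by rewrite /avg -sumrB; apply: eq_bigr => i _; rewrite mulrBr. Qed.

Lemma avgZ a F : avg (fun i => a * F i) = a * avg F.
Proof. by rewrite /avg mulr_sumr; apply: eq_bigr => i _; rewrite mulrCA. Qed.

Lemma avg_sum (K : finType) (P : pred K) (F : K -> I -> R) :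
  avg (fun i => \sum_(k | P k) F k i) = \sum_(k | P k) avg (F k).
Proof.
by rewrite /avg exchange_big /=; apply: eq_bigr => i _; rewrite mulr_sumr.
Qed.

Lemma avg_cst a : \sum_i q i = 1 -> avg (fun=> a) = a.
Proof. by move=> h; rewrite /avg -mulr_suml h mul1r. Qed.

Lemma avg_le F G : (forall i, 0 <= q i) -> (forall i, F i <= G i) -> avg F <= avg G.
Proof. by move=> h0 h; apply: ler_sum => i _; apply: ler_wpM2l. Qed.

End Average.

Section Sampling.
Variables (R : realType) (J Y : finType) (p : Y -> R).
Hypotheses (p0 : forall y, 0 <= p y) (p1 : \sum_y p y = 1).
Implicit Types c : {ffun J -> Y}.

(** Product law, used both for random codebooks, with [J] the set of codeword indices, and for
    i.i.d. blocks, with [J] the set of positions. *)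
Definition wt c : R := \prod_j p (c j).

Lemma wt_ge0 c : 0 <= wt c.
Proof. by apply: prodr_ge0. Qed.

Lemma sum_wt_prod (F : J -> Y -> R) :
  \sum_c wt c * \prod_j F j (c j) = \prod_j \sum_y p y * F j y.
Proof. by rewrite bigA_distr_bigA; apply: eq_bigr => c _; rewrite -big_split. Qed.

Lemma sum_wt : \sum_c wt c = 1.
Proof.
transitivity (\sum_c wt c * \prod_(j : J) (1 : R)).
  by apply: eq_bigr => c _; rewrite big1_eq mulr1.
rewrite (sum_wt_prod (fun _ _ => 1)) big1// => j _; rewrite -[RHS]p1.
by apply: eq_bigr => y _; rewrite mulr1.
Qed.

Lemma sum_wt2_prod (g h : Y -> R) j k : j != k ->
  avg wt (fun c => g (c j) * h (c k)) = avg p g * avg p h.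
Proof.
rewrite /avg => jk; pose F i y := if i == j then g y else if i == k then h y else 1.
have jk' : (k == j) = false by apply/negbTE; rewrite eq_sym.
transitivity (\sum_c wt c * \prod_i F i (c i)).
  apply: eq_bigr => c _; congr (_ * _); rewrite (bigD1 j)//= (bigD1 k)/=; last by rewrite jk'.
  rewrite /F eqxx jk' eqxx big1 ?mulr1// => i /andP[/negPf-> /negPf->] //.
rewrite sum_wt_prod (bigD1 j)//= (bigD1 k)/=; last by rewrite jk'.
rewrite [X in _ * (_ * X)]big1 => [|i /andP[/negPf ij /negPf ik]]; last first.
  by rewrite -p1; apply: eq_bigr => y _; rewrite /F ij ik mulr1.
by rewrite mulr1; congr (_ * _); apply: eq_bigr => y _; rewrite /F ?jk' eqxx.
Qed.

Lemma sum_wt1 (g : Y -> R) j : avg wt (fun c => g (c j)) = avg p g.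
Proof.
rewrite /avg.
pose F i y := if i == j then g y else 1.
transitivity (\sum_c wt c * \prod_i F i (c i)).
  apply: eq_bigr => c _; congr (_ * _); rewrite (bigD1 j)//= /F eqxx big1 ?mulr1//.
  by move=> i /negPf->.
rewrite sum_wt_prod (bigD1 j)//= /F eqxx [X in _ * X]big1 ?mulr1// => i /negPf->.
by rewrite -[RHS]p1; apply: eq_bigr => y _; rewrite mulr1.
Qed.

(** Expanding [h] in indicators reduces this to products. The general form is needed for traces of
    products of two operators. *)
Lemma sum_wt2 (h : Y -> Y -> R) j k : j != k ->
  avg wt (fun c => h (c j) (c k)) = avg p (fun y => avg p (h y)).
Proof.
move=> jk; rewrite /avg.
 transitivity (\sum_c \sum_y \sum_z h y z * (wt c * ((c j == y)%:R * (c k == z)%:R))).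
  apply: eq_bigr => c _; rewrite (bigD1 (c j))//= (bigD1 (c k))//= !eqxx !mulr1.
  rewrite [X in _ + X + _]big1 => [|z /negPf hz]; last by rewrite eq_sym hz !mulr0.
  rewrite [X in _ + _ + X]big1 => [|y /negPf hy]; first by rewrite !addr0 mulrC.
  by apply: big1 => z _; rewrite [_ == y]eq_sym hy mul0r !mulr0.
rewrite exchange_big; apply: eq_bigr => y _; rewrite exchange_big mulr_sumr; apply: eq_bigr => z _ /=.
rewrite -mulr_sumr -/(avg wt _) (sum_wt2_prod (fun u => (u == y)%:R) (fun u => (u == z)%:R) jk).
have h1 w : avg p (fun u => (u == w)%:R) = p w.
  by rewrite /avg (bigD1 w)//= eqxx mulr1 big1 ?addr0// => u /negPf->; rewrite mulr0.
by rewrite !h1 mulrC mulrA.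
Qed.

Lemma expectation_le_exists (F : {ffun J -> Y} -> R) b :
  avg wt F <= b -> exists c, F c <= b.
Proof.
move=> h; have [c0 _|no] := pickP (@predT {ffun J -> Y}); last first.
  by have := sum_wt; rewrite big_pred0// => /eqP; rewrite eq_sym oner_eq0.
have [c1 _ hc1] := @arg_minP _ _ _ c0 predT F isT; exists c1; apply: le_trans h.
rewrite -[leLHS](avg_cst _ sum_wt); apply: avg_le => c'; [exact: wt_ge0|exact: hc1].
Qed.

End Sampling.

(** * Random codebooks *)

Section RandomCoding.
Variable R : realType.
Local Notation C := R[i].

Lemma rtr1_dim_gt0 n (M : 'M[C]_n) : rtr M = 1 -> (0 < n)%N.
Proof.
case: n M => // M; rewrite /rtr /mxtrace big_ord0 /= => /eqP.
by rewrite eq_sym oner_eq0.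
Qed.

Definition isproj {n} (P : 'M[C]_n) : Prop := P^H = P /\ P *m P = P.

Lemma isproj_psd n (P : 'M[C]_n) : isproj P -> psdmx P.
Proof. by case=> h1 h2; rewrite -h2; apply: psdmx_sqr. Qed.

Lemma isproj_compl n (P : 'M[C]_n) : isproj P -> isproj (1%:M - P).
Proof.
case=> h1 h2; split; first by rewrite hadjB hadj1 h1.
by rewrite mulmxBl mul1mx mulmxBr mulmx1 h2 subrr subr0.
Qed.

Lemma isproj_le1 n (P : 'M[C]_n) : isproj P -> psdmx (1%:M - P).
Proof. by move=> /isproj_compl/isproj_psd. Qed.

Lemma tnb_proj n (P W : 'M[C]_n) (t : R) : 0 < t -> psdmx W -> isproj P ->
  tnb (W - P *m W *m P) ((1 + t) * rtr ((1%:M - P) *m W) + rtr W / t).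
Proof.
move=> t0 hW hP; have [h1 h2] := hP; have [h3 h4] := isproj_compl hP.
rewrite -opprB; apply: tnbN; rewrite -{2}h1; apply: tnb_gentle => //.
have -> : (P - 1%:M) *m W *m (P - 1%:M)^H = (1%:M - P) *m W *m (1%:M - P).
  by rewrite -(opprB 1%:M) hadjN h3 mulNmx mulmxN mulNmx opprK.
by rewrite rtrC mulmxA h4.
Qed.

Lemma rtr_proj_conj_le n (P W : 'M[C]_n) : psdmx W -> isproj P -> rtr (P *m W *m P) <= rtr W.
Proof.
move=> hW hP; have [_ h2] := hP; rewrite rtrC mulmxA h2.
by have := rtr_mul_lel hW (isproj_le1 hP); rewrite mul1mx.
Qed.

Section Ensemble.
Variables (X T : finType) (p : X -> R) (W : X -> op R T).
Variables (Pi : X -> op R T) (P0 : op R T) (eps a1 a2 t : R).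
Hypotheses (p0 : forall x, 0 <= p x) (p1 : \sum_x p x = 1).
Hypotheses (hW : forall x, psdmx (W x)) (trW : forall x, rtr (W x) = 1).
Hypotheses (hPi : forall x, isproj (Pi x)) (hP0 : isproj P0) (t0 : 0 < t).

Definition mean (F : X -> op R T) : op R T := \sum_x (p x)%:C%C *: F x.

Lemma rtr_mean F : rtr (mean F) = avg p (fun x => rtr (F x)).
Proof. by rewrite rtr_sum; apply: eq_bigr => x _; rewrite rtrZ. Qed.

Lemma mean_psd F : (forall x, psdmx (F x)) -> psdmx (mean F).
Proof. by move=> h; apply: psdmx_sum => x _; apply: psdmxZr. Qed.

Lemma mul_mean (M : op R T) F : M *m mean F = mean (fun x => M *m F x).
Proof. by rewrite mulmx_sumr; apply: eq_bigr => x _; rewrite -scalemxAr. Qed.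

Lemma mean_mul (M : op R T) F : mean F *m M = mean (fun x => F x *m M).
Proof. by rewrite mulmx_suml; apply: eq_bigr => x _; rewrite -scalemxAl. Qed.

Hypothesis h_eps : avg p (fun x => rtr ((1%:M - Pi x) *m W x)) <= eps.
Hypothesis h_eps0 : rtr ((1%:M - P0) *m mean W) <= eps.
Hypothesis h_a1 : forall x, psdmx (a1%:C%C%:M - Pi x *m W x *m Pi x).
Hypothesis h_a2 : rtr P0 <= a2.

(** The inner cut bounds the eigenvalues by [a1]; the outer one confines all states to a common
    subspace of dimension at most [a2]. For typical projectors [a1 * a2] is about
    [exp (n I(X;RB))]. *)
Definition truncated x : op R T := P0 *m (Pi x *m W x *m Pi x) *m P0.

Definition trunc_err x : R :=
  (1 + t) * (rtr ((1%:M - P0) *m W x) + rtr ((1%:M - Pi x) *m W x)) + 2 / t.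

Lemma trunc_psd x : psdmx (truncated x).
Proof.
have [h _] := hP0; apply: psdmx_conj => //; have [h' _] := hPi x.
exact: psdmx_conj.
Qed.

Lemma trunc_tnb x : tnb (W x - truncated x) (trunc_err x).
Proof.
have -> : W x - truncated x = (W x - P0 *m W x *m P0)
    + P0 *m (W x - Pi x *m W x *m Pi x) *m P0^H.
  by have [-> _] := hP0; rewrite mulmxBr mulmxBl addrA subrK.
have -> : trunc_err x = ((1 + t) * rtr ((1%:M - P0) *m W x) + rtr (W x) / t)
  + ((1 + t) * rtr ((1%:M - Pi x) *m W x) + rtr (W x) / t).
  by rewrite trW /trunc_err; field; rewrite gt_eqF.
apply: tnbD; first exact: tnb_proj.
apply: tnb_congr; last exact: tnb_proj.
by have [-> ->] := hP0; apply: isproj_le1.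
Qed.

Lemma trunc_err_mean : avg p trunc_err <= (1 + t) * (2 * eps) + 2 / t.
Proof.
rewrite /trunc_err avgD avg_cst// avgZ avgD lerD2r; apply: ler_wpM2l.
  by rewrite addr_ge0// ltW.
by move: h_eps h_eps0; rewrite mul_mean rtr_mean; lra.
Qed.

Lemma trunc_le x : psdmx (a1%:C%C *: P0 - truncated x).
Proof.
have [h1 h2] := hP0; have := psdmx_conj h1 (h_a1 x); congr psdmx.
by rewrite mulmxBr mulmxBl mul_mx_scalar -scalemxAl h2.
Qed.

Lemma trunc_trace_le1 x : rtr (truncated x) <= 1.
Proof.
rewrite -(trW x); apply: le_trans (rtr_proj_conj_le _ hP0) (rtr_proj_conj_le (hW x) (hPi x)).
by have [h' _] := hPi x; apply: psdmx_conj.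
Qed.

Lemma a1_ge0 (x : X) : (0 < #|T|)%N -> 0 <= a1.
Proof.
move=> T0; have [h1 _] := hPi x.
have h2 : psdmx (Pi x *m W x *m Pi x) by apply: psdmx_conj.
have /rtr_ge0 : psdmx (a1%:C%C%:M : op R T) by have := psdmxD (h_a1 x) h2; rewrite subrK.
by rewrite -scalemx1 rtrZ rtr1 pmulr_lge0// ltr0n.
Qed.

Lemma trunc_sqr_le x : rtr (truncated x *m truncated x) <= a1.
Proof.
have hT := trunc_psd x; have h0 := a1_ge0 x (rtr1_dim_gt0 (trW x)).
apply: le_trans (rtr_mul_lel hT (trunc_le x)) _; rewrite -scalemxAl rtrZ -[leRHS]mulr1.
apply: ler_wpM2l => //; apply: le_trans (trunc_trace_le1 x).
by have := rtr_mul_lel hT (isproj_le1 hP0); rewrite mul1mx.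
Qed.

Section Covering.
Variables (J : finType) (u : R).
Hypotheses (J0 : (0 < #|J|)%N) (u0 : 0 < u) (a20 : 0 < a2).
Implicit Types c : {ffun J -> X}.
Let v : R := (#|J|%:R)^-1.

Definition deviation x : op R T := truncated x - mean truncated.

Definition fluctuation c : op R T := v%:C%C *: \sum_l deviation (c l).

(** A real function of the codebook, ready to be averaged; its terms follow [sampling_split]. The
    parameter of [tnb_rank] is [u * a2], so that the dimension of the subspace contributes at most
    [1 / u]. *)
Definition covering_err c : R :=
  v * \sum_l trunc_err (c l)
  + (u * a2 * rtr (fluctuation c *m fluctuation c) + rtr P0 / (u * a2)) / 2
  + avg p trunc_err.

Let v0 : 0 <= v. Proof. by rewrite invr_ge0 ler0n. Qed.

Let Jv : #|J|%:R * v = 1. Proof. by rewrite mulfV// pnatr_eq0 -lt0n. Qed.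

Lemma deviation_herm x : (deviation x)^H = deviation x.
Proof. by rewrite hadjB !psdmx_herm//; [apply/mean_psd/trunc_psd|exact: trunc_psd]. Qed.

Lemma deviation_projr x : deviation x *m P0 = deviation x.
Proof.
have [_ h] := hP0; have ht y : truncated y *m P0 = truncated y by rewrite /truncated -mulmxA h.
by rewrite mulmxBl mean_mul ht; congr (_ - _); apply: eq_bigr => y _; rewrite ht.
Qed.

Lemma fluctuation_herm c : (fluctuation c)^H = fluctuation c.
Proof.
rewrite hadjZ (CrealP (ger0_real _)) ?ler0c//; congr (_ *: _).
rewrite /hadj !raddf_sum /=; apply: eq_bigr => l _; exact: deviation_herm.
Qed.

Lemma fluctuation_projr c : fluctuation c *m P0 = fluctuation c.
Proof.
rewrite -scalemxAl mulmx_suml; congr (_ *: _); apply: eq_bigr => l _.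
exact: deviation_projr.
Qed.

Lemma sampling_split c : v%:C%C *: \sum_l W (c l) - mean W =
  v%:C%C *: \sum_l (W (c l) - truncated (c l)) + fluctuation c - mean (fun x => W x - truncated x).
Proof.
have -> : mean (fun x => W x - truncated x) = mean W - mean truncated.
  by rewrite -sumrB; apply: eq_bigr => x _; rewrite scalerBr.
rewrite /fluctuation /deviation !sumrB sumr_const cardE /= -cardE.
rewrite !scalerBr -[_ *+ _]scaler_nat scalerA.
have -> : v%:C%C * #|J|%:R = 1 :> C.
  by rewrite -(rmorph_nat (real_complex R)) -rmorphM mulrC Jv.
rewrite scale1r; mxlin.
Qed.

Lemma covering_tnb c : tnb (v%:C%C *: \sum_l W (c l) - mean W) (covering_err c).
Proof.
rewrite sampling_split; apply: tnbB; [apply: tnbD|].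
- by apply: tnbZ => //; apply: tnb_sum => l _; apply: trunc_tnb.
- have [h1 h2] := hP0; apply: tnb_rank => //; rewrite ?mulr_gt0//.
  + exact: fluctuation_herm.
  + exact: fluctuation_projr.
  by rewrite -[LHS]hadjK hadjM fluctuation_herm h1 fluctuation_projr fluctuation_herm.
by apply: tnb_sum => x _; apply: tnbZ => //; apply: trunc_tnb.
Qed.

Lemma mean_deviation : mean deviation = 0.
Proof.
rewrite /deviation.
have -> : mean (fun x => truncated x - mean truncated) = mean truncated - (\sum_x (p x)%:C%C) *: mean truncated.
  rewrite scaler_suml -sumrB; apply: eq_bigr => x _.
  by rewrite scalerBr.
by rewrite -rmorph_sum p1 scale1r subrr.
Qed.

Lemma deviation_sqr_mean : avg p (fun x => rtr (deviation x *m deviation x)) <= a1.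
Proof.
have h1 : avg p (fun x => rtr (deviation x *m mean truncated)) = 0.
  by rewrite -rtr_mean -mean_mul mean_deviation mul0mx rtr0.
have h2 : avg p (fun x => rtr (mean truncated *m truncated x)) = rtr (mean truncated *m mean truncated).
  by rewrite mul_mean rtr_mean.
have -> : avg p (fun x => rtr (deviation x *m deviation x))
   = avg p (fun x => rtr (truncated x *m truncated x)) - rtr (mean truncated *m mean truncated).
  rewrite -h2 -avgB -[RHS]subr0 -[X in _ = _ - X]h1 -avgB; apply: eq_avg => x.
  by rewrite -!rtrB -mulmxBl -mulmxBr.
apply: le_trans (_ : avg p (fun x => rtr (truncated x *m truncated x)) <= _).
  by rewrite lerBlDr lerDl; apply: rtr_mul_ge0; apply/mean_psd/trunc_psd.
by rewrite -[leRHS](avg_cst _ p1); apply: avg_le => // x; apply: trunc_sqr_le.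
Qed.

Lemma fluctuation_sqrE c : rtr (fluctuation c *m fluctuation c) =
  v * v * \sum_l \sum_k rtr (deviation (c l) *m deviation (c k)).
Proof.
rewrite /fluctuation -scalemxAl -scalemxAr scalerA -rmorphM rtrZ; congr (_ * _).
rewrite mulmx_suml rtr_sum; apply: eq_bigr => l _.
by rewrite mulmx_sumr rtr_sum.
Qed.

(** Variance of a sample mean: deviations at distinct indices are independent and centred, so only
    the diagonal terms survive. *)
Lemma fluctuation_sqr_mean :
  avg (wt p) (fun c : {ffun J -> X} => rtr (fluctuation c *m fluctuation c)) <= v * a1.
Proof.
have dev2 (l : J) : avg (wt p) (fun c => \sum_k rtr (deviation (c l) *m deviation (c k)))
   = avg p (fun x => rtr (deviation x *m deviation x)).
  rewrite avg_sum (bigD1 l)//= big1 ?addr0 => [|k lk].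
    exact: (sum_wt1 p1 (fun x => rtr (deviation x *m deviation x))).
  rewrite (sum_wt2 p1 (fun x y => rtr (deviation x *m deviation y))); last by rewrite eq_sym.
  transitivity (rtr (mean deviation *m mean deviation)).
    rewrite mean_mul rtr_mean; apply: eq_avg => x; rewrite mul_mean rtr_mean.
    by [].
  by rewrite mean_deviation mul0mx rtr0.
rewrite (eq_avg _ fluctuation_sqrE) avgZ avg_sum (eq_bigr _ (fun l _ => dev2 l)).
rewrite sumr_const cardE /= -cardE -[_ *+ _]mulr_natl.
have -> x : v * v * (#|J|%:R * x) = v * ((#|J|%:R * v) * x) by ring.
by rewrite Jv mul1r; apply: ler_wpM2l => //; exact: deviation_sqr_mean.
Qed.

Lemma codeword_avg (g : X -> R) :
  avg (wt p) (fun c : {ffun J -> X} => v * \sum_l g (c l)) = avg p g.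
Proof.
rewrite avgZ avg_sum (eq_bigr _ (fun l _ => sum_wt1 p1 g l)) sumr_const cardE /= -cardE.
by rewrite -[_ *+ _]mulr_natl mulrA [v * _]mulrC Jv mul1r.
Qed.

(** For [u] large but fixed, the last summand is small once the number of codewords is far above
    [a1 * a2]. *)
Lemma covering_err_mean : avg (wt p) covering_err
  <= 2 * ((1 + t) * (2 * eps) + 2 / t) + (u * (a1 * a2 * v) + u^-1) / 2.
Proof.
have s1 := sum_wt J p1.
have -> : avg (wt p) covering_err = avg p trunc_err + (u * a2 * avg (wt p)
   (fun c : {ffun J -> X} => rtr (fluctuation c *m fluctuation c)) + rtr P0 / (u * a2)) / 2
   + avg p trunc_err.
  rewrite /covering_err avgD avgD codeword_avg [X in _ + X]avg_cst//; congr (_ + _ + _).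
  transitivity (avg (wt p) (fun c : {ffun J -> X} =>
      2^-1 * (u * a2 * rtr (fluctuation c *m fluctuation c) + rtr P0 / (u * a2)))).
    by apply: eq_avg => c; rewrite mulrC.
  by rewrite avgZ avgD avgZ avg_cst// mulrC.
have hgb := trunc_err_mean; have hf := fluctuation_sqr_mean.
set f := avg (wt p) _ in hf *.
have h1 : u * a2 * f <= u * (a1 * a2 * v).
  have -> : u * (a1 * a2 * v) = u * a2 * (v * a1) by ring.
  by apply: ler_wpM2l => //; rewrite mulr_ge0// ltW.
have h2 : rtr P0 / (u * a2) <= u^-1.
  rewrite ler_pdivrMr ?mulr_gt0// mulrA mulVf ?gt_eqF// mul1r; exact: h_a2.
by move: (avg p trunc_err) (rtr P0 / _) hgb h1 h2 => x y; lra.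
Qed.

End Covering.
End Ensemble.
End RandomCoding.

(** * Packing: tests on [B] and average decoding failure *)

Section Packing.
Variable R : realType.
Local Notation C := R[i].

Section Test.
Variables (X B : finType) (p : X -> R) (V : X -> op R B).
Variables (Q : X -> op R B) (Q0 : op R B) (eps b1 b2 t : R).
Hypotheses (p0 : forall x, 0 <= p x) (p1 : \sum_x p x = 1).
Hypotheses (hV : forall x, psdmx (V x)) (trV : forall x, rtr (V x) = 1).
Hypotheses (hQ : forall x, isproj (Q x)) (hQ0 : isproj Q0) (t0 : 0 < t) (b20 : 0 <= b2).
Hypothesis h_eps : avg p (fun x => rtr ((1%:M - Q x) *m V x)) <= eps.
Hypothesis h_eps0 : rtr ((1%:M - Q0) *m mean p V) <= eps.
Hypothesis h_b1 : forall x, rtr (Q x) <= b1.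
Hypothesis h_b2 : psdmx (b2%:C%C%:M - Q0 *m mean p V *m Q0).

(** [Q x] recognizes the codeword and has small rank; the outer cut by [Q0] brings in the eigenvalue
    bound [b2] on the average state. *)
Definition test x : op R B := Q0 *m Q x *m Q0.

Lemma test_psd x : psdmx (test x).
Proof. by have [h _] := hQ0; apply: psdmx_conj => //; apply: isproj_psd. Qed.

Lemma test_le1 x : psdmx (1%:M - test x).
Proof.
have [h1 h2] := hQ0.
have := psdmxD (isproj_le1 hQ0) (psdmx_conj h1 (isproj_le1 (hQ x))); congr psdmx.
by rewrite mulmxBr mulmxBl mulmx1 h2 addrA subrK.
Qed.

Lemma rtr_test_mul x M : rtr (test x *m M) = rtr (Q x *m (Q0 *m M *m Q0)).
Proof. by rewrite /test -mulmxA -mulmxA rtrC !mulmxA. Qed.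

(** The outer cut is moved from the test to the state, where it is a gentle measurement. *)
Lemma test_miss x : 1 - rtr (test x *m V x) <=
  rtr ((1%:M - Q x) *m V x) + ((1 + t) * rtr ((1%:M - Q0) *m V x) + 1 / t).
Proof.
have h := tnb_mul_le (tnb_proj t0 (hV x) hQ0) (isproj_psd (hQ x)) (isproj_le1 (hQ x)).
have e1 : rtr (Q x *m (V x - Q0 *m V x *m Q0)) = rtr (Q x *m V x) - rtr (test x *m V x).
  by rewrite mulmxBr rtrB rtr_test_mul.
have e2 : rtr ((1%:M - Q x) *m V x) = 1 - rtr (Q x *m V x).
  by rewrite mulmxBl mul1mx rtrB trV.
move: h; rewrite e1 e2 trV lerBlDr => h.
by rewrite -addrA lerD2l [- _ + _]addrC lerBrDr [- _ + _]addrC lerBlDr.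
Qed.

Lemma test_miss_mean : avg p (fun x => 1 - rtr (test x *m V x)) <=
  eps + ((1 + t) * eps + 1 / t).
Proof.
apply: le_trans (avg_le p0 test_miss) _; rewrite avgD avgD avgZ avg_cst//.
have h : avg p (fun x => rtr ((1%:M - Q0) *m V x)) <= eps.
  by rewrite -rtr_mean -mul_mean.
apply: lerD => //; rewrite lerD2r; apply: ler_wpM2l => //.
by rewrite addr_ge0// ltW.
Qed.

(** Rank times eigenvalue bound; for typical projectors [b1 * b2] is about [exp (- n I(X;B))]. *)
Lemma test_false x : avg p (fun y => rtr (test x *m V y)) <= b1 * b2.
Proof.
rewrite -rtr_mean -mul_mean rtr_test_mul.
apply: le_trans (rtr_mul_ler (isproj_psd (hQ x)) h_b2) _.
by rewrite mul_mx_scalar rtrZ mulrC; apply: ler_wpM2r.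
Qed.

End Test.

Section Failure.
Variables (X S B : finType) (p : X -> R) (W : X -> op R (S * B)%type) (Theta : X -> op R B).
Variables (miss false_rate d : R) (M K : nat).
Hypotheses (p0 : forall x, 0 <= p x) (p1 : \sum_x p x = 1) (M0 : (0 < M)%N) (K0 : (0 < K)%N).
Hypothesis h_miss : avg p (fun x => 1 - rtr (Theta x *m ptrace1 (W x))) <= miss.
Hypothesis h_false : forall x, avg p (fun y => rtr (Theta x *m ptrace1 (W y))) <= false_rate.

Definition codebook (c : {ffun 'I_M * 'I_K -> X}) m k : X := c (m, k).

(** Codewords of other bins do not compete, since the decoder is told the bin; hence [K.-1] and not
    [M * K - 1]. *)
Lemma decoding_failure_mean :
  avg (wt p) (fun c => decoding_failure W Theta (codebook c) d)
  <= 2 * miss + 4 * (K.-1%:R * false_rate + d).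
Proof.
have s1 := sum_wt ('I_M * 'I_K)%type p1.
rewrite /decoding_failure avgZ avg_sum.
set b := 2 * miss + _.
have -> : b = ((M * K)%:R)^-1 * \sum_(m < M) \sum_(k < K) b.
  rewrite !sumr_const !card_ord -mulrnA mulnC -[b *+ _]mulr_natl mulrA mulVf ?mul1r//.
  by rewrite pnatr_eq0 -lt0n muln_gt0 K0 M0.
apply: ler_wpM2l; first by rewrite invr_ge0 ler0n.
apply: ler_sum => m _; rewrite avg_sum; apply: ler_sum => k _.
rewrite avgD !avgZ; apply: lerD; apply: ler_wpM2l => //.
  rewrite (_ : avg _ _ = avg p (fun x => 1 - rtr (Theta x *m ptrace1 (W x))))//.
  exact: (sum_wt1 p1 (fun x => 1 - rtr (Theta x *m ptrace1 (W x)))).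
rewrite avgD avg_sum [avg _ (fun=> d)]avg_cst// lerD2r.
have -> : K.-1%:R * false_rate = \sum_(j < K | j != k) false_rate.
  by rewrite sumr_const mulr_natl cardC1 card_ord.
apply: ler_sum => j jk.
have mjk : (m, j) != (m, k) by rewrite xpair_eqE eqxx.
rewrite (sum_wt2 p1 (fun x y => rtr (Theta x *m ptrace1 (W y))) mjk).
by rewrite -[leRHS](avg_cst _ p1); apply: avg_le.
Qed.

End Failure.
End Packing.

(** * Existence of a good codebook, and a converse *)

Section RandomProtocol.
Variable R : realType.
Local Notation C := R[i].

(** One notion covers the four families of projectors: those of the average states are families
    indexed by [unit]. *)
Definition typical {X T : finType} (p : X -> R) (W : X -> op R T) (eps lo hi : R)
    (Pi : X -> op R T) : Prop :=
  [/\ forall x, isproj (Pi x), avg p (fun x => rtr ((1%:M - Pi x) *m W x)) <= eps,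
      forall x, psdmx (lo%:C%C%:M - Pi x *m W x *m Pi x) & forall x, rtr (Pi x) <= hi].

Lemma mean_ptrace1 (X S B : finType) (p : X -> R) (W : X -> op R (S * B)%type) :
  ptrace1 (mean p W) = mean p (fun x => ptrace1 (W x)).
Proof.
rewrite ptrace1E /mean; under [RHS]eq_bigr => x _ do rewrite ptrace1E scaler_sumr.
rewrite [RHS]exchange_big; apply: eq_bigr => s _ /=.
rewrite mulmx_sumr mulmx_suml; apply: eq_bigr => x _.
by rewrite -scalemxAr -scalemxAl.
Qed.

Section Ensemble.
Variables (X S B : finType) (p : X -> R) (W : X -> op R (S * B)%type).
Variables (Pi : X -> op R (S * B)%type) (P0 : unit -> op R (S * B)%type).
Variables (Q : X -> op R B) (Q0 : unit -> op R B).
Variables (eps a1 a1' a2 a2' b1 b1' b2 b2' t : R).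
Hypotheses (p0 : forall x, 0 <= p x) (p1 : \sum_x p x = 1).
Hypotheses (hW : forall x, psdmx (W x)) (trW : forall x, rtr (W x) = 1).
Hypothesis hPi : typical p W eps a1 a1' Pi.
Hypothesis hP0 : typical (fun=> 1) (fun=> mean p W) eps a2' a2 P0.
Hypothesis hQ : typical p (fun x => ptrace1 (W x)) eps b1' b1 Q.
Hypothesis hQ0 : typical (fun=> 1) (fun=> ptrace1 (mean p W)) eps b2 b2' Q0.
Hypotheses (a20 : 0 < a2) (b20 : 0 <= b2) (t0 : 0 < t).

Let Theta := test Q (Q0 tt).

Let unit_avg (F : unit -> R) : avg (fun=> 1) F = F tt.
Proof. by rewrite /avg (big_pred1 tt) ?mul1r// => -[]. Qed.

Let miss := eps + ((1 + t) * eps + 1 / t).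
Let gam := (1 + t) * (2 * eps) + 2 / t.

Let hWB x : psdmx (ptrace1 (W x)). Proof. exact: ptrace1_psd. Qed.
Let trWB x : rtr (ptrace1 (W x)) = 1. Proof. by rewrite rtr_ptrace1. Qed.

Let decoding_mean M K d : (0 < M)%N -> (0 < K)%N ->
  avg (wt p) (fun c => decoding_failure W Theta (@codebook X M K c) d)
  <= 2 * miss + 4 * (K.-1%:R * (b1 * b2) + d).
Proof.
move=> M0 K0; have [h1 h2 h3 h4] := hQ; have [k1 k2 k3 k4] := hQ0.
apply: decoding_failure_mean => //.
  by apply: test_miss_mean => //; rewrite -mean_ptrace1; move: k2; rewrite unit_avg.
by move=> x; apply: test_false => //; rewrite -mean_ptrace1; apply: k3.
Qed.

Lemma random_protocol (A : finType) (Phi : rop R (S * B)%type A)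
    (Pur : op R (A * (S * B))%type) (M K : nat) (d u s : R) :
  (forall a q a' q', rent Pur (a, q) (a', q') = rent Phi q a * (rent Phi q' a')^*) ->
  Phi *m Phi^H = mean p W -> (0 < M)%N -> (0 < K)%N -> 0 < d -> 0 < u -> 0 < s ->
  exists (Om : 'I_M.+1 -> op R A) (Lam : 'I_M.+1 -> 'I_K.+1 -> op R B)
         (f : 'I_M.+1 -> 'I_K.+1 -> X),
  [/\ povm Om, forall m, povm (Lam m) &
   let sL m k := tens (idop R S) (msqrt (Lam m k)) in
   let tau m k := sL m k *m ptrace1 (tens (Om m) (idop R (S * B)%type) *m Pur) *m sL m k in
   trnorm (\sum_m \sum_k tens (Defs.proj R (f m k)) (tau m k)
           - \sum_m \sum_k \tr (tau m k) *: tens (Defs.proj R (f m k)) (W (f m k)))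
     <= 4 * ((1 + s) * (2 * gam + (u * (a1 * a2 / (M * K)%:R) + u^-1) / 2 + d) + 2 / s
             + (2 + s) * (2 * miss + 4 * (K.-1%:R * (b1 * b2) + d)))].
Proof.
move=> hPur hPhi M0 K0 d0 u0 s0.
have [h1 h2 h3 h4] := hPi; have [k1 k2 k3 k4] := hP0.
have card_MK : #|{: 'I_M * 'I_K}| = (M * K)%N by rewrite card_prod !card_ord.
have J0 : (0 < #|{: 'I_M * 'I_K}|)%N by rewrite card_MK muln_gt0 M0.
have k2' : rtr ((1%:M - P0 tt) *m mean p W) <= eps by move: k2; rewrite unit_avg.
have cov_mean := covering_err_mean p0 p1 hW trW h1 (k1 tt) t0 h2 k2' h3 (k4 tt) J0 u0 a20.
rewrite card_MK in cov_mean.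
pose cov (c : {ffun 'I_M * 'I_K -> X}) := covering_err p W Pi (P0 tt) a2 t u c.
(* Both errors enter one functional, so a codebook below its mean is good for covering and for
   packing at once. *)
pose total c : R := 4 * ((1 + s) * (cov c + d) + 2 / s
   + (2 + s) * decoding_failure W Theta (@codebook X M K c) d).
have w1 := sum_wt ('I_M * 'I_K)%type p1.
have t1 : 0 <= 1 + s by rewrite addr_ge0// ltW.
have t2 : 0 <= 2 + s by rewrite addr_ge0// ltW.
have : avg (wt p) total <= 4 * ((1 + s) * (2 * gam + (u * (a1 * a2 / (M * K)%:R) + u^-1) / 2 + d)
   + 2 / s + (2 + s) * (2 * miss + 4 * (K.-1%:R * (b1 * b2) + d))).
  rewrite /total avgZ avgD avgZ avgD avgZ avgD !avg_cst//.
  apply: ler_wpM2l => //; apply: lerD; last by apply: ler_wpM2l => //; apply: decoding_mean.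
  by rewrite lerD2r; apply: ler_wpM2l => //; rewrite lerD2r.
move=> /(expectation_le_exists p0 p1)[c hc].
(* The positive part [D] of the sampling deviation serves as [Delta]: the reduced state plus [D]
   minus the codebook average is [D'], which is positive. *)
have [D [D' [hD hD' eD lD]]] := covering_tnb p0 hW trW h1 (k1 tt) t0 J0 u0 a20 c.
have [m1 _ _ _] := hQ; have [n1 _ _ _] := hQ0.
have hcov : psdmx (Phi *m Phi^H + D -
    \sum_m \sum_k ((M * K)%:R^-1)%:C%C *: W (codebook c m k)).
  have -> : \sum_m \sum_k ((M * K)%:R^-1)%:C%C *: W (codebook c m k)
      = (#|{: 'I_M * 'I_K}|%:R^-1)%:C%C *: \sum_l W (c l).
    by rewrite card_MK scaler_sumr pair_big; apply: eq_bigr => -[].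
  rewrite hPhi; suff -> : forall Y, Y - mean p W = D - D' -> mean p W + D - Y = D'.
  - exact: hD'.
  - exact: eD.
  by move=> Y /eqP; rewrite subr_eq => /eqP ->; mxlin.
have trPhi : rtr (Phi *m Phi^H) = 1.
  by rewrite hPhi rtr_mean (eq_avg _ trW) avg_cst.
have [Om [Lam [f [hOm hLam err]]]] := codebook_protocol hPur M0 K0 d0 s0 hW trW
  (test_psd m1 (n1 tt)) (test_le1 m1 (n1 tt)) trPhi hD hcov.
exists Om, Lam, f; split=> //; apply: le_trans err _; apply: le_trans hc; rewrite /total.
apply: ler_wpM2l => //; rewrite lerD2r lerD2r; apply: ler_wpM2l => //; rewrite lerD2r.
by have := rtr_ge0 hD'; move: lD; rewrite /cov; lra.
Qed.

(* A code decodable from [B] alone has at most about [a1 * a2] codewords;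
   data processing for the Holevo quantity follows from this. *)
Lemma packing_converse (K : nat) (d : R) : (0 < K)%N -> 0 < d ->
  1 <= 2 * miss + 4 * (K.-1%:R * (b1 * b2) + d) + (gam + a1 * a2 / K%:R).
Proof.
move=> K0 d0; have [h1 h2 h3 h4] := hPi; have [k1 k2 k3 k4] := hP0.
have k2' : rtr ((1%:M - P0 tt) *m mean p W) <= eps by move: k2; rewrite unit_avg.
have card_K : #|{: 'I_1 * 'I_K}| = K by rewrite card_prod !card_ord mul1n.
have J0 : (0 < #|{: 'I_1 * 'I_K}|)%N by rewrite card_K.
pose err := trunc_err W Pi (P0 tt) t.
(* A plain code is a binned one with a single bin, so [decoding_mean] applies with [M = 1]. *)
pose total c : R := decoding_failure W Theta (@codebook X 1 K c) d
   + (#|{: 'I_1 * 'I_K}|%:R)^-1 * \sum_l err (c l).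
have : avg (wt p) total <= 2 * miss + 4 * (K.-1%:R * (b1 * b2) + d) + gam.
  rewrite /total avgD; apply: lerD; first exact: decoding_mean.
  rewrite (codeword_avg p1 J0 err); exact: trunc_err_mean.
move=> /(expectation_le_exists p0 p1)[c hc]; rewrite addrA.
apply: le_trans (lerD hc (lexx _)); rewrite /total {hc}.
have [m1 _ _ _] := hQ; have [n1 _ _ _] := hQ0.
pose w k := W (c (ord0, k)).
have [L [hL hL1 hL2]] := decoder d0 (fun k => test_psd m1 (n1 tt) (c (ord0, k)))
  (fun k => test_le1 m1 (n1 tt) (c (ord0, k))).
have hL2' k : 1 - rtr (L k *m ptrace1 (w k)) <=
   2 * (1 - rtr (Theta (c (ord0, k)) *m ptrace1 (w k)))
   + 4 * (\sum_(j | j != k) rtr (Theta (c (ord0, j)) *m ptrace1 (w k)) + d).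
  have := rtr_mul_lel (hWB (c (ord0, k))) (hL2 k).
  rewrite mulmxBl mul1mx rtrB trWB => h; apply: le_trans h _.
  have -> : 2 = (2%:R)%:C%C :> C by rewrite rmorph_nat.
  have -> : 4 = (4%:R)%:C%C :> C by rewrite rmorph_nat.
  rewrite mulmxDl -!scalemxAl rtrD !rtrZ mulmxBl mulmxDl mul1mx rtrB rtrD trWB.
  rewrite mul_scalar_mx rtrZ trWB mulr1 mulmx_suml rtr_sum; exact: lexx.
have LL k : psdmx (1%:M - L k).
  apply: psdmx_trans hL1; rewrite (bigD1 k)//= addrAC subrr add0r.
  exact: psdmx_sum.
(* Up to the truncation error each state is dominated by the same operator [a1 P0], and the [L k]
   share its trace: the success probabilities sum to at most [a1 * a2] plus errors. *)
have hit k : rtr (L k *m ptrace1 (w k)) <=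
   a1 * rtr (L k *m ptrace1 (P0 tt)) + err (c (ord0, k)).
  have e1 := tnb_mul_le (trunc_tnb hW trW h1 (k1 tt) t0 (c (ord0, k)))
    (tens_id_psd S (hL k)) _.
  have e2 := rtr_mul_ler (tens_id_psd S (hL k))
    (trunc_le (k1 tt) h3 (c (ord0, k))).
  move: e2; rewrite -scalemxAr rtrZ !rtr_tens_id_mul => e2.
  have := e1; rewrite -tens_id1 -tens_idB => /(_ (tens_id_psd S (LL k))).
  rewrite mulmxBr rtrB !rtr_tens_id_mul -/(w k) -/err lerBlDr addrC => h.
  by apply: le_trans h _; rewrite lerD2r.
have sum_hit : \sum_k rtr (L k *m ptrace1 (w k)) <=
   a1 * a2 + \sum_k err (c (ord0, k)).
  apply: le_trans (ler_sum _ (fun k _ => hit k)) _; rewrite big_split /= lerD2r -mulr_sumr.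
  have [x _] : exists x : X, True by exists (c (ord0, Ordinal K0)).
  apply: ler_wpM2l; first exact: a1_ge0 (rtr1_dim_gt0 (trW x)).
  rewrite -rtr_sum -mulmx_suml; apply: le_trans (k4 tt).
  have := rtr_mul_lel (ptrace1_psd (isproj_psd (k1 tt))) hL1.
  by rewrite mul1mx rtr_ptrace1.
have KR : 0 < K%:R :> R by rewrite ltr0n.
rewrite card_K /decoding_failure mul1n big_ord1.
have -> : \sum_l err (c l) = \sum_k err (c (ord0, k)).
  transitivity (\sum_(i < 1) \sum_(k < K) err (c (i, k))); last by rewrite big_ord1.
  by rewrite pair_big; apply: eq_bigr => -[].
have hK : K%:R <= \sum_k (2 * (1 - rtr (Theta (c (ord0, k)) *m ptrace1 (w k)))
   + 4 * (\sum_(j | j != k) rtr (Theta (c (ord0, j)) *m ptrace1 (w k)) + d))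
   + \sum_k err (c (ord0, k)) + a1 * a2.
  rewrite -addrA [X in _ + X]addrC; apply: le_trans (lerD (lexx _) sum_hit).
  rewrite -lerBlDr; have -> : K%:R = \sum_(k < K) (1 : R) by rewrite sumr_const card_ord.
  by rewrite -sumrB; apply: ler_sum => k _.
rewrite [a1 * a2 / _]mulrC -!mulrDr -[leLHS](mulVf (lt0r_neq0 KR)).
by apply: ler_wpM2l => //; rewrite invr_ge0 ltW.
Qed.

End Ensemble.
End RandomProtocol.

(** * Typical projectors *)

Section Chebyshev.
Variables (R : realType) (Z : finType) (q : Z -> R) (n : nat).
Hypotheses (q0 : forall z, 0 <= q z) (q1 : \sum_z q z = 1).

Lemma sum_sqr_mean (k : Z -> R) : avg q k = 0 ->
  avg (wt q) (fun z : {ffun 'I_n -> Z} => (\sum_i k (z i)) ^+ 2) = n%:R * avg q (fun z => k z ^+ 2).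
Proof.
move=> k0.
transitivity (avg (wt q) (fun z : {ffun 'I_n -> Z} => \sum_i \sum_j k (z i) * k (z j))).
  apply: eq_avg => z; rewrite expr2 mulr_suml.
  by apply: eq_bigr => i _; rewrite mulr_sumr.
rewrite avg_sum; have -> : n%:R * avg q (fun z => k z ^+ 2) = \sum_(i < n) avg q (fun z => k z ^+ 2).
  by rewrite sumr_const card_ord mulr_natl.
apply: eq_bigr => i _; rewrite avg_sum (bigD1 i)//= big1 ?addr0 => [|j ij].
  exact: (sum_wt1 q1 (fun z => k z * k z) i).
by rewrite (sum_wt2_prod q1 k k) ?k0 ?mul0r// eq_sym.
Qed.

(** The deviation is required only at sequences of positive weight, because [k] will involve
    logarithms of eigenvalues that may vanish. *)
Lemma chebyshev (k : Z -> R) (a : R) (bad : pred {ffun 'I_n -> Z}) :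
  avg q k = 0 -> 0 < a -> (0 < n)%N ->
  (forall z, bad z -> wt q z != 0 -> n%:R * a <= `|\sum_i k (z i)|) ->
  avg (wt q) (fun z => (bad z)%:R) <= avg q (fun z => k z ^+ 2) / (n%:R * a ^+ 2).
Proof.
move=> k0 a0 n0 hb; have nR : 0 < n%:R :> R by rewrite ltr0n.
have -> : avg q (fun z => k z ^+ 2) / (n%:R * a ^+ 2)
    = ((n%:R * a) ^+ 2)^-1 * (n%:R * avg q (fun z => k z ^+ 2)).
  by field; rewrite !gt_eqF.
rewrite -sum_sqr_mean// -avgZ; apply: ler_sum => z _.
have [->|wz] := eqVneq (wt q z) 0; first by rewrite !mul0r.
apply: ler_wpM2l; first exact: wt_ge0.
rewrite mulrC ler_pdivlMr ?exprn_gt0 ?mulr_gt0//.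
case: (boolP (bad z)) => [hz|_]; last by rewrite mul0r sqr_ge0.
rewrite mul1r -[leRHS]real_normK ?num_real// ler_pXn2r ?nnegrE ?normr_ge0//.
  exact: hb.
by rewrite ltW// mulr_gt0.
Qed.

End Chebyshev.

Section DiagonalOps.
Variables (R : realType) (Y : finType).
Local Notation C := R[i].
Implicit Types f g : Y -> R.

Definition dop f : op R Y := mkop (fun y z => (y == z)%:R * (f y)%:C%C).

Lemma dopM f g : dop f *m dop g = dop (fun y => f y * g y).
Proof.
apply: ropP => y z; rewrite rent_mul rent_mkop.
under eq_bigr => x _ do rewrite !rent_mkop -mulrA.
by rewrite (sum_delta y (fun x => (f y)%:C%C * ((x == z)%:R * (g x)%:C%C))) rmorphM mulrCA.
Qed.

Lemma dopB f g : dop f - dop g = dop (fun y => f y - g y).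
Proof. by apply: ropP => y z; rewrite rentB !rent_mkop rmorphB mulrBr. Qed.

Lemma dop_cst (a : R) : dop (fun=> a) = a%:C%C%:M.
Proof.
by apply: ropP => y z; rewrite rent_mkop -scalemx1 rentZ rent1 mulrC.
Qed.

Lemma eq_dop f g : f =1 g -> dop f = dop g.
Proof. by move=> h; apply: ropP => y z; rewrite !rent_mkop h. Qed.

Lemma rtr_dop f : rtr (dop f) = \sum_y f y.
Proof.
by rewrite /rtr trE Re_sum; apply: eq_bigr => y _; rewrite rent_mkop eqxx mul1r.
Qed.

Lemma dop_psd f : (forall y, 0 <= f y) -> psdmx (dop f).
Proof.
move=> h.
have -> : dop f = diag_mx (\row_i (f (enum_val i))%:C%C).
  apply: ropP => y z; rewrite rent_mkop /rent !mxE enum_rankK (inj_eq enum_rank_inj).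
  by rewrite mulr_natl.
by apply: psdmx_diag_mx => i; rewrite mxE ler0c.
Qed.

Lemma dop_herm f : (dop f)^H = dop f.
Proof.
apply: ropP => y z; rewrite rent_hadj !rent_mkop rmorphM rmorph_nat eq_sym.
have [->|_] := eqVneq y z; last by rewrite !mul0r.
by congr (_ * _); apply/CrealP/complex_realP; exists (f z).
Qed.

End DiagonalOps.

Section TensorPower.
Variables (R : realType) (T Y : finType) (n : nat) (g : Y -> {ffun 'I_n -> T}).
Local Notation C := R[i].
Hypothesis g_bij : bijective g.
Implicit Types u v : 'I_n -> op R T.

(** [g] absorbs the layout of the indices: [R^n B^n] is indexed by pairs of tuples and not by tuples
    of pairs, while for [B^n] it is the identity. *)
Definition tpow u : op R Y := mkop (fun y z => \prod_i rent (u i) (g y i) (g z i)).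

Lemma sum_prod_tpow (F : 'I_n -> T -> C) : \sum_y \prod_i F i (g y i) = \prod_i \sum_t F i t.
Proof.
rewrite bigA_distr_bigA (reindex g)//; exact: onW_bij.
Qed.

Lemma tpowM u v : tpow u *m tpow v = tpow (fun i => u i *m v i).
Proof.
apply: ropP => y z; rewrite rent_mul rent_mkop.
under [RHS]eq_bigr => i _ do rewrite rent_mul.
rewrite -(sum_prod_tpow (fun i t => rent (u i) (g y i) t * rent (v i) t (g z i))).
by apply: eq_bigr => x _; rewrite !rent_mkop -big_split.
Qed.

Lemma tpow_hadj u : (tpow u)^H = tpow (fun i => (u i)^H).
Proof.
apply: ropP => y z; rewrite rent_hadj !rent_mkop rmorph_prod.
by apply: eq_bigr => i _; rewrite rent_hadj.
Qed.

Lemma tpow1 : tpow (fun=> 1%:M) = 1%:M.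
Proof.
apply: ropP => y z; rewrite rent_mkop rent1.
have [->|yz] := eqVneq y z; first by rewrite big1// => i _; rewrite rent1 eqxx.
have [i hi] : exists i, g y i != g z i.
  apply/existsP; apply: contraT; rewrite negb_exists => /forallP h.
  case/eqP: yz; apply: (bij_inj g_bij); apply/ffunP => i.
  by apply/eqP; have := h i; rewrite negbK.
by rewrite (bigD1 i)//= rent1 (negPf hi) mul0r.
Qed.

Lemma tpow_dop (f : 'I_n -> T -> R) :
  tpow (fun i => dop (f i)) = dop (fun y => \prod_i f i (g y i)).
Proof.
apply: ropP => y z; rewrite !rent_mkop.
under eq_bigr => i _ do rewrite rent_mkop.
rewrite big_split /= rmorph_prod; congr (_ * _); have /matrixP := tpow1.
by move/(_ (enum_rank y) (enum_rank z)); rewrite -![_ (enum_rank y) (enum_rank z)]/(rent _ y z)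
  rent1 rent_mkop => <-; apply: eq_bigr => i _; rewrite rent1.
Qed.

Lemma tpow_mean (X : finType) (p : X -> R) (W : X -> op R T) :
  mean (wt p) (fun x : {ffun 'I_n -> X} => tpow (fun i => W (x i))) = tpow (fun=> mean p W).
Proof.
apply: ropP => y z; rewrite rent_sum rent_mkop.
under [RHS]eq_bigr => i _ do rewrite rent_sum.
rewrite bigA_distr_bigA; apply: eq_bigr => x _.
rewrite rentZ rent_mkop rmorph_prod -big_split; apply: eq_bigr => i _.
by rewrite rentZ.
Qed.

Lemma eq_tpow u v : u =1 v -> tpow u = tpow v.
Proof. by move=> h; apply: ropP => y z; rewrite !rent_mkop; apply: eq_bigr => i _; rewrite h. Qed.

End TensorPower.

Section Spectrum.
Variables (R : realType) (T : finType).
Local Notation C := R[i].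

Definition eigv (M : op R T) (t : T) : R := complex.Re (spectral_diag M ord0 (enum_rank t)).

Lemma spectral_dop (M : op R T) : psdmx M ->
  M = (spectralmx M)^H *m dop (eigv M) *m spectralmx M.
Proof.
move=> h; have -> : dop (eigv M) = diag_mx (\row_i id (spectral_diag M ord0 i)).
  apply: ropP => y z; rewrite rent_mkop /rent !mxE (inj_eq enum_rank_inj) mulr_natl.
  by congr (_ *+ _); apply/esym/ger0_ReE/psdmx_eig_ge0.
by rewrite -spectralmx_inv; apply/esym/sfun_id/psdmx_herm.
Qed.

Lemma eigv_ge0 (M : op R T) t : psdmx M -> 0 <= eigv M t.
Proof. by move=> h; have /Re_le := psdmx_eig_ge0 (enum_rank t) h. Qed.

Lemma sum_eigv (M : op R T) : psdmx M -> \sum_t eigv M t = rtr M.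
Proof.
move=> h; rewrite -rtr_dop {2}(spectral_dop h) rtrC mulmxA spectralmx_mulV mul1mx.
by [].
Qed.

Lemma vNE (M : op R T) : vN M = \sum_t eta (eigv M t).
Proof. by rewrite /vN (reindex enum_rank)//; exact/onW_bij/enum_rank_bij. Qed.

End Spectrum.

Section Typical.
Variables (R : realType) (T X : finType) (p : X -> R) (W : X -> op R T).
Local Notation C := R[i].
Hypotheses (p0 : forall x, 0 <= p x) (p1 : \sum_x p x = 1).
Hypotheses (hW : forall x, psdmx (W x)) (trW : forall x, rtr (W x) = 1).

Definition cond_entropy : R := avg p (fun x => vN (W x)).

Let H := cond_entropy.
(** Joint law of a letter [x] and an eigenvector of [W x]. It turns typicality into a law of large
    numbers for the i.i.d. variables [k], which are centred since their logarithmic part has mean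
    [H]. *)
Let q (z : X * T) : R := p z.1 * eigv (W z.1) z.2.
Let k (z : X * T) : R := - ln (eigv (W z.1) z.2) - H.

Let q0 z : 0 <= q z. Proof. by rewrite mulr_ge0// eigv_ge0. Qed.

Let q1 : \sum_z q z = 1.
Proof.
rewrite -(pair_bigA _ (fun x t => p x * eigv (W x) t)) -[RHS]p1 /=; apply: eq_bigr => x _.
by rewrite -mulr_sumr sum_eigv// trW mulr1.
Qed.

Let k0 : avg q k = 0.
Proof.
rewrite avgB avg_cst//; apply/eqP; rewrite subr_eq0; apply/eqP.
rewrite /avg -(pair_bigA _ (fun x t => p x * eigv (W x) t * - ln (eigv (W x) t))) /=.
rewrite /H /cond_entropy /avg; apply: eq_bigr => x _; rewrite vNE mulr_sumr.
apply: eq_bigr => t _; rewrite -mulrA /eta; congr (_ * _); rewrite mulrN.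
have [h|//] := leP (eigv (W x) t) 0.
have -> : eigv (W x) t = 0 by apply/eqP; rewrite eq_le h eigv_ge0.
by rewrite mul0r oppr0.
Qed.

Section Power.
Variables (n : nat) (Y : finType) (g : Y -> {ffun 'I_n -> T}) (d : R).
Hypotheses (g_bij : bijective g) (d0 : 0 < d) (n0 : (0 < n)%N).
Implicit Types x : {ffun 'I_n -> X}.

Let lo : R := expR (- (n%:R * (H - d))).
Let hi : R := expR (n%:R * (H + d)).

Let lam x y : R := \prod_i eigv (W (x i)) (g y i).
Let U x : op R Y := tpow g (fun i => spectralmx (W (x i))).
Let good x y := (hi^-1 <= lam x y) && (lam x y <= lo).

(** Spectral projector of the product state onto the eigenvalues between [1 / hi] and [lo]: the
    upper limit bounds the norm, the lower one the rank. *)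
Definition typical_proj x : op R Y := (U x)^H *m dop (fun y => (good x y)%:R) *m U x.

Let UV x : U x *m (U x)^H = 1%:M.
Proof.
rewrite tpow_hadj tpowM// -(tpow1 R g_bij); apply: eq_tpow => i.
exact: spectralmx_mulV.
Qed.

Let VU x : (U x)^H *m U x = 1%:M.
Proof.
rewrite tpow_hadj tpowM// -(tpow1 R g_bij); apply: eq_tpow => i.
exact: spectralmx_Vmul.
Qed.

Let WE x : tpow g (fun i => W (x i)) = (U x)^H *m dop (lam x) *m U x.
Proof.
rewrite -(tpow_dop g_bij (fun i => eigv (W (x i)))) tpow_hadj !tpowM//; apply: eq_tpow => i.
exact: spectral_dop.
Qed.

Let conjM x (M N : op R Y) :
  (U x)^H *m M *m U x *m ((U x)^H *m N *m U x) = (U x)^H *m (M *m N) *m U x.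
Proof.
have -> : (U x)^H *m M *m U x *m ((U x)^H *m N *m U x)
  = (U x)^H *m M *m (U x *m (U x)^H) *m N *m U x by rewrite !mulmxA.
by rewrite UV mulmx1 !mulmxA.
Qed.

Let conj_rtr x (M : op R Y) : rtr ((U x)^H *m M *m U x) = rtr M.
Proof. by rewrite rtrC mulmxA UV mul1mx. Qed.

Let conj_cst x (a : R) : a%:C%C%:M = (U x)^H *m dop (fun=> a) *m U x :> op R Y.
Proof. by rewrite dop_cst mul_mx_scalar -scalemxAl VU scalemx1. Qed.

Let conj_one x : 1%:M = (U x)^H *m dop (fun=> 1) *m U x :> op R Y.
Proof. by rewrite -conj_cst rmorph1. Qed.

Let conjB x (M N : op R Y) :
  (U x)^H *m M *m U x - (U x)^H *m N *m U x = (U x)^H *m (M - N) *m U x.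
Proof. by rewrite mulmxBr mulmxBl. Qed.

Let lam_ge0 x y : 0 <= lam x y.
Proof. by apply: prodr_ge0 => i _; apply: eigv_ge0. Qed.

Let sum_lam x : \sum_y lam x y = 1.
Proof.
rewrite -rtr_dop -(conj_rtr x) -WE /rtr trE; under eq_bigr => y _ do rewrite rent_mkop.
rewrite (sum_prod_tpow g_bij (fun i t => rent (W (x i)) t t)) big1//= => i _.
by rewrite -trE trE_psd// trW.
Qed.

Let atypical_mean : avg (wt p) (fun x => \sum_y (~~ good x y)%:R * lam x y)
  <= avg q (fun z => k z ^+ 2) / (n%:R * d ^+ 2).
Proof.
(* A word with an eigenvector of its product state is regrouped as a sequence of pairs, i.i.d. under
   [q]. *)
pose fsts (z : {ffun 'I_n -> X * T}) : {ffun 'I_n -> X} := [ffun i => (z i).1].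
pose snds (z : {ffun 'I_n -> X * T}) : {ffun 'I_n -> T} := [ffun i => (z i).2].
have [g' gK g'K] := g_bij.
pose bad (z : {ffun 'I_n -> X * T}) := ~~ good (fsts z) (g' (snds z)).
have -> : avg (wt p) (fun x => \sum_y (~~ good x y)%:R * lam x y)
   = avg (wt q) (fun z => (bad z)%:R).
  rewrite /avg.
  transitivity (\sum_(x : {ffun 'I_n -> X}) \sum_(f : {ffun 'I_n -> T})
     wt p x * ((~~ good x (g' f))%:R * lam x (g' f))).
    apply: eq_bigr => x _; rewrite mulr_sumr (reindex g')//.
    by apply: onW_bij; exists g.
  rewrite pair_big /= (reindex (fun z => (fsts z, snds z))); last first.
    apply: onW_bij; exists (fun xf : {ffun 'I_n -> X} * {ffun 'I_n -> T} => [ffun i => (xf.1 i, xf.2 i)]).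
      by move=> z; apply/ffunP => i; rewrite !ffunE -surjective_pairing.
    by move=> [x f]; congr (_, _); apply/ffunP => i; rewrite !ffunE.
  apply: eq_bigr => z _ /=; rewrite /bad mulrCA mulrC; congr (_ * _).
  rewrite /wt /lam g'K -big_split; apply: eq_bigr => i _.
  by rewrite !ffunE.
apply: chebyshev => // z hbad wz.
have pos i : 0 < eigv (W (z i).1) (z i).2.
  rewrite lt_neqAle eigv_ge0// andbT eq_sym; apply: contraNneq wz => e0.
  by rewrite /wt (bigD1 i)//= /q e0 mulr0 mul0r.
have lamE : lam (fsts z) (g' (snds z)) = expR (- \sum_i - ln (eigv (W (z i).1) (z i).2)).
  rewrite -sumrN (big_morph expR (@expRD R) (expR0 R)); apply: eq_bigr => i _.
  by rewrite g'K !ffunE opprK lnK// posrE.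
have sumk : \sum_i k (z i) = \sum_i - ln (eigv (W (z i).1) (z i).2) - n%:R * H.
  by rewrite /k sumrB sumr_const card_ord mulr_natl.
move: hbad; rewrite /bad /good lamE /hi /lo -expRN !ler_expR negb_and -!ltNge.
by rewrite sumk ler_normr; move=> /orP[]; rewrite ltrN2 => h; apply/orP; [left|right]; lra.
Qed.

Lemma typical_projP eps : avg q (fun z => k z ^+ 2) / (n%:R * d ^+ 2) <= eps ->
  typical (wt p) (fun x => tpow g (fun i => W (x i))) eps lo hi typical_proj.
Proof.
move=> heps; split.
- move=> x; split; first by rewrite !hadjM hadjK dop_herm mulmxA.
  rewrite conjM dopM (@eq_dop _ _ _ (fun y => (good x y)%:R))// => y.
  by case: (good x y); rewrite ?mulr0 ?mulr1.
- apply: le_trans heps; apply: le_trans atypical_mean; rewrite le_eqVlt; apply/orP; left.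
  apply/eqP/eq_avg => x; rewrite WE (conj_one x) conjB conjM conj_rtr dopB dopM rtr_dop.
  by apply: eq_bigr => y _; case: (good x y); rewrite ?subrr ?subr0.
- move=> x; rewrite WE (conj_cst x) !conjM !dopM conjB dopB.
  apply: psdmx_congrH; apply: dop_psd => y; rewrite subr_ge0.
  case: (boolP (good x y)) => [/andP[_ h]|_]; first by rewrite mul1r mulr1.
  by rewrite mul0r mul0r expR_ge0.
move=> x; rewrite conj_rtr rtr_dop.
(* Each retained eigenvalue is at least [1 / hi] and all eigenvalues sum to 1, so at most [hi] are
   retained. *)
have -> : hi = \sum_y hi * lam x y by rewrite -mulr_sumr sum_lam mulr1.
apply: ler_sum => y _.
have h0 : 0 < hi by apply: expR_gt0.
case: (boolP (good x y)) => [/andP[h _]|_]; last by rewrite mulr_ge0// ltW.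
by rewrite -ler_pdivrMl// mulr1.
Qed.

End Power.

Lemma typical_exists (eps d : R) : 0 < eps -> 0 < d ->
  exists N : nat, forall n, (N <= n)%N -> forall (Y : finType) (g : Y -> {ffun 'I_n -> T}),
    bijective g -> exists Pi, typical (wt p) (fun x => tpow g (fun i => W (x i))) eps
      (expR (- (n%:R * (H - d)))) (expR (n%:R * (H + d))) Pi.
Proof.
move=> e0 d0; pose V := avg q (fun z => k z ^+ 2).
have V0 : 0 <= V by apply: sumr_ge0 => z _; rewrite mulr_ge0// sqr_ge0.
pose r := V / (eps * d ^+ 2).
have r0 : 0 <= r by rewrite divr_ge0// mulr_ge0 ?exprn_ge0 ?ltW.
exists (Num.bound r).+1 => n hn Y g hg; have n0 : (0 < n)%N by apply: leq_trans hn.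
exists (typical_proj g d); apply: typical_projP => //.
have nR : r <= n%:R.
  have := archi_boundP r0 => /ltW h; apply: le_trans h _; rewrite ler_nat.
  exact: ltnW.
have n1 : 0 < n%:R :> R by rewrite ltr0n.
rewrite ler_pdivrMr ?mulr_gt0 ?exprn_gt0//; move: nR; rewrite /r ler_pdivrMr ?mulr_gt0 ?exprn_gt0//.
by rewrite -/V mulrCA mulrA.
Qed.

End Typical.

(** * Entropies of classical-quantum states *)

Section CharPoly.
Variable K : fieldType.

Lemma char_poly_conj n (V M U : 'M[K]_n) : V *m U = 1%:M ->
  char_poly (V *m M *m U) = char_poly M.
Proof.
move=> h; pose m (A : 'M[K]_n) := map_mx polyC A.
have hm : m V *m m U = 1%:M by rewrite -map_mxM h map_mx1.
rewrite /char_poly; have -> : char_poly_mx (V *m M *m U) = m V *m char_poly_mx M *m m U.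
  by rewrite /char_poly_mx mulmxBr mulmxBl mul_mx_scalar -scalemxAl hm scalemx1 -!map_mxM.
by rewrite !det_mulmx mulrAC -det_mulmx hm det1 mul1r.
Qed.

Lemma char_poly_diag n (d : 'rV[K]_n) : char_poly (diag_mx d) = \prod_i ('X - (d ord0 i)%:P).
Proof.
rewrite char_poly_trig ?diag_mx_is_trig//.
by apply: eq_bigr => i _; rewrite mxE eqxx.
Qed.

(** [spectral_diag] comes from one chosen diagonalization; the characteristic polynomial shows that
    any other gives the same multiset. Entropies can then be computed from whatever diagonalization
    is at hand. *)
Lemma diag_conj_perm n (V U V' U' : 'M[K]_n) (d e : 'rV[K]_n) :
  V *m U = 1%:M -> V' *m U' = 1%:M -> V *m diag_mx d *m U = V' *m diag_mx e *m U' ->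
  perm_eq [seq d ord0 i | i <- index_enum 'I_n] [seq e ord0 i | i <- index_enum 'I_n].
Proof.
move=> h h' /(congr1 char_poly); rewrite !char_poly_conj// !char_poly_diag => e0.
by apply: prod_XsubC_eq; rewrite !big_map.
Qed.

End CharPoly.

Section Entropy.
Variable R : realType.
Local Notation C := R[i].

Lemma vN_dop (T : finType) (M U : op R T) (d : T -> R) :
  (forall t, 0 <= d t) -> U^H *m U = 1%:M -> M = U^H *m dop d *m U ->
  vN M = \sum_t eta (d t).
Proof.
move=> d0 hU eM; have hM : psdmx M by rewrite eM; apply/psdmx_congrH/dop_psd.
pose dr : 'rV[C]_#|T| := \row_i (d (enum_val i))%:C%C.
have dE : dop d = diag_mx dr.
  apply: ropP => y z; rewrite rent_mkop /rent !mxE enum_rankK (inj_eq enum_rank_inj).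
  by rewrite mulr_natl.
have sE : M = (spectralmx M)^H *m diag_mx (spectral_diag M) *m spectralmx M.
  by rewrite -spectralmx_inv; apply/orthomx_spectralP/herm_normal/psdmx_herm.
have hp : perm_eq [seq (spectral_diag M) ord0 i | i <- index_enum 'I_#|T|]
                  [seq dr ord0 i | i <- index_enum 'I_#|T|].
  by apply: diag_conj_perm (spectralmx_Vmul M) hU _; rewrite -sE -dE.
transitivity (\sum_(x <- [seq (spectral_diag M) ord0 i | i <- index_enum 'I_#|T|])
   eta (complex.Re x)); first by rewrite big_map.
rewrite (perm_big _ hp) big_map (reindex enum_rank) /=; last exact/onW_bij/enum_rank_bij.
by apply: eq_bigr => t _; rewrite mxE enum_rankK.
Qed.

Lemma eta_ge0M (a b : R) : 0 <= a -> 0 <= b -> eta (a * b) = b * eta a + a * eta b.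
Proof.
move=> a0 b0; rewrite /eta.
have [ha|ha] := leP a 0.
  have -> : a = 0 by apply/eqP; rewrite eq_le ha.
  by rewrite mul0r lexx mulr0 mul0r addr0.
have [hb|hb] := leP b 0.
  have -> : b = 0 by apply/eqP; rewrite eq_le hb.
  by rewrite mulr0 lexx mul0r addr0.
rewrite leNgt mulr_gt0//= lnM ?posrE//; ring.
Qed.

Section Block.
Variables X T : finType.
Implicit Types F G : X -> op R T.

Definition bdiag F : op R (X * T)%type := \sum_x tens (Defs.proj R x) (F x).

Lemma rent_bdiag F p q : rent (bdiag F) p q = (p.1 == q.1)%:R * rent (F p.1) p.2 q.2.
Proof.
rewrite rent_sum; under eq_bigr => x _ do rewrite rent_tens rent_proj -mulnb natrM -mulrA.
by rewrite (sum_delta p.1 (fun x => (q.1 == x)%:R * rent (F x) p.2 q.2)) [q.1 == _]eq_sym.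
Qed.

Lemma bdiagM F G : bdiag F *m bdiag G = bdiag (fun x => F x *m G x).
Proof.
apply: ropP => p q; rewrite rent_mul rent_bdiag rent_mul.
rewrite (eq_bigr (fun r : X * T => (p.1 == r.1)%:R * (rent (F p.1) p.2 r.2 *
  ((r.1 == q.1)%:R * rent (G r.1) r.2 q.2)))); last first.
  by move=> r _; rewrite !rent_bdiag -mulrA.
rewrite -(pair_bigA _ (fun x t => (p.1 == x)%:R * (rent (F p.1) p.2 t *
  ((x == q.1)%:R * rent (G x) t q.2)))) exchange_big /= mulr_sumr; apply: eq_bigr => t _.
rewrite (sum_delta p.1 (fun x => rent (F p.1) p.2 t * ((x == q.1)%:R * rent (G x) t q.2))).
by rewrite mulrCA.
Qed.

Lemma bdiag_hadj F : (bdiag F)^H = bdiag (fun x => (F x)^H).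
Proof.
apply: ropP => p q; rewrite rent_hadj !rent_bdiag rmorphM rmorph_nat eq_sym rent_hadj.
by have [->|_] := eqVneq p.1 q.1; rewrite ?mul0r.
Qed.

Lemma bdiag1 : bdiag (fun=> 1%:M) = 1%:M.
Proof. by apply: ropP => p q; rewrite rent_bdiag !rent1 -natrM mulnb -pair_eqE. Qed.

Lemma bdiag_dop (f : X -> T -> R) : bdiag (fun x => dop (f x)) = dop (fun p => f p.1 p.2).
Proof.
by apply: ropP => p q; rewrite rent_bdiag !rent_mkop mulrA -natrM mulnb -pair_eqE.
Qed.

End Block.

Section Holevo.
Variables (X T : finType) (P : X -> R) (W : X -> op R T).
Hypotheses (P0 : forall x, 0 <= P x).
Hypotheses (hW : forall x, psdmx (W x)) (trW : forall x, rtr (W x) = 1).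

Lemma cq_stateE : cq_state P W = bdiag (fun x => (P x)%:C%C *: W x).
Proof.
apply: eq_bigr => x _; rewrite !tens_projE.
by rewrite -scalemxAr -scalemxAl.
Qed.

Lemma vN_cq_state : vN (cq_state P W) = \sum_x eta (P x) + avg P (fun x => vN (W x)).
Proof.
pose U := bdiag (fun x => spectralmx (W x)).
rewrite (@vN_dop _ _ U (fun p => P p.1 * eigv (W p.1) p.2)).
- rewrite -(pair_bigA _ (fun x t => eta (P x * eigv (W x) t))) /avg -big_split /=.
  apply: eq_bigr => x _; under eq_bigr => t _ do rewrite eta_ge0M ?eigv_ge0//.
  by rewrite big_split /= -mulr_suml -mulr_sumr sum_eigv// trW mul1r -vNE.
- by move=> p; rewrite mulr_ge0// eigv_ge0.
- rewrite bdiag_hadj bdiagM -bdiag1; congr bdiag; apply/funext => x.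
  exact: spectralmx_Vmul.
rewrite cq_stateE -(bdiag_dop (fun x t => P x * eigv (W x) t)) bdiag_hadj !bdiagM.
congr bdiag; apply/funext => x.
have -> : dop (fun t => P x * eigv (W x) t) = (P x)%:C%C *: dop (eigv (W x)).
  by apply: ropP => y z; rewrite rentZ !rent_mkop rmorphM mulrCA.
by rewrite -scalemxAr -scalemxAl -spectral_dop.
Qed.

Lemma ptrace2_cq_state : ptrace2 (cq_state P W) = dop P.
Proof.
apply: ropP => x x'; rewrite !rent_mkop cq_stateE.
transitivity (\sum_t rent (bdiag (fun x => (P x)%:C%C *: W x)) (x, t) (x', t)); first by [].
under eq_bigr => t _ do rewrite rent_bdiag /= rentZ.
by rewrite -!mulr_sumr -trE trE_psd// trW mulr1.
Qed.

Lemma ptrace1_cq_state : ptrace1 (cq_state P W) = mean P W.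
Proof.
apply: ropP => t t'; rewrite rent_mkop cq_stateE rent_sum.
transitivity (\sum_x rent (bdiag (fun x => (P x)%:C%C *: W x)) (x, t) (x, t')); first by [].
by apply: eq_bigr => x _; rewrite rent_bdiag eqxx mul1r.
Qed.

(** Holevo form: the Shannon entropy of [P] cancels. *)
Lemma mutinf_cq_state :
  mutinf (cq_state P W) = vN (mean P W) - avg P (fun x => vN (W x)).
Proof.
rewrite /mutinf vN_cq_state ptrace1_cq_state ptrace2_cq_state.
have -> : vN (dop P) = \sum_x eta (P x).
  by apply: (@vN_dop _ _ 1%:M) => //; rewrite hadj1 ?mulmx1 ?mul1mx.
ring.
Qed.

End Holevo.

Lemma ptrace_mid_cq_state (X S B : finType) (P : X -> R) (W : X -> op R (S * B)%type) :
  ptrace_mid (cq_state P W) = cq_state P (fun x => ptrace1 (W x)).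
Proof.
apply: ropP => p q; rewrite rent_mkop !cq_stateE rent_bdiag rentZ rent_mkop.
transitivity (\sum_s rent (bdiag (fun x => (P x)%:C%C *: W x)) (p.1, (s, p.2)) (q.1, (s, q.2))).
  by [].
under eq_bigr => s _ do rewrite rent_bdiag /= rentZ.
by rewrite -!mulr_sumr.
Qed.

End Entropy.

(** * Asymptotics *)

Section Blocks.
Variable R : realType.
Local Notation C := R[i].

Definition zipt (S B : finType) n (q : tup n S * tup n B) : {ffun 'I_n -> S * B} :=
  [ffun i => (q.1 i, q.2 i)].

Lemma zipt_bij (S B : finType) n : bijective (@zipt S B n).
Proof.
exists (fun f : {ffun 'I_n -> S * B} =>
  ([ffun i => (f i).1] : tup n S, [ffun i => (f i).2] : tup n B)).
  by move=> [s b]; congr (_, _); apply/ffunP => i; rewrite !ffunE.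
by move=> f; apply/ffunP => i; rewrite !ffunE -surjective_pairing.
Qed.

Lemma Wpow_tpow (X S B : finType) (W : X -> op R (S * B)%type) n (x : tup n X) :
  Wpow W x = tpow (@zipt S B n) (fun i => W (x i)).
Proof.
apply: ropP => y z; rewrite !rent_mkop; apply: eq_bigr => i _.
by rewrite !ffunE.
Qed.

Lemma ptrace1_tpow (S B : finType) n (u : 'I_n -> op R (S * B)%type) :
  ptrace1 (tpow (@zipt S B n) u) = tpow (fun y : tup n B => y) (fun i => ptrace1 (u i)).
Proof.
apply: ropP => b b'; rewrite !rent_mkop.
transitivity (\sum_(s : tup n S) rent (tpow (@zipt S B n) u) (s, b) (s, b')); first by [].
under [RHS]eq_bigr => i _ do rewrite rent_mkop.
rewrite bigA_distr_bigA; apply: eq_bigr => s _; rewrite rent_mkop; apply: eq_bigr => i _.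
by rewrite !ffunE.
Qed.

Section Purification.
Variables (A B : finType) (rho : op R (A * B)%type) (n : nat).

(** The amplitudes of [n] copies of the purification, read as a map from [A^n] to [R^n B^n]. *)
Definition purif_mx : rop R (tup n (A * B)%type * tup n B)%type (tup n A) :=
  mkrop (fun (q : tup n (A * B)%type * tup n B) (a : tup n A) =>
    \prod_(i < n) ent (msqrt rho) (a i, q.2 i) (q.1 i)).

Lemma rent_purif_pow a q a' q' :
  rent (purif_pow rho n) (a, q) (a', q') = rent purif_mx q a * (rent purif_mx q' a')^*.
Proof.
rewrite !rent_mkrop rmorph_prod -big_split; apply: eq_bigr => i _.
exact: rent_mkop.
Qed.

Lemma purif_mx_gram :
  purif_mx *m purif_mx^H = tpow (@zipt (A * B)%type B n) (fun=> ptrace1 (purif rho)).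
Proof.
apply: ropP => q q'; rewrite rent_mul rent_mkop.
transitivity (\prod_(i < n) \sum_a ent (purif rho) (a, (q.1 i, q.2 i)) (a, (q'.1 i, q'.2 i))).
  rewrite bigA_distr_bigA; apply: eq_bigr => a _.
  rewrite rent_hadj !rent_mkrop rmorph_prod -big_split; apply: eq_bigr => i _.
  by apply/esym; exact: rent_mkop.
by apply: eq_bigr => i _; rewrite rent_mkop !ffunE.
Qed.

End Purification.

(** A single state is an ensemble over a one-letter alphabet, whose only block is [x0]. *)
Lemma typical_unit (T : finType) (M : op R T) (eps d : R) :
  psdmx M -> rtr M = 1 -> 0 < eps -> 0 < d ->
  exists N : nat, forall n, (N <= n)%N -> forall (Y : finType) (g : Y -> {ffun 'I_n -> T}),
    bijective g -> exists Pi : unit -> op R Y,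
      typical (fun=> 1) (fun=> tpow g (fun=> M)) eps
      (expR (- (n%:R * (vN M - d)))) (expR (n%:R * (vN M + d))) Pi.
Proof.
move=> hM trM e0 d0; pose one (_ : unit) : R := 1.
have one1 : \sum_u one u = 1 by rewrite (big_pred1 tt)// => -[].
have H1 : cond_entropy one (fun=> M) = vN M by rewrite /cond_entropy avg_cst.
have [N hN] := @typical_exists R T unit one (fun=> M) (fun=> ler01) one1 (fun=> hM)
  (fun=> trM) eps d e0 d0.
exists N => n hn Y g hg; have [Pi [h1 h2 h3 h4]] := hN n hn Y g hg.
move: h2 h3 h4; rewrite H1 => h2 h3 h4.
pose x0 : {ffun 'I_n -> unit} := [ffun=> tt].
exists (fun=> Pi x0); split=> //.
rewrite /avg (big_pred1 tt) => [|[]//]; rewrite mul1r; apply: le_trans h2.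
rewrite /avg (big_pred1 x0) => [|x]; first by rewrite /wt big1// mul1r.
by apply/esym/eqP/ffunP => i; rewrite ffunE; case: (x i).
Qed.

End Blocks.

Section Ensemble.
Variables (R : realType) (X S B : finType) (P : X -> R) (W : X -> op R (S * B)%type).
Local Notation C := R[i].
Hypotheses (P0 : forall x, 0 <= P x) (P1 : \sum_x P x = 1).
Hypotheses (hW : forall x, psdmx (W x)) (trW : forall x, rtr (W x) = 1).

Let HD := vN (mean P W).
Let HDX := avg P (fun x => vN (W x)).
Let HB := vN (ptrace1 (mean P W)).
Let HBX := avg P (fun x => vN (ptrace1 (W x))).
Let I1 := HD - HDX.
Let I2 := HB - HBX.

Lemma typical_ensemble (eps d : R) : 0 < eps -> 0 < d ->
  exists N : nat, forall n, (N <= n)%N ->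
  let Wn := fun x : tup n X => Wpow W x in
  exists (Pi : tup n X -> op R (tup n S * tup n B)%type)
         (Pi0 : unit -> op R (tup n S * tup n B)%type)
         (Q : tup n X -> op R (tup n B)) (Q0 : unit -> op R (tup n B)),
  [/\ typical (wt P) Wn eps (expR (- (n%:R * (HDX - d)))) (expR (n%:R * (HDX + d))) Pi,
      typical (fun=> 1) (fun=> mean (wt P) Wn) eps
        (expR (- (n%:R * (HD - d)))) (expR (n%:R * (HD + d))) Pi0,
      typical (wt P) (fun x => ptrace1 (Wn x)) eps
        (expR (- (n%:R * (HBX - d)))) (expR (n%:R * (HBX + d))) Q &
      typical (fun=> 1) (fun=> ptrace1 (mean (wt P) Wn)) eps
        (expR (- (n%:R * (HB - d)))) (expR (n%:R * (HB + d))) Q0].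
Proof.
move=> e0 d0.
have hM : psdmx (mean P W) by apply: mean_psd.
have trM : rtr (mean P W) = 1 by rewrite rtr_mean (eq_avg _ trW) avg_cst.
have hWB x : psdmx (ptrace1 (W x)) by apply: ptrace1_psd.
have trWB x : rtr (ptrace1 (W x)) = 1 by rewrite rtr_ptrace1.
have trMB : rtr (ptrace1 (mean P W)) = 1 by rewrite rtr_ptrace1.
have [N1 h1] := typical_exists P0 P1 hW trW e0 d0.
have [N2 h2] := typical_unit hM trM e0 d0.
have [N3 h3] := typical_exists P0 P1 hWB trWB e0 d0.
have [N4 h4] := typical_unit (ptrace1_psd hM) trMB e0 d0.
exists (maxn (maxn N1 N2) (maxn N3 N4)) => n; rewrite !geq_max => /andP[/andP[n1 n2] /andP[n3 n4]] Wn.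
have bz := @zipt_bij S B n.
have bid : bijective (fun y : tup n B => y) by exists id.
have WE : Wn = fun x => tpow (@zipt S B n) (fun i => W (x i)).
  by apply/funext => x; rewrite /Wn Wpow_tpow.
have WBE : (fun x => ptrace1 (Wn x)) =
    fun x => tpow (fun y : tup n B => y) (fun i => ptrace1 (W (x i))).
  by rewrite WE; apply/funext => x; rewrite ptrace1_tpow.
have ME : mean (wt P) Wn = tpow (@zipt S B n) (fun=> mean P W).
  by rewrite WE; apply: tpow_mean.
have [Pi hPi] := h1 n n1 _ _ bz; have [Pi0 hPi0] := h2 n n2 _ _ bz.
have [Q hQ] := h3 n n3 _ _ bid; have [Q0 hQ0] := h4 n n4 _ _ bid.
exists Pi, Pi0, Q, Q0; split.
- by rewrite WE.
- by rewrite ME.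
- by rewrite WBE.
by rewrite ME ptrace1_tpow.
Qed.

Lemma Wpow_psd n (x : tup n X) : psdmx (Wpow W x).
Proof.
rewrite Wpow_tpow; have bz := @zipt_bij S B n.
have -> : tpow (@zipt S B n) (fun i => W (x i)) =
  (tpow (@zipt S B n) (fun i => sqrtmx (W (x i)))) *m
  (tpow (@zipt S B n) (fun i => sqrtmx (W (x i))))^H.
  rewrite tpow_hadj tpowM//; apply: eq_tpow => i.
  by rewrite sqrtmx_herm// sqrtmxK.
exact: psdmx_gram.
Qed.

Lemma rtr_Wpow n (x : tup n X) : rtr (Wpow W x) = 1.
Proof.
rewrite Wpow_tpow /rtr trE; under eq_bigr => y _ do rewrite rent_mkop.
rewrite (sum_prod_tpow (@zipt_bij S B n) (fun i t => rent (W (x i)) t t)) big1//= => i _.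
by rewrite -trE trE_psd// trW.
Qed.

Let wtP0 n (x : tup n X) : 0 <= wt P x. Proof. exact: wt_ge0. Qed.
Let wtP1 n : \sum_(x : tup n X) wt P x = 1. Proof. exact: sum_wt. Qed.

(** The truncation is [K.-1], the number of competitors in a bin. Its exponent [I2 - 3 d] against
    the rate [I2 - 2 d] of a false alarm leaves [- d]. *)
Lemma packing_rate n (d : R) :
  (Num.trunc (expR (n%:R * (I2 - 3 * d))))%:R
    * (expR (n%:R * (HBX + d)) * expR (- (n%:R * (HB - d)))) <= expR (- (n%:R * d)).
Proof.
have /andP[h _] := truncn_itv (expR_ge0 (n%:R * (I2 - 3 * d))).
apply: le_trans (ler_wpM2r _ h) _; first by rewrite mulr_ge0// expR_ge0.
by rewrite -!expRD ler_expR /I2; lra.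
Qed.

Lemma expRN_small (d s : R) : 0 < d -> 0 < s ->
  exists N : nat, forall n, (N <= n)%N -> expR (- (n%:R * d)) <= s.
Proof.
move=> d0 s0; pose r := (s * d)^-1.
have r0 : 0 <= r by rewrite invr_ge0 mulr_ge0// ltW.
exists (Num.bound r) => n hn.
have nr : r <= n%:R.
  by apply: le_trans (ltW (archi_boundP r0)) _; rewrite ler_nat.
rewrite expRN -[s]invrK lef_pV2 ?posrE ?expR_gt0 ?invr_gt0//.
apply: le_trans (expR_ge1Dx _); apply: le_trans (_ : n%:R * d <= _); last by rewrite lerDr.
move: nr; rewrite /r invfM -ler_pdivlMr ?invr_gt0// invrK//.
Qed.

Lemma holevo_ptrace1_le : I2 <= I1.
Proof.
(* As [I2 = I1 + 8 d], a code with about [exp (n (I2 - 3 d))] words has [a1 * a2 / K] at most [exp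
   (n (I1 + 2 d - I2 + 3 d)) = exp (- 3 n d)]. *)
rewrite leNgt; apply/negP => lt12; pose d := (I2 - I1) / 8.
have d0 : 0 < d by rewrite divr_gt0// subr_gt0.
(* These constants keep the right-hand side of [packing_converse] below 0.8, although it should be
   at least 1. *)
have e0 : 0 < 1000%:R^-1 :> R by rewrite invr_gt0 ltr0n.
have s0 : 0 < 10%:R^-1 :> R by rewrite invr_gt0 ltr0n.
have [N hN] := typical_ensemble e0 d0; have [N' hN'] := expRN_small d0 s0.
pose n := maxn N N'; have [Pi [Pi0 [Q [Q0 [hPi hPi0 hQ hQ0]]]]] := hN n (leq_maxl _ _).
have small := hN' n (leq_maxr _ _).
pose K := (Num.trunc (expR (n%:R * (I2 - 3 * d)))).+1.
have d'0 : 0 < 100%:R^-1 :> R by rewrite invr_gt0 ltr0n.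
have t0 : 0 < 32%:R :> R by rewrite ltr0n.
have := packing_converse (@wtP0 n) (wtP1 n) (@Wpow_psd n) (@rtr_Wpow n) hPi hPi0 hQ hQ0
  (expR_ge0 _) t0 (K := K) (ltn0Sn _) d'0.
rewrite [K.-1]/=.
have h1 := packing_rate n d.
have h2 : expR (- (n%:R * (HDX - d))) * expR (n%:R * (HD + d)) / K%:R <= expR (- (n%:R * d)).
  have /andP[_ h] := truncn_itv (expR_ge0 (n%:R * (I2 - 3 * d))).
  rewrite ler_pdivrMr ?ltr0n//; apply: le_trans (ler_wpM2l (expR_ge0 _) (ltW h)).
  rewrite -!expRD ler_expR.
  have e : I2 = I1 + 8 * d by rewrite /d; field.
  rewrite e /I1; have : 0 <= n%:R * d by rewrite mulr_ge0// ltW.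
  nra.
move: h1 h2 small.
set x := _ * (_ * expR _); set y := _ / K%:R; set z := expR _ => h1 h2 small.
by rewrite leNgt => /negP; apply; lra.
Qed.

End Ensemble.

(** [x] stands for [a1 * a2 / (M * K)] and [y] for [K.-1 * (b1 * b2)], the only quantities that
    depend on the block length. *)
Lemma protocol_parameters (R : realType) (eps : R) : 0 < eps ->
  exists s t u d e sg : R, [/\ 0 < s, 0 < t, 0 < u & [/\ 0 < d, 0 < e, 0 < sg &
  forall x y, 0 <= x -> x <= sg -> y <= sg ->
    4 * ((1 + s) * (2 * ((1 + t) * (2 * e) + 2 / t) + (u * x + u^-1) / 2 + d) + 2 / s
         + (2 + s) * (2 * (e + ((1 + t) * e + 1 / t)) + 4 * (y + d))) <= eps]].
Proof.
(* The choices are made in order: [s] fixes the prefactor [c], then [k] is the unit of error,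
   [t = u = 1 / k], and last [e] and [sg] undo the factors [u]. The total is 14 units, that is
   [14 eps / 40], besides the [eps / 4] from [2 / s]. *)
move=> e0; pose s := 32 / eps; have s0 : 0 < s by rewrite divr_gt0.
pose c := 4 * (2 + s); have c0 : 0 < c by rewrite /c; lra.
pose k := eps / (40 * c); have k0 : 0 < k by rewrite divr_gt0// mulr_gt0.
pose u := k^-1; have u0 : 0 < u by rewrite invr_gt0.
pose e := k / (8 + 6 * u); have u6 : 0 < 8 + 6 * u by lra.
have ee0 : 0 < e by rewrite divr_gt0.
pose sg := k / (u / 2 + 4); have u4 : 0 < u / 2 + 4 by lra.
have sg0 : 0 < sg by rewrite divr_gt0.
exists s, u, u, k, e, sg; split=> //; split=> // x y x0 hx hy.
have uV : u^-1 = k by rewrite /u invrK.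
have u2 : 2 / u = 2 * k by rewrite uV.
have u1 : 1 / u = k by rewrite uV mul1r.
have he : (8 + 6 * u) * e = k by rewrite /e mulrC divfK// gt_eqF.
have hs : (u / 2 + 4) * sg = k by rewrite /sg mulrC divfK// gt_eqF.
have s2 : 4 * (2 / s) = eps / 4 by rewrite /s; field; rewrite gt_eqF.
have ck : c * k = eps / 40 by rewrite /k; field; rewrite gt_eqF.
pose U := 2 * ((1 + u) * (2 * e) + 2 / u) + (u * x + u^-1) / 2 + k.
pose V := 2 * (e + ((1 + u) * e + 1 / u)) + 4 * (y + k).
have U0 : 0 <= U.
  have h1 : 0 <= (1 + u) * (2 * e) by apply: mulr_ge0; lra.
  have h2 : 0 <= u * x by rewrite mulr_ge0// ltW.
  by rewrite /U u2 uV; lra.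
have UV : U + V <= 14 * k.
  have h1 : u * x <= u * sg by rewrite ler_pM2l.
  by rewrite /U /V u2 u1 uV; lra.
have -> : 4 * ((1 + s) * U + 2 / s + (2 + s) * V) = c * (U + V) - 4 * U + 4 * (2 / s).
  by rewrite /c; ring.
have : c * (U + V) <= c * (14 * k) by rewrite ler_pM2l.
rewrite mulrCA ck s2; lra.
Qed.

Lemma rtr_density (R : realType) (T : finType) (M : op R T) :
  density M -> psdmx M /\ rtr M = 1.
Proof. by move=> [/psdE hM trM]; split=> //; rewrite /rtr trM. Qed.

Theorem theorem1 (R : realType) (A B X : finType) (rho : op R (A * B)%type)
  (W : X -> op R ((A * B) * B)%type) :
  density rho -> (forall x, density (W x)) ->
  (exists P : X -> R, in_calA rho W P) ->
  forall r : R,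
    (exists P : X -> R, in_calA rho W P /\ I_X_RB P W - I_X_B P W <= r) ->
    achievable rho W r.
Proof.
move=> _ dW _ r [P [[[P0 P1] hcalA] hr]] eps eps0.
have hW x : psdmx (W x) by have [] := rtr_density (dW x).
have trW x : rtr (W x) = 1 by have [] := rtr_density (dW x).
pose HD := vN (mean P W); pose HDX := avg P (fun x => vN (W x)).
pose HB := vN (ptrace1 (mean P W)); pose HBX := avg P (fun x => vN (ptrace1 (W x))).
have le12 : HB - HBX <= HD - HDX := holevo_ptrace1_le P0 P1 hW trW.
have {}hr : HD - HDX - (HB - HBX) <= r.
  move: hr; rewrite /I_X_RB /I_X_B mutinf_cq_state// ptrace_mid_cq_state mutinf_cq_state//.
  - by rewrite -mean_ptrace1.
  - by move=> x; apply: ptrace1_psd.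
  - by move=> x; rewrite rtr_ptrace1.
have [s [t [u [d [e [sg [s0 t0 u0 [d0 e0 sg0 bound]]]]]]]] := protocol_parameters eps0.
(* The rate will exceed [I1 - I2] by [6 dl = eps / 2]; the other half of [eps] absorbs a constant
   divided by [n]. *)
pose dl := eps / 12; have dl0 : 0 < dl by rewrite divr_gt0.
have [N1 hN1] := typical_ensemble P0 P1 hW trW e0 dl0.
have [N2 hN2] := expRN_small dl0 sg0.
exists (maxn (maxn N1 N2) (Num.bound (4 / eps))).+1 => n hn.
have : (maxn (maxn N1 N2) (Num.bound (4 / eps)) <= n)%N by apply: ltnW.
rewrite !geq_max => /andP[/andP[n1 n2] n3].
have n0 : (0 < n)%N by apply: leq_trans hn.
have nR : 0 < n%:R :> R by rewrite ltr0n.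
have n4 : 4 / eps <= n%:R.
  have h : 0 <= 4 / eps by rewrite divr_ge0// ltW.
  by apply: le_trans (ltW (archi_boundP h)) _; rewrite ler_nat.
have [Pi [Pi0 [Q [Q0 [hPi hPi0 hQ hQ0]]]]] := hN1 n n1.
pose I1 := HD - HDX; pose I2 := HB - HBX.
pose K := (Num.trunc (expR (n%:R * (I2 - 3 * dl)))).+1.
have /andP[K_le K_gt] := truncn_itv (expR_ge0 (n%:R * (I2 - 3 * dl))).
have KR : 0 < K%:R :> R by rewrite ltr0n.
(* [M * K] exceeds [E1], which beats [a1 * a2], of exponent [I1 + 2 dl], by a factor
   [exp (n dl)]. *)
pose E1 := expR (n%:R * (I1 + 3 * dl)).
have E10 : 0 <= E1 / K%:R by rewrite divr_ge0 ?expR_ge0.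
pose M := (Num.trunc (E1 / K%:R)).+1.
have /andP[M_le M_gt] := truncn_itv E10.
(* Membership in [in_calA] enters here: the random codewords average to the reduced state of the
   purification. *)
have hPhi : purif_mx rho n *m (purif_mx rho n)^H = mean (wt P) (fun x : tup n X => Wpow W x).
  rewrite purif_mx_gram -hcalA -/(mean P W) -tpow_mean.
  by apply: eq_bigr => x _; rewrite Wpow_tpow.
have [Om [Lam [f [hOm hLam err]]]] := random_protocol (wt_ge0 P0) (sum_wt _ P1)
  (Wpow_psd hW (n := n)) (rtr_Wpow hW trW (n := n)) hPi hPi0 hQ hQ0 (expR_gt0 _) (expR_ge0 _) t0
  (M := M) (K := K) (rent_purif_pow rho (n := n)) hPhi (ltn0Sn _) (ltn0Sn _) d0 u0 s0.
exists M.+1, K.+1, Om, Lam, f; split=> //; last first.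
  apply: le_trans err _; apply: bound.
  - by rewrite divr_ge0 ?ler0n// mulr_ge0 ?expR_ge0.
  - apply: le_trans (hN2 n n2).
    rewrite ler_pdivrMr ?ltr0n// natrM; apply: le_trans (_ : expR (- (n%:R * dl)) * E1 <= _).
      by rewrite /E1 -!expRD ler_expR /I1 /HD /HDX; lra.
    apply: ler_wpM2l; first exact: expR_ge0.
    by rewrite -ler_pdivrMr// ltW.
  apply: le_trans (hN2 n n2); rewrite [K.-1]/=; exact: packing_rate.
clear err hPi hPi0 hQ hQ0 bound hPhi hcalA.
have z_ge : E1 / K%:R <= expR (n%:R * (I1 - I2 + 6 * dl)).
  rewrite ler_pdivrMr//; apply: le_trans (ler_wpM2l (expR_ge0 _) (ltW K_gt)).
  by rewrite -expRD ler_expR; lra.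
(* Here [I2 <= I1] is used: otherwise the additive constants in [M.+1] could dominate. *)
have z1 : 1 <= expR (n%:R * (I1 - I2 + 6 * dl)).
  apply: le_trans (expR_ge1Dx _); rewrite lerDl mulr_ge0// ?ler0n//.
  by move: le12; rewrite /I1 /I2; lra.
(* [M.+1] is a truncation plus 2, hence at most three times the exponential, and 3 is at most
   [expR 2]. *)
have Th_le : M.+1%:R <= expR (2 + n%:R * (I1 - I2 + 6 * dl)).
  have e2 : 1 + 2 <= expR 2 :> R := expR_ge1Dx 2.
  rewrite expRD; apply: le_trans (ler_wpM2r (expR_ge0 _) e2).
  rewrite -natr1 /M -natr1.
  by move: M_le z_ge z1; lra.
have lnTh : ln (M.+1%:R) <= 2 + n%:R * (I1 - I2 + 6 * dl).
  by rewrite -[leRHS]expRK ler_ln// posrE ?expR_gt0 ?ltr0n.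
rewrite ler_pdivrMr//; apply: le_trans lnTh _.
have h2 : 2 <= eps / 2 * n%:R by move: n4; rewrite ler_pdivrMr//; lra.
have h3 : n%:R * (I1 - I2) <= n%:R * r by rewrite ler_pM2l.
have e6 : 6 * dl = eps / 2 by rewrite /dl; field.
rewrite e6; lra.
Qed.
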